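(* The spectrum of the operator $\mathcal P:\mathcal H_0\to\mathcal H_0$ is the union of the interval $[0,1]$ and a finite or countably infinite set of eigenvalues of finite multiplicity.
   Context: Let $m$ be the measure on $\mathbb R^+=(0,\infty)$ given by $dm(t)=\frac{t}{e^t-1}\,dt$, and $L_2(m)$ the complex Hilbert space of square-integrable functions. $\mathcal H_0$ is the Hilbert space of all functions of the form $$f(w)=(\mathcal B[\varphi])(w):=\frac1{w^2}\int_0^\infty e^{-t/w}\,e^t\,\varphi(t)\,dm(t),\qquad \varphi\in L_2(m),$$ which are holomorphic in the disk $\{w\in\mathbb C:\operatorname{Re}(1/w)>1/2\}=\{|w-1|<1\}$, with inner product $(\mathcal B[\varphi_1],\mathcal B[\varphi_2])=\int_0^\infty\overline{\varphi_1}\,\varphi_2\,dm$. $\mathcal P$ is the transfer operator of the Farey map ($F(x)=x/(1-x)$ for $0\le x\le 1/2$, $F(x)=(1-x)/x$ for $1/2<x\le1$), acting on $\mathcal H_0$ by $$(\mathcal P f)(w)=\Big(\frac1{w+1}\Big)^2\Big[f\Big(\frac w{w+1}\Big)+f\Big(\frac1{w+1}\Big)\Big].$$ *)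

(* Defs.v *)
From HB Require Import structures.
From mathcomp Require Import all_boot all_order all_algebra.
From mathcomp Require Import complex ring lra.
From mathcomp Require Import all_classical all_reals all_analysis.
From mathcomp Require Import measurable_realfun.

Set Implicit Arguments.
Unset Strict Implicit.
Unset Printing Implicit Defensive.

Import Order.TTheory GRing.Theory Num.Theory.
Import numFieldNormedType.Exports.

Local Open Scope classical_set_scope.
Local Open Scope ring_scope.
Local Open Scope complex_scope.

Local Notation Re := complex.Re.
Local Notation Im := complex.Im.

(* The operator acts on the subspace [H] of the complex vector space [V], with
   norm [nrm]; it is given by a map [T] on [V], of which only the restriction to
   [H], assumed to map [H] to itself, is considered. *)

Section Spectrum.
Context {R : realType} {V : lmodType R[i]}.
Variables (H : set V) (nrm : V -> R) (T : V -> V).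

(* [T - lambda] is a bijection of [H] onto itself, with bounded inverse [S]. *)
Definition resolvent_set : set R[i] := [set lambda |
  exists S : V -> V,
    [/\ forall g, H g -> H (S g),
        forall f, H f -> S (T f - lambda *: f) = f,
        forall g, H g -> T (S g) - lambda *: S g = g &
        exists M : R, forall g, H g -> nrm (S g) <= M * nrm g]].

Definition spectrum : set R[i] := ~` resolvent_set.

Definition eigenspace (lambda : R[i]) : set V :=
  [set f | H f /\ T f = lambda *: f].

Definition is_eigenvalue (lambda : R[i]) : Prop :=
  exists2 f, eigenspace lambda f & f != 0.

Definition finite_multiplicity (lambda : R[i]) : Prop :=
  exists (n : nat) (v : 'I_n -> V), forall f, eigenspace lambda f ->
    exists c : 'I_n -> R[i], f = \sum_(k < n) c k *: v k.

End Spectrum.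

Section Measure.
Context {R : realType}.

Definition dens (t : R) : R := t / (expR t - 1).

Lemma dens_ge0 (t : R) : t \in `]0, +oo[ -> 0 <= dens t.
Proof.
rewrite in_itv/= andbT => t0; rewrite /dens divr_ge0 ?ltW//.
by rewrite subr_gt0 -expR0 ltr_expR.
Qed.

Lemma measurable_dens : measurable_fun (`]0%R, +oo[ : set R) dens.
Proof.
apply: open_continuous_measurable_fun; first exact: interval_open.
move=> t; rewrite inE/= in_itv/= andbT => t0.
rewrite /dens; apply: cvgM; first exact: cvg_id.
apply: cvgV; first by rewrite gt_eqF// subr_gt0 -expR0 ltr_expR.
by apply: cvgB; [exact: continuous_expR | exact: cvg_cst].
Qed.

(* [dm(t) = t / (e^t - 1) dt] on [(0, +oo)], extended by zero to a measure on
   all of [R]. *)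
Definition m : set (measurableTypeR R) -> \bar R := fun A =>
  (\int[lebesgue_measure]_(t in A `&` `]0%R, +oo[) (dens t)%:E)%E.

Let m0 : m set0 = 0%E.
Proof. by rewrite /m set0I integral_set0. Qed.

Let m_ge0 A : (0 <= m A)%E.
Proof.
by apply: integral_ge0 => t [_ t0]; rewrite lee_fin dens_ge0.
Qed.

Let m_sigma_additive : semi_sigma_additive m.
Proof.
move=> /= F mF tF mUF.
rewrite /m setI_bigcupl ge0_integral_bigcup//=.
- apply: is_cvg_ereal_nneg_natsum_cond => n _ _.
  by apply: integral_ge0 => t [_ t0]; rewrite lee_fin dens_ge0.
- by move=> k; apply: measurableI.
- by apply/measurable_EFinP; apply: measurable_funS measurable_dens => // t [k _ []].
- by move=> t [k _ [_ t0]]; rewrite lee_fin dens_ge0.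
- exact: trivIset_setIr.
Qed.

HB.instance Definition _ := isMeasure.Build _ _ _ m m0 m_ge0 m_sigma_additive.

End Measure.

(* Elements of the complex Hilbert space [L_2(m)] are represented by functions
   [R -> R[i]], of which only the values on [(0, +oo)] matter, and those only up
   to [m]-null sets. *)

Section L2.
Context {R : realType}.
Local Notation Rpos := (`]0%R, +oo[%classic : set R).
Implicit Types phi psi : R -> R[i].

Definition complex_exp (z : R[i]) : R[i] :=
  (expR (Re z))%:C * (cos (Im z) +i* sin (Im z)).

Definition cintegral phi : R[i] :=
  Rintegral m Rpos (@complex.Re R \o phi : R -> R)
  +i* Rintegral m Rpos (@complex.Im R \o phi : R -> R).

Definition L2 : set (R -> R[i]) := [set phi : R -> R[i] |
  [/\ measurable_fun Rpos (@complex.Re R \o phi : R -> R),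
      measurable_fun Rpos (@complex.Im R \o phi : R -> R) &
      (\int[m]_(t in Rpos) ((Normc.normc (phi t)) ^+ 2)%:E < +oo)%E]].

Definition L2inner phi psi : R[i] :=
  cintegral (fun t => (phi t)^* * psi t).

End L2.

Section H0.
Context {R : realType}.

(* The disk [|w - 1| < 1], see [diskE]; [Re 0^-1 = 0] excludes [w = 0]. *)
Definition disk : Type := {w : R[i] | 2^-1 < Re w^-1}.

Lemma diskE (w : R[i]) : (2^-1 < Re w^-1) = (`|w - 1| < 1).
Proof.
case: w => a b; have -> : Re (a +i* b)^-1 = a / (a ^+ 2 + b ^+ 2) by [].
have -> : (`|a +i* b - 1| < 1) = (a ^+ 2 + b ^+ 2 < 2 * a).
  rewrite normc_def/= ltcE/= eqxx/= oppr0 addr0.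
  rewrite -[X in _ < X]sqrtr1 ltr_sqrt// -[RHS]subr_gt0 -[LHS]subr_gt0.
  by congr (0 < _); ring.
have [n0|] := ltrP 0 (a ^+ 2 + b ^+ 2).
  by rewrite ltr_pdivlMr// mulrC ltr_pdivrMr// [a * 2]mulrC.
rewrite le_eqVlt ltNge addr_ge0 ?sqr_ge0// orbF.
rewrite paddr_eq0 ?sqr_ge0// !sqrf_eq0 => /andP[/eqP-> /eqP->].
by rewrite mul0r mulr0 expr0n/= addr0 ltxx; apply/negbTE; rewrite -leNgt invr_ge0.
Qed.

Definition laplace (phi : R -> R[i]) : disk -> R[i] := fun w =>
  (sval w ^+ 2)^-1 *
  cintegral (fun t => complex_exp (- t%:C / sval w) * (expR t)%:C * phi t).

Definition H0 : set (disk -> R[i]) := laplace @` L2.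

(* [laplace] is injective on [L2] up to equality [m]-almost everywhere, so the
   inner product below does not depend on the choice of preimages. *)
Definition laplace_inv (f : disk -> R[i]) : R -> R[i] :=
  xget (fun=> 0) [set phi | L2 phi /\ laplace phi = f].

Definition H0inner (f g : disk -> R[i]) : R[i] :=
  L2inner (laplace_inv f) (laplace_inv g).

Definition H0norm (f : disk -> R[i]) : R := Num.sqrt (Re (H0inner f f)).

End H0.
Arguments disk : clear implicits.

Section Transfer.
Context {R : realType}.

Lemma disk_left (w : disk R) : 2^-1 < Re (sval w / (sval w + 1))^-1.
Proof.
case: w => w /= wD; have [w0|w0] := eqVneq w 0.
  by move: wD; rewrite w0 invr0/= ltNge invr_ge0 ler0n.
rewrite invf_div mulrDl divff// mul1r.
have -> : Re (1 + w^-1) = 1 + Re w^-1 by case: (w^-1).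
by rewrite (lt_trans wD)// ltrDr.
Qed.

Lemma disk_right (w : disk R) : 2^-1 < Re (1 / (sval w + 1))^-1.
Proof.
rewrite div1r invrK; case: w => -[a b] /= wD.
suff a0 : 0 < a by lra.
rewrite ltNge; apply/negP => a0; move: wD; apply/negP; rewrite -leNgt.
apply: (@le_trans _ _ 0); last by rewrite invr_ge0.
by rewrite mulr_le0_ge0// invr_ge0 addr_ge0 ?sqr_ge0.
Qed.

Definition transfer (f : disk R -> R[i]) : disk R -> R[i] := fun w =>
  (1 / (sval w + 1)) ^+ 2 *
  (f (exist _ (sval w / (sval w + 1)) (disk_left w)) +
   f (exist _ (1 / (sval w + 1)) (disk_right w))).

End Transfer.

(* Main.v *)
Require Import Defs.
From HB Require Import structures.
From mathcomp Require Import all_boot all_order all_algebra.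
From mathcomp Require Import complex ring lra.
From mathcomp Require Import all_classical all_reals all_analysis.
From mathcomp Require Import measurable_realfun.

Set Implicit Arguments.
Unset Strict Implicit.
Unset Printing Implicit Defensive.

Import Order.TTheory GRing.Theory Num.Theory.
Import numFieldNormedType.Exports.

Local Open Scope classical_set_scope.
Local Open Scope ring_scope.

(* Substituting w -> 1/w turns f = laplace phi into an ordinary Laplace
   transform, and transfer becomes the operator A = M + N on L_2(m), where
   M is multiplication by e^-t and N phi (t) = (1 - e^-t) * K phi (t), with
   K the integral operator of kernel J_1(2 sqrt(t s)) / sqrt(t s) for m.

   [0,1] is in the spectrum: on the indicator function of a short interval of
   length d, A - lambda is as small as e^-t - lambda, since N contributes
   only O(d) pointwise.

   Outside [0,1]: the kernel of N is bounded and the limit of degenerate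
   kernels, so A - lambda is a finite rank perturbation of an invertible
   operator given by a Neumann series. The Fredholm alternative then shows that
   spectral points are eigenvalues of finite multiplicity.

   Countability: (1 - e^-t)^(1/2) symmetrizes A, hence the eigenvalues outside
   [0,1] are real with orthogonal eigenvectors; by Bessel's inequality only
   finitely many of them are at distance at least e from [0,1], because
   the kernel has finite Hilbert-Schmidt norm. *)

(** The Bessel kernel is forced by the second branch. With z = 1/w that branch produces the kernel
    z^-2 e^(-s/z), which is the Laplace transform in t of J_1(2 sqrt(t s)) / sqrt(t s) against t dt;
    the weight e^t of [laplace] and the density t / (e^t - 1) leave exactly the factor 1 - e^-t to
    be supplied by N. Two facts keep the analysis elementary: m is finite, and |J_1(2 sqrt x) / sqrt
    x| <= 1 for x >= 0. Hence N sends integrable functions to bounded ones, and series of iterated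
    kernels converge at each point under an integrable bound. The recurring obstacle is that an
    element of H_0 determines its preimage in L_2(m) only up to a null set, while [laplace_inv]
    picks one representative. Injectivity of [laplace] up to null functions makes the norm
    computable, and every map or functional passing through [laplace_inv] has to be shown
    insensitive to the choice, usually by Cauchy-Schwarz or by a norm bound. *)

Local Notation Re := (@complex.Re _).
Local Notation Im := (@complex.Im _).
Local Notation mu := (@lebesgue_measure _).
Local Notation Rpos := (`]0%R, +oo[%classic : set (Real.sort _)).
Local Notation L1 u := (m.-integrable Rpos (EFin \o (u : Real.sort _ -> Real.sort _))).
Local Notation meas u := (measurable_fun Rpos (u : Real.sort _ -> Real.sort _)).
Local Notation mint u := (\int[m]_(t in Rpos) (u : Real.sort _ -> Real.sort _) t).

(** * The measure m *)

Section Measure.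
Context {R : realType}.

(** After clearing denominators this is [1 + t <= expR t]. The factor [expR (- t)] makes m finite
    and leaves room to integrate exponentials of rate below 1. *)
Lemma dens_le (t : R) : 0 < t -> dens t <= (1 + t) * expR (- t).
Proof.
move=> t0; rewrite /dens; have e1 : 0 < expR t - 1.
  by rewrite subr_gt0 -expR0 ltr_expR.
rewrite ler_pdivrMr// expRN -mulrA [_^-1 * _]mulrC mulrBl mul1r divff ?gt_eqF ?expR_gt0//.
rewrite mulrBr mulr1 -subr_ge0 (_ : _ - _ = ((expR t) - (1 + t)) / expR t); last first.
  by field; rewrite gt_eqF ?expR_gt0.
by rewrite divr_ge0 ?expR_ge0// subr_ge0 expR_ge1Dx.
Qed.

Lemma dens_le1 (t : R) : 0 < t -> dens t <= 1.
Proof.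
move=> t0; rewrite /dens ler_pdivrMr ?mul1r; last first.
  by rewrite subr_gt0 -expR0 ltr_expR.
by rewrite lerBrDl expR_ge1Dx.
Qed.

Lemma dens_gt0 (t : R) : 0 < t -> 0 < dens t.
Proof. by move=> t0; rewrite divr_gt0// subr_gt0 -expR0 ltr_expR. Qed.

Lemma continuous_expRM (c : R) : continuous (fun t : R => expR (c * t)).
Proof.
move=> t; apply: (@continuous_comp _ _ _ (fun t => c * t) expR).
  exact: mulrl_continuous.
exact: continuous_expR.
Qed.

Lemma measurable_expRM (c : R) D : measurable_fun D (fun t : R => expR (c * t)).
Proof.
apply: measurable_funTS; apply: continuous_measurable_fun.
exact: continuous_expRM.
Qed.

Lemma integral_expRN (r : R) : 0 < r ->
  (\int[mu]_(t in Rpos) (expR (- r * t))%:E = (r^-1)%:E)%E.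
Proof.
move=> r0; have ce := @continuous_expRM (- r).
rewrite integral_itv_obnd_cbnd; last first.
  by apply/measurable_EFinP; exact: measurable_expRM.
rewrite (@ge0_continuous_FTC2y _ _ (fun t => - r^-1 * expR (- r * t)) _ 0).
- by rewrite mulr0 expR0 mulr1 EFinN oppeK add0e.
- by move=> t _; exact: expR_ge0.
- exact: continuous_subspaceT.
- rewrite -[X in _ --> X](mulr0 (- r^-1)); apply: cvgMr.
  rewrite (_ : (fun x => expR (- r * x)) =
               (fun z => expR (- z)) \o (fun z => r * z)); last first.
    by apply: eq_fun => x; rewrite mulNr.
  apply: (@cvg_comp _ _ _ _ _ _ (pinfty_nbhs R)); last exact: cvgr_expR.
  exact: gt0_cvgMry.
- by move=> t _; exact: ex_derive.
- by apply: cvg_at_right_filter; apply: cvgMr; exact: ce.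
- move=> t _; rewrite derive1E.
  have d : is_derive t (1 : R) (fun t => - r^-1 * expR (- r * t)) (expR (- r * t)).
    by apply: is_derive_eq; rewrite /GRing.scale/= mulr1; field; rewrite gt_eqF.
  by rewrite derive_val.
Qed.

(** The density is at most 2 e^(-t/2), because 1 + t <= 2 (1 + t/2) <= 2 e^(t/2). Finiteness makes
    constants integrable and puts L_2(m) inside L_1(m). *)
Lemma m_fin : fin_num_fun (@m R).
Proof.
move=> A mA; rewrite ge0_fin_numE//.
have me D : measurable_fun D (fun t : R => (2 * expR (- 2^-1 * t))%:E).
  by apply/measurable_EFinP; apply: measurable_funM => //; exact: measurable_expRM.
apply: (@le_lt_trans _ _ (\int[mu]_(t in Rpos) (2 * expR (- 2^-1 * t))%:E)%E).
  apply: (@le_trans _ _ (\int[mu]_(t in A `&` Rpos) (2 * expR (- 2^-1 * t))%:E)%E).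
    apply: ge0_le_integral => //=.
    - exact: measurableI.
    - by move=> t [_ t0]; rewrite lee_fin dens_ge0.
    - apply/measurable_EFinP; apply: measurable_funS measurable_dens => //.
    - exact: me.
    - move=> t [_ /=]; rewrite in_itv/= andbT lee_fin => t0.
      rewrite (le_trans (dens_le t0))// (_ : - t = - 2^-1 * t + - 2^-1 * t); last by lra.
      rewrite expRD mulrA ler_wpM2r ?expR_ge0//.
      rewrite mulNr expRN ler_pdivrMr ?expR_gt0//.
      have := expR_ge1Dx (2^-1 * t); lra.
  apply: ge0_subset_integral => //=; first exact: measurableI.
  exact: me.
under eq_integral do rewrite EFinM.
rewrite ge0_integralZl//=.
- by rewrite integral_expRN// -EFinM ltry.
by apply/measurable_EFinP; exact: measurable_expRM.
Qed.

HB.instance Definition _ := Measure_isFinite.Build _ _ _ (@m R) m_fin.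

Lemma m_dominates : (@m R) `<< mu.
Proof.
apply/null_content_dominatesP => A mA muA.
rewrite /m null_set_integral//.
- exact: measurableI.
- apply: (measurable_funS (E:= Rpos)) => //.
  by apply/measurable_EFinP; exact: measurable_dens.
- apply: (@subset_measure0 _ _ _ mu _ A) => //.
  exact: measurableI.
Qed.

Import Radon_Nikodym_SigmaFinite.

(** The Radon-Nikodym theorem gives such a formula with an abstract derivative; that derivative has
    the same integral as [dens] over every measurable subset of the half-line, so the two agree
    almost everywhere. *)
Lemma ge0_integral_m (f : R -> \bar R) : measurable_fun Rpos f ->
  (forall t, 0 <= f t)%E ->
  (\int[m]_(t in Rpos) f t = \int[mu]_(t in Rpos) (f t * (dens t)%:E))%E.
Proof.
move=> mf f0.
have md : measurable_fun Rpos (EFin \o @dens R).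
  by apply/measurable_EFinP; exact: measurable_dens.
rewrite -(change_of_variables m_dominates f0)//.
have rn : ae_eq mu Rpos (Radon_Nikodym_SigmaFinite.f m mu) (EFin \o @dens R).
  apply: integral_ae_eq => //.
  - by apply: (integrableS measurableT) => //; apply: f_integrable; exact: m_dominates.
  - move=> E EP mE; rewrite -f_integral//; last exact: m_dominates.
    transitivity (\int[mu]_(t in E `&` Rpos) (dens t)%:E)%E => //.
    by rewrite setIidl.
apply: ge0_ae_eq_integral => //.
- apply: emeasurable_funM => //; apply: (measurable_int mu).
  by apply: (integrableS measurableT) => //; apply: f_integrable; exact: m_dominates.
- exact: emeasurable_funM.
- by move=> t _; rewrite mule_ge0// f_ge0//; exact: m_dominates.
- by move=> t t0; rewrite mule_ge0// lee_fin dens_ge0.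
- exact: ae_eqe_mul2l.
Qed.

Lemma L1_meas (u : R -> R) : L1 u -> meas u.
Proof. by move/(measurable_int m)/measurable_EFinP. Qed.

Lemma L1_le (u h : R -> R) : meas u -> L1 h ->
  (forall t, 0 < t -> `|u t| <= h t) -> L1 u.
Proof.
move=> mu_ Lh uh; apply: le_integrable Lh => //; first exact/measurable_EFinP.
move=> t /=; rewrite in_itv/= andbT => t0.
by rewrite lee_fin (le_trans (uh _ t0))// ler_norm.
Qed.

Lemma L1D (u v : R -> R) : L1 u -> L1 v -> L1 (fun t => u t + v t).
Proof.
by move=> Lu Lv; rewrite (_ : EFin \o _ = (EFin \o u) \+ (EFin \o v))%E//; exact: integrableD.
Qed.

Lemma L1Z c (u : R -> R) : L1 u -> L1 (fun t => c * u t).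
Proof.
by move=> Lu; rewrite (_ : EFin \o _ = (fun t => c%:E * (EFin \o u) t))%E//; exact: integrableZl.
Qed.

Lemma L1B (u v : R -> R) : L1 u -> L1 v -> L1 (fun t => u t - v t).
Proof.
by move=> Lu Lv; rewrite (_ : EFin \o _ = (EFin \o u) \- (EFin \o v))%E//; exact: integrableB.
Qed.

Lemma L1_norm (u : R -> R) : L1 u -> L1 (fun t => `|u t|).
Proof. by move=> Lu; rewrite (_ : EFin \o _ = abse \o (EFin \o u))//; exact: integrable_abse. Qed.

Lemma L1_cst c : L1 (fun=> c : R).
Proof. exact: finite_measure_integrable_cst. Qed.

Lemma L1_eq (u v : R -> R) : (forall t, 0 < t -> u t = v t) -> L1 u -> L1 v.
Proof.
move=> uv; apply: eq_integrable => // t; rewrite inE/= in_itv/= andbT => t0.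
by rewrite uv.
Qed.

Lemma mint_eq (u v : R -> R) : (forall t, 0 < t -> u t = v t) -> mint u = mint v.
Proof.
move=> uv; apply: eq_Rintegral => t; rewrite inE/= in_itv/= andbT => t0.
by rewrite uv.
Qed.

Lemma mint_le (u v : R -> R) : L1 u -> L1 v -> (forall t, 0 < t -> u t <= v t) ->
  mint u <= mint v.
Proof.
move=> Lu Lv uv; apply: le_Rintegral => // t; rewrite /= in_itv/= andbT; exact: uv.
Qed.

Lemma mint_ge0 (u : R -> R) : (forall t, 0 < t -> 0 <= u t) -> 0 <= mint u.
Proof.
by move=> u0; apply: Rintegral_ge0 => t; rewrite /= in_itv/= andbT; exact: u0.
Qed.

Lemma mint_norm (u : R -> R) : L1 u -> `|mint u| <= mint (fun t => `|u t|).
Proof. by move=> Lu; apply: le_normr_Rintegral. Qed.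

Lemma mint_normle (u h : R -> R) : L1 u -> L1 h -> (forall t, 0 < t -> `|u t| <= h t) ->
  `|mint u| <= mint h.
Proof.
move=> Lu Lh uh; apply: (le_trans (mint_norm Lu)); apply: mint_le => //.
exact: L1_norm.
Qed.

Lemma mintE (u : R -> R) : L1 u -> (mint u)%:E = (\int[m]_(t in Rpos) (u t)%:E)%E.
Proof. by move=> Lu; rewrite /Rintegral fineK//; exact: integrable_fin_num. Qed.

Lemma mintD (u v : R -> R) : L1 u -> L1 v -> mint (fun t => u t + v t) = mint u + mint v.
Proof. by move=> Lu Lv; exact: RintegralD. Qed.

Lemma mintB (u v : R -> R) : L1 u -> L1 v -> mint (fun t => u t - v t) = mint u - mint v.
Proof. by move=> Lu Lv; exact: RintegralB. Qed.

Lemma mintZ c (u : R -> R) : L1 u -> mint (fun t => c * u t) = c * mint u.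
Proof. by move=> Lu; exact: RintegralZl. Qed.

Lemma mint_sum (I : Type) (r : seq I) (u : I -> R -> R) : (forall i, L1 (u i)) ->
  L1 (fun t => \sum_(i <- r) u i t) /\
  mint (fun t => \sum_(i <- r) u i t) = \sum_(i <- r) mint (u i).
Proof.
move=> Lu; elim: r => [|i r [L e]].
  rewrite big_nil; under [X in EFin \o X]funext do rewrite big_nil.
  split; first exact: L1_cst.
  by under eq_Rintegral do rewrite big_nil; rewrite Rintegral_cst// mul0r.
rewrite big_cons -e -mintD//; split.
  by under [X in EFin \o X]funext do rewrite big_cons; exact: L1D.
by apply: mint_eq => t _; rewrite big_cons.
Qed.

Lemma L1_exp (c : R) : c < 1 -> L1 (fun t => expR (c * t)).
Proof.
move=> c1; apply/integrableP; split.
  by apply/measurable_EFinP; exact: measurable_expRM.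
(* The margin [1 - c] is split in two: one half absorbs the factor [1 + t] of [dens_le], the other
   remains as an integrable exponential. *)
pose e := (1 - c) / 2; have e0 : 0 < e by rewrite /e; lra.
rewrite ge0_integral_m//; last first.
  by apply/measurable_EFinP; apply: measurableT_comp => //; exact: measurable_expRM.
apply: (@le_lt_trans _ _ (\int[mu]_(t in Rpos) ((1 + e^-1)%:E * (expR (- e * t))%:E))%E).
  apply: ge0_le_integral => //=.
  - by move=> t t0; rewrite mule_ge0// lee_fin dens_ge0.
  - apply: emeasurable_funM.
      by apply/measurable_EFinP; apply: measurableT_comp => //; exact: measurable_expRM.
    by apply/measurable_EFinP; exact: measurable_dens.
  - apply: emeasurable_funM => //.
    by apply/measurable_EFinP; exact: measurable_expRM.
  - move=> t; rewrite in_itv/= andbT => t0.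
    rewrite -!EFinM lee_fin ger0_norm ?expR_ge0//.
    apply: (@le_trans _ _ (expR (c * t) * ((1 + t) * expR (- t)))).
      by rewrite ler_wpM2l ?expR_ge0// dens_le.
    rewrite mulrCA -expRD (_ : c * t + - t = - e * t + - e * t); last by rewrite /e; lra.
    rewrite expRD mulrA ler_wpM2r ?expR_ge0// mulNr expRN ler_pdivrMr ?expR_gt0//.
    apply: (@le_trans _ _ ((1 + e^-1) * (1 + e * t))).
      rewrite (_ : _ * _ = 1 + t + (e * t + e^-1)); last by field; rewrite gt_eqF.
      have et : 0 <= e * t by rewrite mulr_ge0// ltW.
      have ei : 0 <= e^-1 by rewrite invr_ge0 ltW.
      by rewrite lerDl addr_ge0.
    by rewrite ler_wpM2l ?expR_ge1Dx// addr_ge0// invr_ge0 ltW.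
rewrite ge0_integralZl//=.
- by rewrite integral_expRN// -EFinM ltry.
- by apply/measurable_EFinP; exact: measurable_expRM.
- by rewrite lee_fin addr_ge0// invr_ge0 ltW.
Qed.

Lemma mint_lebesgue (u : R -> R) : L1 u ->
  mu.-integrable Rpos (EFin \o (fun t => u t * dens t)) /\
  mint u = \int[mu]_(t in Rpos) (u t * dens t).
Proof.
move=> Lu; have mu_ := L1_meas Lu.
have md : meas (@dens R) by exact: measurable_dens.
have iu : mu.-integrable Rpos (EFin \o (fun t => u t * dens t)).
  apply/integrableP; split.
    by apply/measurable_EFinP; exact: measurable_funM.
  have /integrableP[_] := Lu; rewrite ge0_integral_m//; last first.
    by apply: measurableT_comp => //; exact/measurable_EFinP.
  apply: le_lt_trans; rewrite le_eqVlt; apply/orP; left; apply/eqP.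
  apply: eq_integral => t; rewrite inE/= => t0.
  by rewrite normrM (ger0_norm (dens_ge0 t0)) EFinM.
split => //.
have mp : measurable_fun Rpos (EFin \o u) by exact/measurable_EFinP.
rewrite /Rintegral; congr fine.
rewrite integralE [RHS]integralE !ge0_integral_m//; last 2 first.
- exact: measurable_funeneg.
- exact: measurable_funepos.
congr (_ - _)%E; apply: eq_integral => t; rewrite inE/= => t0.
  rewrite !funeposE -EFin_max -EFinM -EFin_max; congr EFin.
  by rewrite maxr_pMl ?dens_ge0// mul0r.
rewrite !funenegE -!EFinN -!EFin_max -EFinM; congr EFin.
by rewrite maxr_pMl ?dens_ge0// mul0r mulNr.
Qed.

Lemma mint_dct (u : nat -> R -> R) (v h : R -> R) :
  (forall n, meas (u n)) -> L1 h ->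
  (forall n t, 0 < t -> `|u n t| <= h t) ->
  (forall t, 0 < t -> u n t @[n --> \oo] --> v t) ->
  L1 v /\ (mint (u n) @[n --> \oo] --> mint v).
Proof.
move=> mu_ Lh uh uv.
have mv : meas v.
  by apply: measurable_fun_cvg mu_ _ => t /=; rewrite in_itv/= andbT; exact: uv.
have Lu n : L1 (u n) by apply: L1_le (uh n).
have := @dominated_convergence _ _ R m Rpos _ (fun n => EFin \o u n) (EFin \o v) (EFin \o h).
case=> //.
- by move=> n; apply/measurable_EFinP; exact: mu_.
- exact/measurable_EFinP.
- apply: aeW => t /=; rewrite in_itv/= andbT => t0.
  by apply: cvg_EFin; [exact: nearW|exact: uv].
- by apply: aeW => t /= n; rewrite in_itv/= andbT => t0; rewrite lee_fin; exact: uh.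
move=> Lv _ cv; split => //.
by apply: fine_cvg; rewrite mintE.
Qed.

(** * Fubini for bounded kernels *)

Lemma measRpos (u : R -> R) : meas u -> measurable_fun setT (u \_ Rpos).
Proof. by move=> mu_; apply/(measurable_restrictT _ _).1. Qed.

(** The functions are extended by zero so that the product measure on the whole plane applies; the
    double integral is dominated by C times the product of the L_1 norms of [u] and [v]. The last
    clause is phrased as an iterated integral, ready for an exchange of the order. *)
Lemma m_section_fubini (k : R -> R -> R) (C : R) (u v : R -> R) :
  measurable_fun setT (fun x : R * R => k x.1 x.2) ->
  (forall t s, 0 < t -> 0 < s -> `|k t s| <= C) ->
  L1 u -> L1 v ->
  [/\ (m \x m)%E.-integrable setT
       (fun x => ((u \_ Rpos) x.1 * (k x.1 x.2 * (v \_ Rpos) x.2))%:E),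
    (forall t, 0 < t -> L1 (fun s => k t s * v s)) &
    mint (fun t => u t * mint (fun s => k t s * v s)) =
    fine (\int[m]_t \int[m]_s ((u \_ Rpos) t * (k t s * (v \_ Rpos) s))%:E)%E].
Proof.
move=> mk kC Lu Lv.
have C0 : 0 <= C by rewrite (le_trans _ (kC 1 1 _ _)).
have mkt t : measurable_fun setT (k t).
  rewrite (_ : k t = (fun x => k x.1 x.2) \o pair t)//.
  by apply: measurableT_comp => //; exact: pair1_measurable.
have Lk t : 0 < t -> L1 (fun s => k t s * v s).
  move=> t0; apply: L1_le (L1Z C (L1_norm Lv)) _.
    by apply: measurable_funM; [exact: measurable_funTS|exact: L1_meas].
  by move=> s s0; rewrite normrM ler_wpM2r// kC.
have LkR t : 0 < t -> m.-integrable setT (fun s => (k t s * (v \_ Rpos) s)%:E).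
  move=> t0; have /(integrable_mkcond _ _).1 := Lk _ t0; move=> /(_ (measurable_itv _)).
  apply: eq_integrable => // s _; rewrite /= !patchE; case: ifPn => //.
  by rewrite mulr0.
have L1R (w : R -> R) : L1 w -> m.-integrable setT (EFin \o (w \_ Rpos)).
  by move=> Lw; rewrite -restrict_EFin; apply/(integrable_mkcond _ _).1.
set F := (fun x : R * R => ((u \_ Rpos) x.1 * (k x.1 x.2 * (v \_ Rpos) x.2))%:E).
have mf : measurable_fun setT F.
  apply/measurable_EFinP; apply: measurable_funM; last apply: measurable_funM => //.
  - by apply: measurableT_comp => //; apply: measRpos; exact: L1_meas.
  - by apply: measurableT_comp => //; apply: measRpos; exact: L1_meas.
have mFt t : measurable_fun setT (fun s => F (t, s)).
  by apply: measurableT_comp => //; exact: pair1_measurable.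
split=> //.
- apply/integrable12ltyP => //.
  apply: (@le_lt_trans _ _ (\int[m]_t ((C * `|(u \_ Rpos) t|)%:E * \int[m]_s (`|(v \_ Rpos) s|)%:E))%E).
    apply: ge0_le_integral => //.
    + by move=> t _; apply: integral_ge0.
    + apply: (@measurable_fun_fubini_tonelli_F _ _ _ _ R m (abse \o F)) => //.
        exact: measurableT_comp.
      by move=> x; exact: abse_ge0.
    + apply: emeasurable_funM => //; apply/measurable_EFinP.
      apply: measurable_funM => //; apply: measurableT_comp => //.
      by apply: measRpos; exact: L1_meas.
    + move=> t _; rewrite -ge0_integralZl//; last 2 first.
      * apply/measurable_EFinP; apply: measurableT_comp => //.
        by apply: measRpos; exact: L1_meas.
      * by rewrite lee_fin mulr_ge0.
      apply: ge0_le_integral => //.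
      * by apply: measurableT_comp (mFt t).
      * apply: emeasurable_funM => //; apply/measurable_EFinP.
        apply: measurableT_comp => //.
        by apply: measRpos; exact: L1_meas.
      * move=> s _; rewrite -EFinM lee_fin !normrM /= !patchE.
        case: ifPn => [|_]; last by rewrite normr0 mulr0 !mul0r.
        rewrite inE/= in_itv/= andbT => t0.
        case: ifPn => [|_]; last by rewrite normr0 !mulr0.
        rewrite inE/= in_itv/= andbT => s0.
        by rewrite mulrA ler_wpM2r// mulrC ler_wpM2r// kC.
  have /integrableP[_ Vy] := L1R _ Lv.
  have Ui : m.-integrable setT (fun t => (C * `|(u \_ Rpos) t|)%:E).
    by have := integrableZl measurableT C (integrable_abse (L1R _ Lu)).
  rewrite ge0_integralZr//.
  - apply: lte_mul_pinfty => //.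
    + by apply: integral_ge0 => t _; rewrite lee_fin mulr_ge0.
    + exact: integrable_fin_num.
  - exact: measurable_int Ui.
  - by move=> t _; rewrite lee_fin mulr_ge0.
  - exact: integral_ge0.
have fin t : 0 < t -> ((u t * mint (fun s => k t s * v s))%:E = \int[m]_s F (t, s))%E.
  move=> t0; rewrite EFinM mintE; last exact: Lk.
  rewrite -integralZl//; last exact: Lk.
  rewrite [LHS]integral_mkcond; apply: eq_integral => s _.
  have tP : t \in Rpos by rewrite inE/= in_itv/= t0.
  by rewrite patchE /F/= !patchE tP; case: ifPn => // _; rewrite !mulr0.
rewrite /Rintegral [in LHS]integral_mkcond; congr fine; apply: eq_integral => t _.
rewrite [LHS]patchE; case: ifPn => [|tn].
  by rewrite inE/= in_itv/= andbT => /fin.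
by rewrite integral0_eq// => s _; rewrite /F /= patchE (negbTE tn) mul0r.
Qed.

Lemma mint_swap (k : R -> R -> R) (C : R) (u v : R -> R) :
  measurable_fun setT (fun x : R * R => k x.1 x.2) ->
  (forall t s, 0 < t -> 0 < s -> `|k t s| <= C) ->
  L1 u -> L1 v ->
  mint (fun t => u t * mint (fun s => k t s * v s)) =
  mint (fun s => v s * mint (fun t => k t s * u t)).
Proof.
move=> mk kC Lu Lv; have [fi _ ->] := m_section_fubini mk kC Lu Lv.
have mk' : measurable_fun setT (fun x : R * R => k x.2 x.1).
  rewrite (_ : (fun _ => _) = (fun x => k x.1 x.2) \o (fun x => (x.2, x.1)))//.
  apply: measurableT_comp => //.
  by apply: measurable_fun_pair; [exact: measurable_snd|exact: measurable_fst].
have [_ _ ->] := @m_section_fubini (fun s t => k t s) C v u mk' (fun t s t0 s0 => kC s t s0 t0) Lv Lu.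
rewrite (Fubini fi); congr fine; apply: eq_integral => s _; apply: eq_integral => t _.
by congr EFin; rewrite /=; ring.
Qed.

Lemma L1_kernel (k : R -> R -> R) (C : R) (v : R -> R) :
  measurable_fun setT (fun x : R * R => k x.1 x.2) ->
  (forall t s, 0 < t -> 0 < s -> `|k t s| <= C) ->
  L1 v -> (forall t, 0 < t -> L1 (fun s => k t s * v s)) /\
  meas (fun t => mint (fun s => k t s * v s)).
Proof.
move=> mk kC Lv; have [fi Lk _] := m_section_fubini mk kC (L1_cst 1) Lv.
split=> //.
have mF := measurable_fubini_F fi.
apply/measurable_EFinP; apply: (eq_measurable_fun _ _ (measurable_funTS mF)).
move=> t; rewrite inE/= in_itv/= andbT => t0.
rewrite /= mintE ?Lk// [RHS]integral_mkcond; apply: eq_integral => s _.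
have tP : t \in Rpos by rewrite inE/= in_itv/= t0.
by rewrite /= !patchE tP mul1r; case: ifPn => //; rewrite mulr0.
Qed.

(** * Real square-integrable functions *)

Definition SL2 (u : R -> R) := meas u /\ L1 (fun t => u t ^+ 2).

Lemma SL2_le (u h : R -> R) : meas u -> SL2 h -> (forall t, 0 < t -> `|u t| <= h t) -> SL2 u.
Proof.
move=> mu_ [mh Lh] uh; split => //; apply: L1_le Lh _; first exact: measurable_funX.
by move=> t t0; rewrite normrX lerXn2r ?nnegrE// ?uh// (le_trans _ (uh _ t0)).
Qed.

Lemma SL2M (u v : R -> R) : SL2 u -> SL2 v -> L1 (fun t => u t * v t).
Proof.
move=> [mu_ Lu] [mv Lv]; apply: L1_le (L1D Lu Lv) _; first exact: measurable_funM.
move=> t _; rewrite normrM -(real_normK (num_real (u t))) -(real_normK (num_real (v t))).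
have := sqr_ge0 (`|u t| - `|v t|); have := sqr_ge0 (`|u t| + `|v t|).
by rewrite sqrrB sqrrD; lra.
Qed.

Lemma SL2D (u v : R -> R) : SL2 u -> SL2 v -> SL2 (fun t => u t + v t).
Proof.
move=> Lu Lv; have Luv := SL2M Lu Lv.
case: Lu Lv => [mu_ Lu] [mv Lv]; split; first exact: measurable_funD.
apply: (L1_eq _ (L1D (L1D Lu Lv) (L1Z 2 Luv))) => t _; ring.
Qed.

Lemma SL2Z c (u : R -> R) : SL2 u -> SL2 (fun t => c * u t).
Proof.
move=> [mu_ Lu]; split; first exact: measurable_funM.
by apply: (L1_eq _ (L1Z (c ^+ 2) Lu)) => t _; rewrite exprMn.
Qed.

Lemma SL2_norm (u : R -> R) : SL2 u -> SL2 (fun t => `|u t|).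
Proof.
move=> [mu_ Lu]; split; first exact: measurableT_comp.
by apply: (L1_eq _ Lu) => t _; rewrite real_normK ?num_real.
Qed.

Lemma SL2_cst c : SL2 (fun=> c : R).
Proof. by split => //; exact: L1_cst. Qed.

Lemma SL2_L1 (u : R -> R) : SL2 u -> L1 u.
Proof. by move=> Lu; apply: (L1_eq _ (SL2M Lu (SL2_cst 1))) => t _; rewrite mulr1. Qed.

Lemma SL2M_bounded (u b : R -> R) (C : R) : SL2 u -> meas b ->
  (forall t, 0 < t -> `|b t| <= C) -> SL2 (fun t => b t * u t).
Proof.
move=> Lu mb bC; apply: SL2_le (SL2Z C (SL2_norm Lu)) _.
  by case: Lu => mu_ _; exact: measurable_funM.
by move=> t t0; rewrite normrM ler_wpM2r// bC.
Qed.

(** The quadratic A x^2 + 2 B x + C is the integral of (x u + v)^2, hence nonnegative. Its value at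
    the vertex -B/A gives the inequality; if A = 0 and B were not 0, it would take the value -1 at
    -(C + 1) / (2 B). *)
Lemma cauchy_schwarz (u v : R -> R) : SL2 u -> SL2 v ->
  mint (fun t => u t * v t) ^+ 2 <=
  mint (fun t => u t ^+ 2) * mint (fun t => v t ^+ 2).
Proof.
move=> Lu Lv; have Luv := SL2M Lu Lv.
set A := mint (fun t => u t ^+ 2); set B := mint (fun t => u t * v t); set C := mint (fun t => v t ^+ 2).
have q x : 0 <= A * x ^+ 2 + 2 * B * x + C.
  have -> : A * x ^+ 2 + 2 * B * x + C = mint (fun t => (x * u t + v t) ^+ 2).
    case: (Lu) (Lv) => [_ Lu2] [_ Lv2].
    transitivity (mint (fun t => (x ^+ 2 * u t ^+ 2 + (2 * x) * (u t * v t)) + v t ^+ 2)).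
      rewrite mintD//; last by apply: L1D; exact: L1Z.
      rewrite mintD//; [|exact: L1Z|exact: L1Z].
      by rewrite !mintZ// -/A -/B -/C; ring.
    by apply: mint_eq => t _; ring.
  by apply: mint_ge0 => t _; exact: sqr_ge0.
have A0 : 0 <= A by apply: mint_ge0 => t _; exact: sqr_ge0.
have [A00|An0] := eqVneq A 0.
  suff -> : B = 0 by rewrite A00 mul0r expr0n.
  apply/eqP; apply: contraT => B0; have := q (- (C + 1) / (2 * B)).
  rewrite A00 mul0r add0r (_ : _ + _ = -1) ?oppr_ge0 ?ler10//.
  by field.
have := q (- B / A).
rewrite (_ : _ + _ = (A * C - B ^+ 2) / A); last by field.
by rewrite pmulr_lge0 ?subr_ge0// invr_gt0 lt_neqAle eq_sym An0.
Qed.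

End Measure.

(** * The Bessel kernel and the complex exponential *)

Section PowerSeries.
Context {R : realType}.
Implicit Types (f g : nat -> R) (x r C : R).

Lemma expseries_le x n : 0 <= x -> series (exp_coeff x) n <= expR x.
Proof.
move=> x0; apply: nondecreasing_cvgn_le; last exact: is_cvg_series_exp_coeff.
apply/nondecreasing_seqP => k; rewrite !seriesEnat/= big_nat_recr//= lerDl.
exact: exp_coeff_ge0.
Qed.

Lemma expcoeff_le x n : 0 <= x -> x ^+ n / n`!%:R <= expR x.
Proof.
move=> x0; apply: le_trans (expseries_le n.+1 x0).
rewrite seriesEnat/= big_nat_recr//= lerDr.
by apply: sumr_ge0 => i _; exact: exp_coeff_ge0.
Qed.

(** Domination by an exponential series is stronger than an infinite radius of convergence, and it
    survives termwise differentiation with the same rate [Cr.2]. *)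
Definition entire f := exists2 Cr : R * R, 0 <= Cr.2 &
  forall n, `|f n| <= Cr.1 * Cr.2 ^+ n / n`!%:R.

Lemma entire_diffs f : entire f -> entire (pseries_diffs f).
Proof.
move=> [[C r]/= r0 fC]; exists (C * r, r) => //= n.
rewrite /pseries_diffs normrM ger0_norm//.
apply: (le_trans (ler_wpM2l _ (fC _))) => //.
rewrite factS natrM exprS invfM le_eqVlt; apply/orP; left; apply/eqP.
by rewrite mulrCA !mulrA mulfK ?pnatr_eq0// [X in X / _]mulrC; congr (_ / _); ring.
Qed.

Lemma entire_cvg f x : entire f -> cvgn (pseries f x).
Proof.
move=> [[C r]/= r0 fC]; apply: normed_cvg.
have C0 : 0 <= C.
  by have := fC 0%N; rewrite expr0 mulr1 fact0 invr1 mulr1; apply: le_trans.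
apply: (@series_le_cvg _ _ (fun n => C *: exp_coeff (r * `|x|) n)).
- by move=> n /=.
- by move=> n; rewrite mulr_ge0// exp_coeff_ge0// mulr_ge0.
- move=> n; rewrite /= normrM normrX /exp_coeff/= exprMn.
  rewrite (le_trans (ler_wpM2r _ (fC n)))// /GRing.scale/=.
  by rewrite le_eqVlt; apply/orP; left; apply/eqP; ring.
- exact/is_cvg_seriesZ/is_cvg_series_exp_coeff.
Qed.

Definition psum f x := limn (pseries f x).

Lemma psum_cvg f x : entire f -> pseries f x @ \oo --> psum f x.
Proof. exact: entire_cvg. Qed.

Lemma psum_lim f x l : pseries f x @ \oo --> l -> psum f x = l.
Proof. by move=> h; apply: cvg_lim. Qed.

Lemma psumD f g x : entire f -> entire g ->
  psum (fun n => f n + g n) x = psum f x + psum g x.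
Proof.
move=> ef eg; apply: psum_lim.
rewrite (_ : pseries _ x = pseries f x \+ pseries g x).
  by apply: cvgD; exact: psum_cvg.
apply/funext => n; rewrite /pseries !seriesEnat/= -big_split/=.
by apply: eq_bigr => i _; rewrite mulrDl.
Qed.

Lemma psumZ f c x : entire f -> psum (fun n => c * f n) x = c * psum f x.
Proof.
move=> ef; apply: psum_lim.
rewrite (_ : pseries _ x = fun n => c * pseries f x n).
  by apply: cvgMr; exact: psum_cvg.
apply/funext => n; rewrite /pseries !seriesEnat/= mulr_sumr.
by apply: eq_bigr => i _; rewrite mulrA.
Qed.

Lemma pseries_shift f x : entire f ->
  pseries (fun n => if n is k.+1 then f k else 0) x @ \oo --> x * psum f x.
Proof.
move=> ef; rewrite -(cvg_shiftn 1)/=.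
rewrite (_ : (fun _ => _) = (fun n => x * pseries f x n)).
  by apply: cvgMr; exact: psum_cvg.
apply/funext => n; rewrite /pseries !seriesEnat/= addn1 big_nat_recl//= mul0r add0r.
by rewrite mulr_sumr; apply: eq_bigr => i _; rewrite exprS; ring.
Qed.

Lemma psum0 f : psum f 0 = f 0%N.
Proof.
apply: psum_lim; rewrite -(cvg_shiftn 1)/=.
rewrite (_ : (fun _ => _) = cst (f 0%N)); first exact: cvg_cst.
apply/funext => n; rewrite /pseries !seriesEnat/= addn1 big_nat_recl//= mulr1.
by rewrite big1 ?addr0// => i _; rewrite exprS mul0r mulr0.
Qed.

Lemma is_derive_psum f x : entire f ->
  is_derive x (1 : R) (psum f) (psum (pseries_diffs f) x).
Proof.
move=> ef; apply: (@pseries_snd_diffs _ _ (`|x| + 1)).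
- exact: entire_cvg.
- exact/entire_cvg/entire_diffs.
- exact/entire_cvg/entire_diffs/entire_diffs.
- by rewrite [ltRHS]ger0_norm ?addr_ge0// ltrDl.
Qed.

(** Termwise comparison with the exponential series. The bound depends on [x] only through [X], so
    it is uniform; it serves to replace the Bessel kernel by a polynomial on a square. *)
Lemma psum_tail f x X n : (forall k, `|f k| <= k`!%:R^-1) -> `|x| <= X ->
  `|psum f x - pseries f x n| <= expR X - series (exp_coeff X) n.
Proof.
move=> fk xX.
have X0 : 0 <= X by rewrite (le_trans _ xX).
have ef : entire f by exists (1, 1) => //= k; rewrite expr1n !mul1r.
have h : (fun N => `|pseries f x N - pseries f x n|) @ \oo --> `|psum f x - pseries f x n|.
  by apply: cvg_norm; apply: cvgB; [exact: psum_cvg|exact: cvg_cst].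
apply: (cvgr_to_le h); near=> N.
have nN : (n <= N)%N by near: N; exact: nbhs_infty_ge.
rewrite sub_series_geq// (le_trans (ler_norm_sum _ _ _))//.
apply: (@le_trans _ _ (series (exp_coeff X) N - series (exp_coeff X) n)).
  rewrite sub_series_geq//; apply: ler_sum => i _.
  rewrite normrM normrX /exp_coeff/= [leRHS]mulrC ler_pM//.
  by rewrite lerXn2r ?nnegrE.
by rewrite lerD2r expseries_le.
Unshelve. all: by end_near. Qed.

Definition bessc n : R := (-1) ^+ n / (n`!%:R * n.+1`!%:R).

(* For [0 < x], [bess x] is [J_1(2 sqrt x) / sqrt x]. *)
Definition bess := psum bessc.

Lemma bessc_le n : `|bessc n| <= n`!%:R^-1 * n`!%:R^-1.
Proof.
rewrite normrM normrX normrN1 expr1n mul1r normfV normrM !ger0_norm//.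
rewrite invfM ler_wpM2l ?invr_ge0// lef_pV2 ?posrE ?ltr0n ?fact_gt0//.
by rewrite ler_nat factS leq_pmull.
Qed.

Lemma bessc_le1 n : `|bessc n| <= n`!%:R^-1.
Proof.
apply: (le_trans (bessc_le n)); rewrite ler_piMr ?invr_ge0//.
by rewrite invf_le1 ?ltr0n ?fact_gt0// ler1n fact_gt0.
Qed.

Lemma entire_bessc : entire bessc.
Proof. by exists (1, 1) => //= k; rewrite expr1n !mul1r bessc_le1. Qed.

(** Bessel's equation in the variable x. With c_k the coefficients [bessc], it says (k + 1) (k + 2)
    c_(k+1) + c_k = 0 for every k; multiplication by x shifts the second-derivative series by one
    place. *)
Lemma bess_ode x :
  x * psum (pseries_diffs (pseries_diffs bessc)) x +
  2 * psum (pseries_diffs bessc) x + bess x = 0.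
Proof.
have e1 := entire_bessc; have e2 := entire_diffs e1; have e3 := entire_diffs e2.
have h : (fun n => pseries (fun n => if n is k.+1
      then pseries_diffs (pseries_diffs bessc) k else 0) x n +
    2 * pseries (pseries_diffs bessc) x n + pseries bessc x n) @ \oo -->
    x * psum (pseries_diffs (pseries_diffs bessc)) x +
      2 * psum (pseries_diffs bessc) x + bess x.
  apply: cvgD; last exact: psum_cvg.
  by apply: cvgD; [exact: pseries_shift|apply: cvgMr; exact: psum_cvg].
suff h0 : (fun=> 0 : R) @ \oo --> x * psum (pseries_diffs (pseries_diffs bessc)) x +
      2 * psum (pseries_diffs bessc) x + bess x.
  by apply: (cvg_unique _ h0 (cvg_cst _)).
apply: cvg_trans h; apply: near_eq_cvg; apply: nearW => n.
rewrite /pseries !seriesEnat/= mulr_sumr -!big_split/=.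
apply: big1 => k _; rewrite mulrA -!mulrDl.
suff -> : (if k is k'.+1 then pseries_diffs (pseries_diffs bessc) k' else 0) +
  2 * pseries_diffs bessc k + bessc k = 0 by rewrite mul0r.
have nz j : (j`!%:R : R) != 0 by rewrite pnatr_eq0 -lt0n fact_gt0.
have nz1 j : (j.+1%:R : R) != 0 by rewrite pnatr_eq0.
rewrite /pseries_diffs /bessc.
case: k => [|k].
  by rewrite !expr1 expr0 (_ : 2`! = 2%N)// fact0 !mulr1 !mul1r; field.
rewrite !exprS !factS !natrM.
have := nz k; have := nz1 k; have := nz1 k.+1; have := nz1 k.+2.
rewrite -[k.+3%:R]natr1 -[k.+2%:R]natr1 -[k.+1%:R]natr1 => h3 h2 h1 h0.
set e := (-1) ^+ k; move: (k%:R : R) (k`!%:R : R) h0 h1 h2 h3 => a b h0 h1 h2 h3.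
field.
by apply/and4P; split.
Qed.

(** Energy argument: by the differential equation, E = b^2 + x b'^2 has derivative -3 b'^2, so E
    decreases from E(0) = 1 on the half-line, and b^2 <= E there. *)
Lemma bess_le1 x : 0 <= x -> `|bess x| <= 1.
Proof.
move=> x0; pose b1 := psum (pseries_diffs bessc).
pose b2 := psum (pseries_diffs (pseries_diffs bessc)).
pose E x := bess x ^+ 2 + x * b1 x ^+ 2.
have e1 := entire_bessc; have e2 := entire_diffs e1.
have db z : is_derive z (1 : R) bess (b1 z) by exact: is_derive_psum.
have db1 z : is_derive z (1 : R) b1 (b2 z) by exact: is_derive_psum.
have dE z : is_derive z (1 : R) E (- 3 * b1 z ^+ 2).
  apply: is_derive_eq; rewrite /GRing.scale/= mulr1.
  have := bess_ode z; rewrite -/(b1 z) -/(b2 z) => /eqP.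
  rewrite -addrA addrC addr_eq0 => /eqP h.
  have -> : bess z = - (z * b2 z) - 2 * b1 z by rewrite -h; ring.
  ring.
have Ex : E x <= E 0.
  apply: (@ler0_derive1_nincry _ E 0) => //.
  - by move=> z _; rewrite derive1E derive_val mulNr oppr_le0 mulr_ge0// sqr_ge0.
  - apply: continuous_subspaceT => z; apply: differentiable_continuous.
    by apply/derivable1_diffP.
have E0 : E 0 = 1.
  by rewrite /E mul0r addr0 /bess psum0 /bessc expr0 !fact0 mulr1 invr1 mulr1 expr1n.
rewrite -(@ler_pXn2r _ 2)// ?nnegrE//= expr1n real_normK ?num_real//.
by rewrite -E0 (le_trans _ Ex)// /E lerDl mulr_ge0// sqr_ge0.
Qed.

Lemma continuous_bess : continuous bess.
Proof.
move=> x; have := is_derive_psum x entire_bessc => ?.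
by apply: differentiable_continuous; exact/derivable1_diffP.
Qed.

(** The bound by 1 holds for the full sum but not for its partial sums. Writing t s = (e t) (s / e)
    and spending one factorial on each factor bounds them with an arbitrarily small growth rate in
    [t], paid for by a large constant in [s]. *)
Lemma bess_partial_le (t s e : R) n : 0 <= t -> 0 <= s -> 0 < e ->
  `|pseries bessc (t * s) n| <= expR (e * t) * expR (s / e).
Proof.
move=> t0 s0 e0; rewrite /pseries seriesEnat/=.
rewrite (le_trans (ler_norm_sum _ _ _))//.
have es0 : 0 <= s / e by rewrite divr_ge0// ltW.
apply: le_trans (ler_wpM2l (expR_ge0 _) (expseries_le n es0)).
rewrite seriesEnat/= mulr_sumr; apply: ler_sum => i _.
rewrite normrM normrX [`|t * s|]ger0_norm ?mulr_ge0//.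
apply: (le_trans (ler_wpM2r _ (bessc_le i))); first by rewrite exprn_ge0// mulr_ge0.
apply: (@le_trans _ _ ((e * t) ^+ i / i`!%:R * (s / e) ^+ i / i`!%:R)).
  rewrite (_ : t * s = (e * t) * (s / e)); last by field; rewrite gt_eqF.
  by rewrite exprMn le_eqVlt; apply/orP; left; apply/eqP; ring.
rewrite /exp_coeff/= -mulrA ler_wpM2r ?mulr_ge0 ?invr_ge0 ?exprn_ge0//.
by apply: expcoeff_le; rewrite mulr_ge0// ltW.
Qed.

Lemma cvg_expseries_tail (X e : R) : 0 < e ->
  exists n, expR X - series (exp_coeff X) n <= e.
Proof.
move=> e0; have h : series (exp_coeff X) @ \oo --> expR X by exact: is_cvg_series_exp_coeff.
move/cvgrPdist_le : h => /(_ e e0)[N _ h]; exists N.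
by have := h N (leqnn N); rewrite /= => /(le_trans (ler_norm _)).
Qed.

End PowerSeries.

(** * The complex exponential as a power series *)

Section ComplexExp.
Context {R : realType}.
Implicit Types z w : R[i].

(* Equivalent to the modulus, and easier to bound in terms of [Re] and [Im]. *)
Definition norm1 z : R := `|Re z| + `|Im z|.

Lemma cReM z w : Re (z * w) = Re z * Re w - Im z * Im w.
Proof. by case: z w => a b [c d]. Qed.

Lemma cImM z w : Im (z * w) = Re z * Im w + Im z * Re w.
Proof. by case: z w => a b [c d]. Qed.

Lemma norm1_ge0 z : 0 <= norm1 z. Proof. exact: addr_ge0. Qed.

Lemma norm1M z w : norm1 (z * w) <= norm1 z * norm1 w.
Proof.
rewrite /norm1 cReM cImM mulrDl !mulrDr -!normrM.
have := ler_normB (Re z * Re w) (Im z * Im w).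
have := ler_normD (Re z * Im w) (Im z * Re w); lra.
Qed.

Lemma norm1D z w : norm1 (z + w) <= norm1 z + norm1 w.
Proof.
rewrite /norm1 !raddfD/=; have := ler_normD (Re z) (Re w).
have := ler_normD (Im z) (Im w); lra.
Qed.

Lemma norm1X z n : norm1 (z ^+ n) <= norm1 z ^+ n.
Proof.
elim: n => [|n ih]; first by rewrite !expr0 /norm1/= normr1 normr0 addr0.
by rewrite !exprS (le_trans (norm1M _ _))// ler_wpM2l ?norm1_ge0.
Qed.

Lemma norm1_Re z : `|Re z| <= norm1 z. Proof. by rewrite lerDl. Qed.
Lemma norm1_Im z : `|Im z| <= norm1 z. Proof. by rewrite lerDr. Qed.

Lemma complex_eta z : z = (Re z +i* Im z)%C. Proof. by case: z. Qed.

(** [zRe z] and [zIm z] are the Taylor coefficients, in a real variable x, of the real and imaginary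
    parts of exp(x z). *)
Definition zRe z n := Re (z ^+ n) / n`!%:R.
Definition zIm z n := Im (z ^+ n) / n`!%:R.

Lemma entire_zRe z : entire (zRe z).
Proof.
exists (1, norm1 z) => /=; first exact: norm1_ge0.
move=> n; rewrite mul1r normrM normfV (ger0_norm (ler0n _ _)) ler_wpM2r ?invr_ge0//.
exact: le_trans (norm1_Re _) (norm1X _ _).
Qed.

Lemma entire_zIm z : entire (zIm z).
Proof.
exists (1, norm1 z) => /=; first exact: norm1_ge0.
move=> n; rewrite mul1r normrM normfV (ger0_norm (ler0n _ _)) ler_wpM2r ?invr_ge0//.
exact: le_trans (norm1_Im _) (norm1X _ _).
Qed.

(** With z = a + i b, the two sums P and Q satisfy P' = a P - b Q and Q' = b P + a Q. Then U + i V =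
    e^(-z s) (P + i Q) has zero derivative and equals 1 at s = 0; evaluating at s = 1 and using
    cos^2 + sin^2 = 1 solves for P(1) and Q(1). *)
Lemma psum_cexp z : complex_exp z = (psum (zRe z) 1 +i* psum (zIm z) 1)%C.
Proof.
set a := Re z; set b := Im z.
pose P := psum (zRe z); pose Q := psum (zIm z).
have fz (c : R) n : n.+1%:R * (c / n.+1`!%:R) = c / n`!%:R.
  by rewrite factS natrM invfM mulrCA [X in _ * X]mulrA divff ?pnatr_eq0// mul1r.
have dP s : is_derive s (1 : R) P (a * P s - b * Q s).
  have := is_derive_psum s (entire_zRe z).
  rewrite (_ : pseries_diffs _ = fun n => a * zRe z n + - b * zIm z n); last first.
    by apply/funext => n; rewrite /pseries_diffs /zRe fz exprS cReM /zIm; ring.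
  rewrite psumD; last 2 first.
  - have [[C r]/= r0 h] := entire_zRe z; exists (`|a| * C, r) => //= n.
    by rewrite normrM -!mulrA ler_wpM2l// mulrA.
  - have [[C r]/= r0 h] := entire_zIm z; exists (`|- b| * C, r) => //= n.
    by rewrite normrM -!mulrA ler_wpM2l// mulrA.
  by rewrite !psumZ ?mulNr//; [exact: entire_zIm|exact: entire_zRe].
have dQ s : is_derive s (1 : R) Q (b * P s + a * Q s).
  have := is_derive_psum s (entire_zIm z).
  rewrite (_ : pseries_diffs _ = fun n => b * zRe z n + a * zIm z n); last first.
    by apply/funext => n; rewrite /pseries_diffs /zRe fz exprS cImM /zIm; ring.
  rewrite psumD; last 2 first.
  - have [[C r]/= r0 h] := entire_zRe z; exists (`|b| * C, r) => //= n.
    by rewrite normrM -!mulrA ler_wpM2l// mulrA.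
  - have [[C r]/= r0 h] := entire_zIm z; exists (`|a| * C, r) => //= n.
    by rewrite normrM -!mulrA ler_wpM2l// mulrA.
  by rewrite !psumZ//; [exact: entire_zIm|exact: entire_zRe].
pose U s := expR (- a * s) * (P s * cos (b * s) + Q s * sin (b * s)).
pose V s := expR (- a * s) * (Q s * cos (b * s) - P s * sin (b * s)).
have dU s : is_derive s (1 : R) U 0.
  by apply: is_derive_eq; rewrite /GRing.scale/= !mulr1; ring.
have dV s : is_derive s (1 : R) V 0.
  by apply: is_derive_eq; rewrite /GRing.scale/= !mulr1; ring.
have U1 : U 1 = 1.
  rewrite (is_derive_0_is_cst _ 0 dU) /U !mulr0 expR0 cos0 sin0 /P psum0 /zRe.
  by rewrite expr0 fact0 divr1 mulr0 mulr1 addr0 mulr1.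
have V1 : V 1 = 0.
  rewrite (is_derive_0_is_cst _ 0 dV) /V !mulr0 expR0 cos0 sin0 /Q psum0 /zIm.
  by rewrite expr0/= mul0r; ring.
have cs := cos2Dsin2 b.
have e1 : P 1 * cos b + Q 1 * sin b = expR a.
  move: U1; rewrite /U !mulr1 expRN => U1.
  move: (congr1 (fun x => expR a * x) U1).
  by rewrite mulrA divff ?mul1r ?mulr1// gt_eqF ?expR_gt0.
have e2 : Q 1 * cos b - P 1 * sin b = 0.
  move: V1; rewrite /V !mulr1 expRN => /eqP; rewrite mulf_eq0 invr_eq0.
  by rewrite gt_eqF ?expR_gt0//= => /eqP.
rewrite /complex_exp -/a -/b -/(P 1) -/(Q 1).
move: (P 1) (Q 1) (cos b) (sin b) (expR a) e1 e2 cs => p q c d e e1 e2 cs.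
have -> : p = e * c.
  by rewrite -e1 -[LHS]mulr1 -cs; apply: subr0_eq; rewrite -(mulr0 (- d)) -e2; ring.
have -> : q = e * d.
  by rewrite -e1 -[LHS]mulr1 -cs; apply: subr0_eq; rewrite -(mulr0 c) -e2; ring.
by rewrite [LHS]complex_eta cReM cImM /= !mul0r subr0 addr0.
Qed.

Lemma cexpD z w : complex_exp (z + w) = complex_exp z * complex_exp w.
Proof.
rewrite /complex_exp !raddfD/= expRD cosD sinD [RHS]complex_eta [LHS]complex_eta !cReM !cImM/=.
by congr (_ +i* _)%C; ring.
Qed.

Lemma cexp_real (x : R) : complex_exp (x%:C)%C = (expR x)%:C%C.
Proof.
by rewrite /complex_exp/= cos0 sin0 [LHS]complex_eta cReM cImM/=; congr (_ +i* _)%C; ring.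
Qed.

Lemma norm1_cexp z : norm1 (complex_exp z) <= 2 * expR (Re z).
Proof.
rewrite /norm1 /complex_exp cReM cImM/= !mul0r subr0 addr0 !normrM (ger0_norm (expR_ge0 _)).
rewrite -mulrDr mulrC ler_wpM2r ?expR_ge0//.
have := cos_max (Im z); have := sin_max (Im z); lra.
Qed.

End ComplexExp.

(** * Laplace transform of the Bessel kernel *)

Section Gamma.
Context {R : realType}.
Implicit Types (a b t : R).

Lemma pow_exp_le (n : nat) (e t : R) : 0 < e -> 0 <= t ->
  t ^+ n <= n`!%:R / e ^+ n * expR (e * t).
Proof.
move=> e0 t0; have et : 0 <= e * t by rewrite mulr_ge0// ltW.
have := expcoeff_le n et; rewrite ler_pdivrMr ?ltr0n ?fact_gt0// exprMn => h.
rewrite mulrAC ler_pdivlMr ?exprn_gt0// mulrC (le_trans h)//.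
by rewrite mulrC.
Qed.

Lemma integrable_decay (f : R -> R) (C e : R) : 0 < e -> measurable_fun Rpos f ->
  (forall t, 0 < t -> `|f t| <= C * expR (- e * t)) ->
  mu.-integrable Rpos (EFin \o f).
Proof.
move=> e0 mf fC.
have ei : mu.-integrable Rpos (fun t => (C%:E * (EFin \o (fun t => expR (- e * t))) t)%E).
  apply: integrableZl => //; apply/integrableP; split.
    by apply/measurable_EFinP; exact: measurable_expRM.
  under eq_integral do rewrite /= ger0_norm ?expR_ge0//.
  by rewrite integral_expRN// ltry.
apply: le_integrable ei => //; first exact/measurable_EFinP.
move=> t /=; rewrite in_itv/= andbT => t0; rewrite lee_fin.
by rewrite (le_trans (fC _ t0))// ler_norm.
Qed.

(** The fundamental theorem on a half-line is applied to a nonnegative integrand: C e^(-e t) is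
    added to [f], the matching term to its primitive, and the integral C / e of the addition is
    removed at the end. *)
Lemma ftc_decay (F f : R -> R) (C e : R) : 0 < e -> continuous f ->
  (forall t, is_derive t (1 : R) F (f t)) ->
  (forall t, 0 <= t -> `|f t| <= C * expR (- e * t)) ->
  (forall t, 0 <= t -> `|F t| <= C * expR (- e * t)) ->
  \int[mu]_(t in Rpos) f t = - F 0.
Proof.
move=> e0 cf dF fC FC.
have C0 : 0 <= C.
  by have := FC 0 (lexx _); rewrite mulr0 expR0 mulr1; apply: le_trans.
have ce : continuous (fun t : R => C * expR (- e * t)).
  by move=> t; apply: cvgMr; exact: continuous_expRM.
have mf : measurable_fun Rpos f by apply: measurable_funTS; exact: continuous_measurable_fun.
have fi : mu.-integrable Rpos (EFin \o f).
  by apply: (integrable_decay (C := C) e0 mf) => t t0; exact/fC/ltW.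
have ei : mu.-integrable Rpos (EFin \o (fun t => C * expR (- e * t))).
  apply: (integrable_decay e0 (C := C)).
    by apply: measurable_funTS; exact: continuous_measurable_fun.
  by move=> t t0; rewrite ger0_norm// mulr_ge0// expR_ge0.
have exp0 : (fun t : R => expR (- e * t)) @ +oo%R --> (0 : R).
  rewrite (_ : (fun x => expR (- e * x)) =
               (fun z => expR (- z)) \o (fun z => e * z)); last first.
    by apply: eq_fun => x; rewrite mulNr.
  apply: (@cvg_comp _ _ _ _ _ _ (pinfty_nbhs R)); last exact: cvgr_expR.
  exact: gt0_cvgMry.
pose G t := F t - C / e * expR (- e * t).
have dG t : is_derive t (1 : R) G (f t + C * expR (- e * t)).
  have d : is_derive t (1 : R) (fun t => C / e * expR (- e * t)) (- (C * expR (- e * t))).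
    by apply: is_derive_eq; rewrite /GRing.scale/= mulr1; field; rewrite gt_eqF.
  by apply: is_derive_eq; rewrite opprK.
have key : (\int[mu]_(t in Rpos) (f t + C * expR (- e * t))%:E = 0%:E - (G 0)%:E)%E.
  rewrite integral_itv_obnd_cbnd; last first.
    apply/measurable_EFinP; apply: measurable_funTS; apply: continuous_measurable_fun.
    by move=> t; apply: cvgD; [exact: cf|exact: ce].
  apply: (@ge0_continuous_FTC2y _ _ G).
  - by move=> t t0; have := fC _ t0; rewrite ler_norml => /andP[+ _]; lra.
  - by apply: continuous_subspaceT => t; apply: cvgD; [exact: cf|exact: ce].
  - rewrite -[X in _ --> X](subr0 0); apply: cvgB; last first.
      by rewrite -[X in _ --> X](mulr0 (C / e)); exact: cvgMr.
    apply: norm_cvg0; apply: (@squeeze_cvgr _ _ _ _ (cst 0) (fun t => C * expR (- e * t))).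
    + near=> t; rewrite normr_ge0/= FC//.
    + exact: cvg_cst.
    + by rewrite -[X in _ --> X](mulr0 C); exact: cvgMr.
  - by move=> t _; apply: ex_derive.
  - apply: cvg_at_right_filter; apply: differentiable_continuous.
    by apply/derivable1_diffP; apply: ex_derive.
  - by move=> t _; rewrite derive1E derive_val.
have : \int[mu]_(t in Rpos) (f t + C * expR (- e * t)) = - G 0.
  by rewrite /Rintegral key sub0e.
rewrite RintegralD// /G mulr0 expR0 mulr1 opprB.
have -> : \int[mu]_(t in Rpos) (C * expR (- e * t)) = C / e.
  rewrite /Rintegral; under eq_integral do rewrite EFinM.
  rewrite ge0_integralZl//=.
  - by rewrite integral_expRN.
  - by apply/measurable_EFinP; exact: measurable_expRM.
by lra.
Unshelve. all: by end_near. Qed.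

(** With z = a + i b, the combination gcos - i gsin is t^n e^(-z t). *)
Definition gcos a b n t := t ^+ n * (expR (- a * t) * cos (b * t)).
Definition gsin a b n t := t ^+ n * (expR (- a * t) * sin (b * t)).

Lemma gcos_le a b n t : 0 < a -> 0 <= t ->
  `|gcos a b n t| <= n`!%:R / (a / 2) ^+ n * expR (- (a / 2) * t).
Proof.
move=> a0 t0; have a2 : 0 < a / 2 by lra.
rewrite /gcos normrM normrX (ger0_norm t0) normrM (ger0_norm (expR_ge0 _)).
apply: (@le_trans _ _ ((n`!%:R / (a / 2) ^+ n * expR (a / 2 * t)) * (expR (- a * t) * 1))).
  rewrite ler_pM//; first by rewrite exprn_ge0.
  - exact: pow_exp_le.
  - by rewrite ler_wpM2l ?expR_ge0// cos_max.
rewrite mulr1 -mulrA -expRD (_ : a / 2 * t + - a * t = - (a / 2) * t)//; lra.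
Qed.

Lemma gsin_le a b n t : 0 < a -> 0 <= t ->
  `|gsin a b n t| <= n`!%:R / (a / 2) ^+ n * expR (- (a / 2) * t).
Proof.
move=> a0 t0; have a2 : 0 < a / 2 by lra.
rewrite /gsin normrM normrX (ger0_norm t0) normrM (ger0_norm (expR_ge0 _)).
apply: (@le_trans _ _ ((n`!%:R / (a / 2) ^+ n * expR (a / 2 * t)) * (expR (- a * t) * 1))).
  rewrite ler_pM//; first by rewrite exprn_ge0.
  - exact: pow_exp_le.
  - by rewrite ler_wpM2l ?expR_ge0// sin_max.
rewrite mulr1 -mulrA -expRD (_ : a / 2 * t + - a * t = - (a / 2) * t)//; lra.
Qed.

Lemma is_derive_pow n t : is_derive t (1 : R) (fun t : R => t ^+ n) (n%:R * t ^+ n.-1).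
Proof.
rewrite (_ : (fun t : R => t ^+ n) = id ^+ n); last first.
  by apply/funext => x; rewrite fctE.
have h := @is_deriveX R R id n t 1 1 (is_derive_id _ _).
by apply: is_derive_eq; rewrite /GRing.scale/= mulr1.
Qed.

Lemma is_derive_gcos a b n t : is_derive t (1 : R) (gcos a b n)
  (n%:R * gcos a b n.-1 t - a * gcos a b n t - b * gsin a b n t).
Proof.
have ? := is_derive_pow n t.
rewrite /gcos /gsin; apply: is_derive_eq; rewrite /GRing.scale/= !mulr1; ring.
Qed.

Lemma is_derive_gsin a b n t : is_derive t (1 : R) (gsin a b n)
  (n%:R * gsin a b n.-1 t - a * gsin a b n t + b * gcos a b n t).
Proof.
have ? := is_derive_pow n t.
rewrite /gcos /gsin; apply: is_derive_eq; rewrite /GRing.scale/= !mulr1; ring.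
Qed.

Lemma continuous_gcos a b n : continuous (gcos a b n).
Proof.
move=> t; have ? := is_derive_gcos a b n t.
by apply: differentiable_continuous; exact/derivable1_diffP.
Qed.

Lemma continuous_gsin a b n : continuous (gsin a b n).
Proof.
move=> t; have ? := is_derive_gsin a b n t.
by apply: differentiable_continuous; exact/derivable1_diffP.
Qed.

Lemma integrable_gcos a b n : 0 < a -> mu.-integrable Rpos (EFin \o gcos a b n).
Proof.
move=> a0; apply: (@integrable_decay _ (n`!%:R / (a / 2) ^+ n) (a / 2)); first lra.
  by apply: measurable_funTS; apply: continuous_measurable_fun; exact: continuous_gcos.
by move=> t t0; apply: gcos_le => //; exact: ltW.
Qed.

Lemma integrable_gsin a b n : 0 < a -> mu.-integrable Rpos (EFin \o gsin a b n).
Proof.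
move=> a0; apply: (@integrable_decay _ (n`!%:R / (a / 2) ^+ n) (a / 2)); first lra.
  by apply: measurable_funTS; apply: continuous_measurable_fun; exact: continuous_gsin.
by move=> t t0; apply: gsin_le => //; exact: ltW.
Qed.

Lemma lincomb3_le (N a b x y w kx ky kw e : R) : 0 <= N -> 0 <= a ->
  `|x| <= kx * e -> `|y| <= ky * e -> `|w| <= kw * e ->
  `|N * x - a * y - b * w| <= (N * kx + a * ky + `|b| * kw) * e.
Proof.
move=> N0 a0 hx hy hw; rewrite (le_trans (ler_normB _ _))// !mulrDl lerD//.
  rewrite (le_trans (ler_normB _ _))// lerD// normrM ger0_norm// -mulrA; exact: ler_wpM2l.
by rewrite normrM -mulrA ler_wpM2l.
Qed.

(** Integration by parts for t^n e^(-z t), split into real and imaginary parts. For n = 0 the term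
    with [n.-1] has coefficient 0, so the truncated predecessor is harmless. *)
Lemma gamma_rec a b n : 0 < a ->
  n%:R * \int[mu]_(t in Rpos) gcos a b n.-1 t - a * \int[mu]_(t in Rpos) gcos a b n t
    - b * \int[mu]_(t in Rpos) gsin a b n t = - gcos a b n 0 /\
  n%:R * \int[mu]_(t in Rpos) gsin a b n.-1 t - a * \int[mu]_(t in Rpos) gsin a b n t
    + b * \int[mu]_(t in Rpos) gcos a b n t = - gsin a b n 0.
Proof.
move=> a0; have a2 : 0 < a / 2 by lra.
pose K k := k`!%:R / (a / 2) ^+ k : R.
have K0 k : 0 <= K k by rewrite divr_ge0// exprn_ge0// ltW.
pose C := n%:R * K n.-1 + a * K n + `|b| * K n + K n.
have iZ (c : R) (f : R -> R) :
    mu.-integrable Rpos (EFin \o f) -> mu.-integrable Rpos (EFin \o (fun t : R => c * f t)).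
  move=> fi; rewrite (_ : EFin \o _ = (fun t => c%:E * (EFin \o f) t)%E)//.
  exact: integrableZl.
have iB (f g : R -> R) : mu.-integrable Rpos (EFin \o f) -> mu.-integrable Rpos (EFin \o g) ->
    mu.-integrable Rpos (EFin \o (fun t : R => f t - g t)).
  move=> fi gi; rewrite (_ : EFin \o _ = (EFin \o f) \- (EFin \o g))%E//.
  exact: integrableB.
have CK t : 0 <= expR (- (a / 2) * t) by exact: expR_ge0.
split.
- transitivity (\int[mu]_(t in Rpos) (n%:R * gcos a b n.-1 t - a * gcos a b n t - b * gsin a b n t)); last apply: (@ftc_decay (gcos a b n) _ C (a / 2)) => //.
  + rewrite RintegralB//; last exact/iZ/integrable_gsin; last first.
      by apply: iB; exact/iZ/integrable_gcos.
    rewrite RintegralB//; [|exact/iZ/integrable_gcos|exact/iZ/integrable_gcos].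
    by rewrite !RintegralZl//; [exact: integrable_gsin|exact: integrable_gcos|exact: integrable_gcos].
  + move=> t; apply: cvgB; [apply: cvgB|]; apply: cvgMr;
      [exact: continuous_gcos|exact: continuous_gcos|exact: continuous_gsin].
  + exact: is_derive_gcos.
  + move=> t t0; apply: (@le_trans _ _ ((n%:R * K n.-1 + a * K n + `|b| * K n) * expR (- (a / 2) * t))).
      apply: lincomb3_le; [by []|exact: ltW|exact: gcos_le|exact: gcos_le|exact: gsin_le].
    by rewrite /C ler_wpM2r// lerDl.
  + move=> t t0; rewrite (le_trans (gcos_le b n a0 t0))// ler_wpM2r// -/(K n) /C lerDr.
    by rewrite !addr_ge0// mulr_ge0// ltW.
- transitivity (\int[mu]_(t in Rpos) (n%:R * gsin a b n.-1 t - a * gsin a b n t + b * gcos a b n t)); last apply: (@ftc_decay (gsin a b n) _ C (a / 2)) => //.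
  + rewrite RintegralD//; last exact/iZ/integrable_gcos; last first.
      by apply: iB; exact/iZ/integrable_gsin.
    rewrite RintegralB//; [|exact/iZ/integrable_gsin|exact/iZ/integrable_gsin].
    by rewrite !RintegralZl//; [exact: integrable_gcos|exact: integrable_gsin|exact: integrable_gsin].
  + move=> t; apply: cvgD; [apply: cvgB|]; apply: cvgMr;
      [exact: continuous_gsin|exact: continuous_gsin|exact: continuous_gcos].
  + exact: is_derive_gsin.
  + move=> t t0; rewrite (_ : _ + b * gcos a b n t =
        n%:R * gsin a b n.-1 t - a * gsin a b n t - (- b) * gcos a b n t); last by ring.
    apply: (@le_trans _ _ ((n%:R * K n.-1 + a * K n + `|- b| * K n) * expR (- (a / 2) * t))).
      apply: lincomb3_le; [by []|exact: ltW|exact: gsin_le|exact: gsin_le|exact: gcos_le].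
    by rewrite /C normrN ler_wpM2r// lerDl.
  + move=> t t0; rewrite (le_trans (gsin_le b n a0 t0))// ler_wpM2r// -/(K n) /C lerDr.
    by rewrite !addr_ge0// mulr_ge0// ltW.
Qed.

Lemma complex_ext (z w : R[i]) : Re z = Re w -> Im z = Im w -> z = w.
Proof. by case: z w => a b [c d] /= -> ->. Qed.

(** The Gamma integral at a complex rate. If I_n is the integral of t^n e^(-z t), [gamma_rec] reads
    z I_0 = 1 and z I_(n+1) = (n + 1) I_n. *)
Lemma gamma_int (z : R[i]) n : 0 < Re z ->
  (\int[mu]_(t in Rpos) gcos (Re z) (Im z) n t -i*
   \int[mu]_(t in Rpos) gsin (Re z) (Im z) n t)%C = n`!%:R / z ^+ n.+1.
Proof.
move=> z0; have zn0 : z != 0 by apply: contraTneq z0 => ->; rewrite ltxx.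
elim: n => [|n ih].
  have [] := gamma_rec (Im z) 0 z0.
  rewrite /gcos /gsin !mulr0 expR0 cos0 sin0 !mulr1 expr0 mulr0 !mul0r !add0r mulr0.
  rewrite -/(gcos (Re z) (Im z) 0) -/(gsin (Re z) (Im z) 0) => h1 h2.
  apply: (mulfI zn0); rewrite expr1 mulrCA divff// mulr1.
  apply: complex_ext; rewrite ?cReM ?cImM fact0/=; move: h1 h2; lra.
have [] := gamma_rec (Im z) n.+1 z0.
rewrite /gcos /gsin !expr0n/= !mul0r oppr0 => h1 h2.
rewrite -!/(gcos _ _ _ _) -!/(gsin _ _ _ _) in h1 h2 *.
have -> : (n.+1)`!%:R / z ^+ n.+2 = z^-1 * (n.+1%:R * (n`!%:R / z ^+ n.+1)).
  by rewrite (exprS z n.+1) invfM factS natrM; ring.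
rewrite -ih; apply: (mulfI zn0); rewrite mulVKf//.
have -> : (n.+1%:R : R[i]) = (n.+1%:R%:C)%C by rewrite rmorph_nat.
move: (n.+1%:R : R) h1 h2 => N h1 h2.
apply: complex_ext; rewrite ?cReM ?cImM/=; move: h1 h2; rewrite !mul0r ?subr0 ?addr0.
  lra.
lra.
Qed.

(** The weight [expR t - 1] cancels the denominator of the density and grows at the critical rate 1;
    the decay a/2 of [g] brings the product below the threshold of [L1_exp]. *)
Lemma L1_weighted (g : R -> R) (n : nat) (a : R) : 0 < a -> continuous g ->
  (forall t, 0 <= t -> `|g t| <= n`!%:R / (a / 2) ^+ n * expR (- (a / 2) * t)) ->
  L1 (fun t => (expR t - 1) * g t).
Proof.
move=> a0 cg gle; pose K : R := n`!%:R / (a / 2) ^+ n.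
have K1 : 1 - a / 2 < 1 by lra.
apply: L1_le (L1Z K (L1_exp K1)) _.
  apply: measurable_funM; last by apply: measurable_funTS; exact: continuous_measurable_fun.
  by apply: measurable_funB => //; exact: measurable_funTS.
move=> t t0; rewrite normrM.
have e1 : 0 <= expR t - 1 by rewrite subr_ge0 -expR0 ler_expR ltW.
rewrite (ger0_norm e1) (_ : (1 - a / 2) * t = t + (- (a / 2) * t)); last by ring.
rewrite expRD mulrCA; apply: ler_pM => //; last exact/gle/ltW.
by rewrite lerBlDr lerDl.
Qed.

Lemma L1_gcos a b n : 0 < a -> L1 (fun t => (expR t - 1) * gcos a b n t).
Proof.
move=> a0; apply: (@L1_weighted _ n a) => //; first exact: continuous_gcos.
by move=> t; exact: gcos_le.
Qed.

Lemma L1_gsin a b n : 0 < a -> L1 (fun t => (expR t - 1) * gsin a b n t).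
Proof.
move=> a0; apply: (@L1_weighted _ n a) => //; first exact: continuous_gsin.
by move=> t; exact: gsin_le.
Qed.

Lemma expB1_dens t : 0 < t -> (expR t - 1) * dens t = t.
Proof.
by move=> t0; rewrite /dens mulrCA divff ?mulr1// subr_eq0 gt_eqF// -expR0 ltr_expR.
Qed.

Lemma mint_gcos a b n : 0 < a ->
  mint (fun t => (expR t - 1) * gcos a b n t) = \int[mu]_(t in Rpos) gcos a b n.+1 t.
Proof.
move=> a0; have [_ ->] := mint_lebesgue (L1_gcos b n a0).
apply: eq_Rintegral => t; rewrite inE/= in_itv/= andbT => t0.
by rewrite mulrAC expB1_dens// /gcos exprS -!mulrA.
Qed.

Lemma mint_gsin a b n : 0 < a ->
  mint (fun t => (expR t - 1) * gsin a b n t) = \int[mu]_(t in Rpos) gsin a b n.+1 t.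
Proof.
move=> a0; have [_ ->] := mint_lebesgue (L1_gsin b n a0).
apply: eq_Rintegral => t; rewrite inE/= in_itv/= andbT => t0.
by rewrite mulrAC expB1_dens// /gsin exprS -!mulrA.
Qed.

(** Termwise integration by dominated convergence, stated for an abstract [g] to cover cosine and
    sine at once. The partial sums are bounded by [bess_partial_le] with rate a/4, so that half of
    the decay a/2 of [g] is left. *)
Lemma bess_series_int (g : nat -> R -> R) (I : nat -> R) (a s : R) :
  0 < a -> 0 <= s -> (forall n, continuous (g n)) ->
  (forall n t, g n t = t ^+ n * g 0%N t) ->
  (forall n t, 0 <= t -> `|g n t| <= n`!%:R / (a / 2) ^+ n * expR (- (a / 2) * t)) ->
  (forall n, mint (fun t => (expR t - 1) * g n t) = I n) ->
  (fun n => \sum_(0 <= k < n) bessc k * s ^+ k * I k) @ \oo -->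
    mint (fun t => (expR t - 1) * g 0%N t * bess (t * s)).
Proof.
move=> a0 s0 cg gS gle gI.
have Lg n : L1 (fun t => (expR t - 1) * g n t) by apply: (@L1_weighted _ n a) => // t; exact: gle.
have a4 : 0 < a / 4 by lra.
have K1 : 1 - a / 4 < 1 by lra.
pose u n t := (expR t - 1) * g 0%N t * pseries bessc (t * s) n.
have uE n : u n = fun t => \sum_(0 <= k < n) bessc k * s ^+ k * ((expR t - 1) * g k t).
  apply/funext => t; rewrite /u /pseries seriesEnat/= mulr_sumr.
  by apply: eq_bigr => k _; rewrite (gS k) exprMn; ring.
have Lu n : L1 (u n) /\ mint (u n) = \sum_(0 <= k < n) bessc k * s ^+ k * I k.
  rewrite uE; have [L ->] := @mint_sum R nat (index_iota 0 n)
    (fun k t => bessc k * s ^+ k * ((expR t - 1) * g k t)) (fun k => L1Z _ (Lg k)).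
  by split => //; apply: eq_bigr => k _; rewrite mintZ ?gI.
rewrite (_ : (fun n => _) = fun n => mint (u n)); last first.
  by apply/funext => n; rewrite (Lu n).2.
apply: (@mint_dct _ _ _ (fun t => expR (s / (a / 4)) * expR ((1 - a / 4) * t)) _ _ _ _).2.
- by move=> n; apply: L1_meas; exact: (Lu n).1.
- exact/L1Z/L1_exp.
- move=> n t t0; rewrite /u normrM [leRHS]mulrC.
  have e1 : 0 <= expR t - 1 by rewrite subr_ge0 -expR0 ler_expR ltW.
  rewrite normrM (ger0_norm e1).
  apply: (@le_trans _ _ (expR t * (1 * expR (- (a / 2) * t)) * (expR (a / 4 * t) * expR (s / (a / 4))))).
    rewrite ler_pM ?mulr_ge0//; last exact: bess_partial_le (ltW t0) _ _.
    rewrite ler_pM//; first by rewrite lerBlDr lerDl.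
    by have := gle 0%N t (ltW t0); rewrite expr0 fact0 divr1.
  rewrite mul1r mulrA ler_wpM2r ?expR_ge0// -!expRD ler_expR.
  by rewrite le_eqVlt; apply/orP; left; apply/eqP; field.
- move=> t t0; apply: cvgMr; exact/psum_cvg/entire_bessc.
Qed.

(** The k-th term integrates to c_k s^k (k + 1)! / z^(k+2) = z^-2 (-s/z)^k / k!, with c_k = (-1)^k /
    (k! (k + 1)!): the factorial of the Gamma integral removes one of the two in the Bessel
    coefficient and leaves an exponential series. *)
Lemma bess_laplace (z : R[i]) (s : R) : 0 < Re z -> 0 <= s ->
  (mint (fun t => (expR t - 1) * gcos (Re z) (Im z) 0 t * bess (t * s)) -i*
   mint (fun t => (expR t - 1) * gsin (Re z) (Im z) 0 t * bess (t * s)))%C =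
  z ^- 2 * complex_exp (- s%:C%C / z).
Proof.
move=> z0 s0; have zn0 : z != 0 by apply: contraTneq z0 => ->; rewrite ltxx.
have gcS n t : gcos (Re z) (Im z) n t = t ^+ n * gcos (Re z) (Im z) 0 t.
  by rewrite /gcos expr0 mul1r.
have gsS n t : gsin (Re z) (Im z) n t = t ^+ n * gsin (Re z) (Im z) 0 t.
  by rewrite /gsin expr0 mul1r.
have hc := @bess_series_int (gcos (Re z) (Im z)) _ _ s z0 s0
  (fun n => @continuous_gcos _ _ n) gcS (fun n t => gcos_le _ n z0) (fun n => mint_gcos _ n z0).
have hs := @bess_series_int (gsin (Re z) (Im z)) _ _ s z0 s0
  (fun n => @continuous_gsin _ _ n) gsS (fun n t => gsin_le _ n z0) (fun n => mint_gsin _ n z0).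
set zeta := - s%:C%C / z.
have term k : (bessc k * s ^+ k)%:C%C *
    (\int[mu]_(t in Rpos) gcos (Re z) (Im z) k.+1 t -i*
     \int[mu]_(t in Rpos) gsin (Re z) (Im z) k.+1 t)%C =
    z ^- 2 * (zRe zeta k +i* zIm zeta k)%C.
  have nz j : (j`!%:R : R[i]) != 0 by rewrite pnatr_eq0 -lt0n fact_gt0.
  have -> : (zRe zeta k +i* zIm zeta k)%C = zeta ^+ k / k`!%:R.
    have -> : (k`!%:R : R[i])^-1 = ((k`!%:R : R)^-1%:C)%C by rewrite fmorphV rmorph_nat.
    by apply: complex_ext; rewrite ?cReM ?cImM /zRe /zIm /=; ring.
  rewrite gamma_int// /bessc /zeta !rmorphM fmorphV/= !rmorphM/= !rmorphXn/= rmorphN1 !rmorph_nat.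
  rewrite exprMn exprVn [(- s%:C%C) ^+ k]exprNn -[k.+2]addn2 exprD.
  move: (nz k) (nz k.+1) (expf_neq0 k zn0).
  move: (k`!%:R : R[i]) ((k.+1)`!%:R : R[i]) (z ^+ k) ((-1) ^+ k : R[i]) (s%:C%C ^+ k) => A B Z e S hA hB hZ.
  by field; rewrite ?hA ?hB ?hZ ?zn0.
have hR := @psum_cvg R _ 1 (entire_zRe zeta); have hI := @psum_cvg R _ 1 (entire_zIm zeta).
rewrite psum_cexp; apply: complex_ext; rewrite ?cReM ?cImM /=.
- apply: (cvg_unique _ hc) => //.
  rewrite (_ : (fun n => _) = fun n => Re (z ^- 2) * pseries (zRe zeta) 1 n -
      Im (z ^- 2) * pseries (zIm zeta) 1 n); first by apply: cvgB; exact: cvgMr.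
  apply/funext => n; rewrite /pseries !seriesEnat/= !mulr_sumr -sumrB.
  apply: eq_bigr => k _; have /(congr1 Re) := term k.
  by rewrite !cReM/= expr1n !mulr1 mul0r subr0.
- rewrite -[RHS]opprK; congr (- _); apply: (cvg_unique _ hs) => //.
  rewrite (_ : (fun n => _) = fun n => - (Re (z ^- 2) * pseries (zIm zeta) 1 n +
      Im (z ^- 2) * pseries (zRe zeta) 1 n)); first by apply: cvgN; apply: cvgD; exact: cvgMr.
  apply/funext => n; rewrite /pseries !seriesEnat/= !mulr_sumr -big_split/= -sumrN.
  apply: eq_bigr => k _; have /(congr1 Im) := term k.
  by rewrite !cImM/= expr1n !mulr1 mul0r addr0 mulrN => <-; rewrite opprK.
Qed.

End Gamma.

(** * The transfer operator on L_2(m) *)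

Section Farey.
Context {R : realType}.
Implicit Types (phi psi : R -> R[i]) (t s : R) (c z : R[i]).

Definition reF phi t := Re (phi t).
Definition imF phi t := Im (phi t).
Definition cmeas phi := meas (reF phi) /\ meas (imF phi).
Definition CL1 phi := L1 (reF phi) /\ L1 (imF phi).
Definition CL2 phi := SL2 (reF phi) /\ SL2 (imF phi).

Lemma L2P phi : L2 phi <-> CL2 phi.
Proof.
have nE t : Normc.normc (phi t) ^+ 2 = reF phi t ^+ 2 + imF phi t ^+ 2.
  rewrite /reF /imF; case: (phi t) => a b /=.
  by rewrite sqr_sqrtr// addr_ge0// sqr_ge0.
split=> [[mr mi ioo]|[[mr Lr] [mi Li]]].
  have Ls : L1 (fun t => reF phi t ^+ 2 + imF phi t ^+ 2).
    apply/integrableP; split.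
      by apply/measurable_EFinP; apply: measurable_funD; exact: measurable_funX.
    apply: le_lt_trans ioo; rewrite le_eqVlt; apply/orP; left; apply/eqP.
    by apply: eq_integral => t _; rewrite /= nE ger0_norm// addr_ge0// sqr_ge0.
  split; split=> //; apply: L1_le Ls _; try exact: measurable_funX.
    by move=> t _; rewrite ger0_norm ?sqr_ge0// lerDl sqr_ge0.
  by move=> t _; rewrite ger0_norm ?sqr_ge0// lerDr sqr_ge0.
split=> //; have /integrableP[_] := L1D Lr Li.
apply: le_lt_trans; rewrite le_eqVlt; apply/orP; left; apply/eqP.
by apply: eq_integral => t _; rewrite /= nE ger0_norm// addr_ge0// sqr_ge0.
Qed.

Lemma CL2_cmeas phi : CL2 phi -> cmeas phi.
Proof. by case=> -[? _] [? _]. Qed.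

Lemma CL2_CL1 phi : CL2 phi -> CL1 phi.
Proof. by case=> h1 h2; split; exact: SL2_L1. Qed.

Lemma CL2_norm1 phi : CL2 phi -> SL2 (fun t => norm1 (phi t)).
Proof. by case=> h1 h2; apply: SL2D; exact: SL2_norm. Qed.

Lemma CL2_le phi (h : R -> R) : cmeas phi -> SL2 h ->
  (forall t, 0 < t -> norm1 (phi t) <= h t) -> CL2 phi.
Proof.
move=> [mr mi] Lh ph; split; apply: SL2_le Lh _ => // t t0; apply: le_trans (ph _ t0).
  exact: norm1_Re.
exact: norm1_Im.
Qed.

Lemma CL1_le phi (h : R -> R) : cmeas phi -> L1 h ->
  (forall t, 0 < t -> norm1 (phi t) <= h t) -> CL1 phi.
Proof.
move=> [mr mi] Lh ph; split; apply: L1_le Lh _ => // t t0; apply: le_trans (ph _ t0).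
  exact: norm1_Re.
exact: norm1_Im.
Qed.

Lemma cmeasD phi psi : cmeas phi -> cmeas psi -> cmeas (fun t => phi t + psi t).
Proof.
move=> [p1 p2] [q1 q2]; split.
  rewrite (_ : reF _ = fun t => reF phi t + reF psi t); first exact: measurable_funD.
  by apply/funext => t; rewrite /reF raddfD.
rewrite (_ : imF _ = fun t => imF phi t + imF psi t); first exact: measurable_funD.
by apply/funext => t; rewrite /imF raddfD.
Qed.

Lemma cmeasM phi psi : cmeas phi -> cmeas psi -> cmeas (fun t => phi t * psi t).
Proof.
move=> [p1 p2] [q1 q2]; split.
  rewrite (_ : reF _ = fun t => reF phi t * reF psi t - imF phi t * imF psi t).
    by apply: measurable_funB; exact: measurable_funM.
  by apply/funext => t; rewrite /reF cReM.
rewrite (_ : imF _ = fun t => reF phi t * imF psi t + imF phi t * reF psi t).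
  by apply: measurable_funD; exact: measurable_funM.
by apply/funext => t; rewrite /imF cImM.
Qed.

Lemma cmeas_real (u : R -> R) : meas u -> cmeas (fun t => (u t)%:C%C).
Proof. by move=> mu_; split => //; exact: measurable_cst. Qed.

Lemma cmeas_cst c : cmeas (fun=> c).
Proof. by split; exact: measurable_cst. Qed.

Lemma CL2D phi psi : CL2 phi -> CL2 psi -> CL2 (fun t => phi t + psi t).
Proof.
move=> Lp Lq; apply: CL2_le (SL2D (CL2_norm1 Lp) (CL2_norm1 Lq)) _.
  by apply: cmeasD; exact: CL2_cmeas.
by move=> t _; exact: norm1D.
Qed.

Lemma CL2M_bounded phi psi (C : R) : cmeas psi -> CL2 phi ->
  (forall t, 0 < t -> norm1 (psi t) <= C) -> CL2 (fun t => psi t * phi t).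
Proof.
move=> mp Lp pC; apply: CL2_le (SL2Z C (CL2_norm1 Lp)) _.
  by apply: cmeasM => //; exact: CL2_cmeas.
by move=> t t0; rewrite (le_trans (norm1M _ _))// ler_wpM2r ?norm1_ge0// pC.
Qed.

Lemma CL2Z c phi : CL2 phi -> CL2 (fun t => c * phi t).
Proof. by move=> Lp; apply: (CL2M_bounded (C := norm1 c)) => //; exact: cmeas_cst. Qed.

Lemma CL2M phi psi : CL2 phi -> CL2 psi -> CL1 (fun t => phi t * psi t).
Proof.
move=> Lp Lq; apply: CL1_le (SL2M (CL2_norm1 Lp) (CL2_norm1 Lq)) _.
  by apply: cmeasM; exact: CL2_cmeas.
by move=> t _; exact: norm1M.
Qed.

Lemma cintE phi : cintegral phi = (mint (reF phi) +i* mint (imF phi))%C.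
Proof. by []. Qed.

Lemma cint_eq phi psi : (forall t, 0 < t -> phi t = psi t) -> cintegral phi = cintegral psi.
Proof.
move=> pq; rewrite !cintE; congr (_ +i* _)%C; apply: mint_eq => t t0;
  by rewrite /reF /imF pq.
Qed.

Lemma cintD phi psi : CL1 phi -> CL1 psi ->
  cintegral (fun t => phi t + psi t) = cintegral phi + cintegral psi.
Proof.
move=> [p1 p2] [q1 q2]; rewrite !cintE.
apply: complex_ext => /=; rewrite -mintD//; apply: mint_eq => t _; by rewrite /reF /imF raddfD.
Qed.

Lemma cintZ c phi : CL1 phi -> cintegral (fun t => c * phi t) = c * cintegral phi.
Proof.
move=> [p1 p2]; rewrite !cintE; apply: complex_ext => /=; rewrite ?cReM ?cImM/=.
  rewrite -!mintZ// -mintB; [|exact: L1Z|exact: L1Z].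
  by apply: mint_eq => t _; rewrite /reF cReM.
rewrite -!mintZ// -mintD; [|exact: L1Z|exact: L1Z].
by apply: mint_eq => t _; rewrite /imF cImM.
Qed.

Definition Kop (k : R -> R -> R) phi t :=
  (mint (fun s => k t s * reF phi s) +i* mint (fun s => k t s * imF phi s))%C.

Definition bkernel (k : R -> R -> R) := measurable_fun setT (fun x : R * R => k x.1 x.2) /\
  exists C, forall t s, 0 < t -> 0 < s -> `|k t s| <= C.

Lemma Kop_cmeas k phi : bkernel k -> CL1 phi -> cmeas (Kop k phi).
Proof.
move=> [mk [C kC]] [p1 p2]; split.
  by have [] := L1_kernel mk kC p1.
by have [] := L1_kernel mk kC p2.
Qed.

Lemma Kop_L1 k phi t : bkernel k -> CL1 phi -> 0 < t ->
  L1 (fun s => k t s * reF phi s) /\ L1 (fun s => k t s * imF phi s).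
Proof.
move=> [mk [C kC]] [p1 p2] t0; split.
  by have [h _] := L1_kernel mk kC p1; exact: h.
by have [h _] := L1_kernel mk kC p2; exact: h.
Qed.

Lemma Kop_le k phi (h : R -> R) t : bkernel k -> CL1 phi -> 0 < t -> L1 h ->
  (forall s, 0 < s -> `|k t s| * norm1 (phi s) <= h s) -> norm1 (Kop k phi t) <= mint h.
Proof.
move=> bk Lp t0 Lh kh; have [h1 h2] := Kop_L1 bk Lp t0; rewrite /norm1/=.
apply: (@le_trans _ _ (mint (fun s => `|k t s * reF phi s| + `|k t s * imF phi s|))).
  by rewrite mintD ?lerD ?mint_norm//; exact: L1_norm.
apply: mint_le => //; first by apply: L1D; exact: L1_norm.
by move=> s s0; rewrite !normrM -mulrDr kh.
Qed.

Lemma Kop_CL2 k phi : bkernel k -> CL1 phi -> CL2 (Kop k phi).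
Proof.
move=> bk Lp; have [mk [C kC]] := bk.
have Ln : L1 (fun s => C * norm1 (phi s)).
  by apply/L1Z/L1D; apply: L1_norm; [exact: Lp.1|exact: Lp.2].
apply: CL2_le (SL2_cst (mint (fun s => C * norm1 (phi s)))) _; first exact: Kop_cmeas.
move=> t t0; apply: Kop_le => // s s0; by rewrite ler_wpM2r ?norm1_ge0// kC.
Qed.

Lemma KopD k phi psi t : bkernel k -> CL1 phi -> CL1 psi -> 0 < t ->
  Kop k (fun s => phi s + psi s) t = Kop k phi t + Kop k psi t.
Proof.
move=> bk Lp Lq t0; have [p1 p2] := Kop_L1 bk Lp t0; have [q1 q2] := Kop_L1 bk Lq t0.
apply: complex_ext => /=; rewrite -mintD//; apply: mint_eq => s _;
  by rewrite /reF /imF raddfD/= mulrDr.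
Qed.

Lemma KopZ k c phi t : bkernel k -> CL1 phi -> 0 < t ->
  Kop k (fun s => c * phi s) t = c * Kop k phi t.
Proof.
move=> bk Lp t0; have [p1 p2] := Kop_L1 bk Lp t0.
apply: complex_ext; rewrite ?cReM ?cImM/=.
  rewrite -!mintZ// -mintB; [|exact: L1Z|exact: L1Z].
  by apply: mint_eq => s _; rewrite /reF /imF cReM; ring.
rewrite -!mintZ// -mintD; [|exact: L1Z|exact: L1Z].
by apply: mint_eq => s _; rewrite /reF /imF cImM; ring.
Qed.

Lemma Kop_eq k phi psi t : (forall s, 0 < s -> phi s = psi s) -> Kop k phi t = Kop k psi t.
Proof.
by move=> pq; congr (_ +i* _)%C; apply: mint_eq => s s0; rewrite /reF /imF pq.
Qed.

Definition bk t s : R := bess (t * s).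

Lemma bkernel_bk : bkernel bk.
Proof.
split.
  apply: (measurableT_comp (f := @bess R)).
    by apply: continuous_measurable_fun; exact: continuous_bess.
  by apply: measurable_funM; [exact: measurable_fst|exact: measurable_snd].
by exists 1 => t s t0 s0; apply: bess_le1; rewrite mulr_ge0// ltW.
Qed.

Definition Nop phi t := (1 - expR (- t))%:C%C * Kop bk phi t.
Definition Aop phi t := (expR (- t))%:C%C * phi t + Nop phi t.

Lemma norm1_real (x : R) : norm1 (x%:C)%C = `|x|.
Proof. by rewrite /norm1/= normr0 addr0. Qed.

Lemma expRN_01 t : 0 < t -> 0 < expR (- t) < 1.
Proof. by move=> t0; rewrite expR_gt0 -expR0 ltr_expR oppr_lt0. Qed.

Lemma meas_expRN : meas (fun t => expR (- t)).
Proof.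
rewrite (_ : (fun t => _) = fun t => expR (-1 * t)); first exact: measurable_expRM.
by apply/funext => t; rewrite mulN1r.
Qed.

Lemma Nop_CL2 phi : CL2 phi -> CL2 (Nop phi).
Proof.
move=> Lp; apply: (CL2M_bounded (C := 1)).
- by apply: cmeas_real; apply: measurable_funB => //; exact: meas_expRN.
- by apply: Kop_CL2; [exact: bkernel_bk|exact: CL2_CL1].
- move=> t t0; have /andP[e0 e1] := expRN_01 t0; rewrite norm1_real ger0_norm; lra.
Qed.

Lemma Aop_CL2 phi : CL2 phi -> CL2 (Aop phi).
Proof.
move=> Lp; apply: CL2D; last exact: Nop_CL2.
apply: (CL2M_bounded (C := 1)) => //.
  by apply: cmeas_real; exact: meas_expRN.
by move=> t t0; have /andP[e0 e1] := expRN_01 t0; rewrite norm1_real ger0_norm ltW.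
Qed.

Definition lapk z t := complex_exp (- t%:C%C * z) * (expR t)%:C%C.

Lemma lapkE z t : lapk z t =
  ((expR t * gcos (Re z) (Im z) 0 t) -i* (expR t * gsin (Re z) (Im z) 0 t))%C.
Proof.
rewrite /lapk /complex_exp /gcos /gsin !expr0 !mul1r.
have -> : Re (- t%:C%C * z) = - Re z * t by rewrite cReM/=; ring.
have -> : Im (- t%:C%C * z) = - (Im z * t) by rewrite cImM/=; ring.
rewrite cosN sinN; apply: complex_ext; rewrite ?cReM ?cImM/= ?cReM ?cImM/=; ring.
Qed.

Lemma lapk_cmeas z : cmeas (lapk z).
Proof.
split.
  rewrite (_ : reF _ = fun t => expR t * gcos (Re z) (Im z) 0 t).
    apply: measurable_funM; first exact: measurable_funTS.
    by apply: measurable_funTS; apply: continuous_measurable_fun; exact: continuous_gcos.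
  by apply/funext => t; rewrite /reF lapkE.
rewrite (_ : imF _ = fun t => - (expR t * gsin (Re z) (Im z) 0 t)).
  apply: measurableT_comp => //; apply: measurable_funM; first exact: measurable_funTS.
  by apply: measurable_funTS; apply: continuous_measurable_fun; exact: continuous_gsin.
by apply/funext => t; rewrite /imF lapkE.
Qed.

(** The square of the kernel has growth rate 2 (1 - Re z), and this is below the threshold 1 of
    [L1_exp] precisely when Re z > 1/2: the disk is the domain on which the Laplace kernel is
    square-integrable. *)
Lemma lapk_CL2 z : 2^-1 < Re z -> CL2 (lapk z).
Proof.
move=> z2; have c1 : 2 * (1 - Re z) < 1 by lra.
apply: (@CL2_le _ (fun t => 2 * expR ((1 - Re z) * t))).
- exact: lapk_cmeas.
- apply: SL2Z; split; first exact: measurable_expRM.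
  by apply: (L1_eq _ (L1_exp c1)) => t _; rewrite -expRM_natl; congr expR; ring.
- move=> t t0; rewrite (le_trans (norm1M _ _))// norm1_real ger0_norm ?expR_ge0//.
  have := norm1_cexp (- t%:C%C * z); rewrite (_ : Re (- t%:C%C * z) = - t * Re z); last by rewrite cReM/=; ring.
  rewrite (_ : (1 - Re z) * t = - t * Re z + t); last by ring.
  by rewrite expRD mulrA => h; rewrite ler_wpM2r ?expR_ge0.
Qed.

Lemma laplaceE phi (w : disk R) :
  laplace phi w = (sval w ^+ 2)^-1 * cintegral (fun t => lapk (sval w)^-1 t * phi t).
Proof. by []. Qed.

Lemma laplaceD phi psi : CL2 phi -> CL2 psi ->
  laplace (fun t => phi t + psi t) = laplace phi + laplace psi.
Proof.
move=> Lp Lq; apply/funext => w; rewrite fctE !laplaceE -mulrDr -cintD.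
- by congr (_ * _); apply: cint_eq => t _; rewrite mulrDr.
- by apply: CL2M => //; apply: lapk_CL2; exact: (svalP w).
- by apply: CL2M => //; apply: lapk_CL2; exact: (svalP w).
Qed.

Lemma laplaceZ c phi : CL2 phi -> laplace (fun t => c * phi t) = c *: laplace phi.
Proof.
move=> Lp; apply/funext => w; transitivity (c * laplace phi w) => //.
rewrite !laplaceE [RHS]mulrCA -[c * cintegral _]cintZ.
  by congr (_ * _); apply: cint_eq => t _; rewrite mulrCA.
by apply: CL2M => //; apply: lapk_CL2; exact: (svalP w).
Qed.

Lemma laplace_eq phi psi : (forall t, 0 < t -> phi t = psi t) -> laplace phi = laplace psi.
Proof.
move=> pq; apply/funext => w; rewrite !laplaceE; congr (_ * _).
by apply: cint_eq => t t0; rewrite pq.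
Qed.

(** In the variable z = 1/w the left branch w -> w / (w + 1) is the translation z -> z + 1, which
    therefore acts as multiplication by e^-t. *)
Lemma lapk_shift z t : lapk (z + 1) t = lapk z t * (expR (- t))%:C%C.
Proof.
rewrite /lapk mulrDr cexpD mulr1 (_ : - t%:C%C = (- t)%:C%C); last by rewrite rmorphN.
by rewrite cexp_real; ring.
Qed.

(** Since e^t (1 - e^-t) = e^t - 1, Fubini moves the integration in t onto the Bessel kernel, where
    [bess_laplace] evaluates it. The exchange is done on real functions: [A] and [B] carry the real
    part and minus the imaginary part of the weighted Laplace kernel. *)
Lemma Kop_laplace phi z : CL2 phi -> 0 < Re z ->
  cintegral (fun t => lapk z t * Nop phi t) =
  z ^- 2 * cintegral (fun s => complex_exp (- s%:C%C / z) * phi s).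
Proof.
move=> Lp z0; have [p1 p2] := CL2_CL1 Lp.
set u := reF phi in p1 *; set v := imF phi in p2 *.
pose A t := (expR t - 1) * gcos (Re z) (Im z) 0 t.
pose B t := (expR t - 1) * gsin (Re z) (Im z) 0 t.
have LA : L1 A by exact: L1_gcos.
have LB : L1 B by exact: L1_gsin.
pose P s := Re (z ^- 2 * complex_exp (- s%:C%C / z)).
pose Q s := Im (z ^- 2 * complex_exp (- s%:C%C / z)).
have [mk [C kC]] := bkernel_bk.
have swap f g : L1 f -> L1 g -> L1 (fun t => f t * mint (fun s => bk t s * g s)) /\
    mint (fun t => f t * mint (fun s => bk t s * g s)) =
    mint (fun s => g s * mint (fun t => f t * bess (t * s))).
  move=> Lf Lg; split; last first.
    rewrite (mint_swap mk kC Lf Lg); apply: mint_eq => s _; congr (_ * _).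
    by apply: mint_eq => t _; rewrite mulrC.
  have [Lk mk'] := L1_kernel mk kC Lg.
  apply: (L1_le (h := fun t => mint (fun s => C * `|g s|) * `|f t|)).
  - by apply: measurable_funM => //; exact: L1_meas.
  - by apply: L1Z; exact: L1_norm.
  - move=> t t0; rewrite normrM mulrC ler_wpM2r//.
    apply: mint_normle; [exact: Lk|by apply: L1Z; exact: L1_norm|].
    by move=> s s0; rewrite normrM ler_wpM2r// kC.
have PE s : 0 < s -> mint (fun t => A t * bess (t * s)) = P s.
  by move=> s0; have /(congr1 Re) := bess_laplace z0 (ltW s0).
have QE s : 0 < s -> mint (fun t => B t * bess (t * s)) = - Q s.
  by move=> s0; rewrite /Q -(bess_laplace z0 (ltW s0))/= opprK.
have gw f g h : L1 f -> L1 g -> (forall s, 0 < s -> mint (fun t => f t * bess (t * s)) = h s) ->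
    L1 (fun s => g s * h s).
  move=> Lf Lg fh; apply: (L1_eq (u := fun s => g s * mint (fun t => bk s t * f t))).
    by move=> s s0; rewrite -fh//; congr (_ * _); apply: mint_eq => t _; rewrite mulrC /bk mulrC [s * t]mulrC mulrC.
  exact: (swap _ _ Lg Lf).1.
rewrite !cintE.
have e1 : mint (reF (fun t => lapk z t * Nop phi t)) =
    mint (fun t => A t * mint (fun s => bk t s * u s)) + mint (fun t => B t * mint (fun s => bk t s * v s)).
  rewrite -mintD; [|exact: (swap _ _ _ _).1|exact: (swap _ _ _ _).1].
  apply: mint_eq => t t0; rewrite /reF lapkE /Nop !cReM /= /A /B -/u -/v.
  have E : expR t * expR (- t) = 1 by rewrite -expRD subrr expR0.
  have -> : expR t - 1 = expR t * (1 - expR (- t)) by rewrite mulrBr E mulr1.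
  by ring.
have e2 : mint (imF (fun t => lapk z t * Nop phi t)) =
    mint (fun t => A t * mint (fun s => bk t s * v s)) - mint (fun t => B t * mint (fun s => bk t s * u s)).
  rewrite -mintB; [|exact: (swap _ _ _ _).1|exact: (swap _ _ _ _).1].
  apply: mint_eq => t t0; rewrite /imF lapkE /Nop !cImM /= ?cReM/= /A /B -/u -/v.
  have E : expR t * expR (- t) = 1 by rewrite -expRD subrr expR0.
  have -> : expR t - 1 = expR t * (1 - expR (- t)) by rewrite mulrBr E mulr1.
  by ring.
rewrite e1 e2 !(swap _ _ _ _).2//.
have lQ g : L1 g -> L1 (fun s => g s * Q s).
  move=> Lg; apply: (L1_eq _ (L1Z (-1) (gw B g (fun s => - Q s) LB Lg QE))) => s _; ring.
have r1 g : L1 g -> mint (fun s => g s * mint (fun t => A t * bess (t * s))) = mint (fun s => g s * P s).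
  by move=> Lg; apply: mint_eq => s s0; rewrite PE.
have r2 g : L1 g -> mint (fun s => g s * mint (fun t => B t * bess (t * s))) = - mint (fun s => g s * Q s).
  move=> Lg; rewrite -[RHS]mulN1r -mintZ; last exact: lQ.
  by apply: mint_eq => s s0; rewrite QE//; ring.
rewrite !r1// !r2// opprK -cintZ; last first.
  apply: CL2_CL1; apply: (CL2M_bounded (C := 2)) => //.
    rewrite (_ : (fun t => _) = fun t => lapk z^-1 t * (expR (- t))%:C%C).
      by apply: cmeasM; [exact: lapk_cmeas|apply: cmeas_real; exact: meas_expRN].
    by apply/funext => t; rewrite /lapk -mulrA -rmorphM -expRD subrr expR0 rmorph1 mulr1.
  move=> t t0; apply: (le_trans (norm1_cexp _)); rewrite -[leRHS]mulr1 ler_wpM2l//.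
  rewrite -expR0 ler_expR cReM/= oppr0 mul0r subr0 mulNr oppr_le0 mulr_ge0 ?ltW//.
  by case: (z) z0 => a b /= a0; rewrite divr_gt0// ltr_pwDl ?sqr_ge0// exprn_gt0.
have lP g : L1 g -> L1 (fun s => g s * P s) by move=> Lg; exact: gw LA Lg PE.
rewrite cintE; congr (_ +i* _)%C.
  rewrite -mintB; [|exact: lP|exact: lQ].
  apply: mint_eq => t _; rewrite /reF mulrA cReM -/(P t) -/(Q t) /u /v /reF /imF; ring.
rewrite -mintD; [|exact: lP|exact: lQ].
apply: mint_eq => t _; rewrite /imF mulrA cImM -/(P t) -/(Q t) /u /v /reF /imF; ring.
Qed.

Lemma disk_algebra (F : fieldType) (w : F) : w != 0 -> w + 1 != 0 ->
  [/\ (1 / (w + 1)) ^+ 2 * ((w / (w + 1)) ^+ 2)^-1 = (w ^+ 2)^-1,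
      (w / (w + 1))^-1 = w^-1 + 1 &
      (1 / (w + 1)) ^+ 2 * ((1 / (w + 1)) ^+ 2)^-1 = (w ^+ 2)^-1 * w^-1 ^- 2].
Proof.
move=> w0 w1; split; first by field; rewrite w0 w1.
  by field; rewrite w0 w1.
by rewrite divff ?expf_neq0 ?mul1r ?invr_eq0// exprVn invrK mulVf ?expf_neq0.
Qed.

(** The left branch gives multiplication by e^-t through [lapk_shift]. The right branch evaluates
    the transform at 1/(w + 1), where the kernel is e^(-s (w + 1)) e^s = e^(-s w), the right-hand
    side of [Kop_laplace] for z = 1/w; [disk_algebra] matches the prefactors. *)
Lemma transfer_laplace phi : CL2 phi -> transfer (laplace phi) = laplace (Aop phi).
Proof.
move=> Lp; apply/funext => w.
have z2 := svalP w; set z := (sval w)^-1 in z2.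
have w0 : sval w != 0.
  by apply: contraTneq z2; rewrite /z => ->; rewrite invr0/= ltNge invr_ge0 ler0n.
have L2l : CL2 (lapk z) by exact: lapk_CL2.
have w1 : sval w + 1 != 0.
  apply/eqP => /eqP; rewrite addr_eq0 => /eqP e.
  have e1 : Re z = -1 by rewrite /z e invrN invr1 raddfN.
  have h0 : (0 : R) < 2^-1 by rewrite invr_gt0 ltr0n.
  by move: (lt_trans h0 z2); rewrite e1 ltNge lerN10.
have z0 : 0 < Re z by apply: lt_trans z2; rewrite invr_gt0 ltr0n.
have [a1 a2 a3] := disk_algebra w0 w1.
transitivity ((sval w ^+ 2)^-1 * (cintegral (fun t => lapk z t * ((expR (- t))%:C%C * phi t)) +
    cintegral (fun t => lapk z t * Nop phi t))); last first.
  rewrite laplaceE; congr (_ * _); rewrite -cintD.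
  - by apply: cint_eq => t _; rewrite -mulrDr.
  - apply: CL2M => //; apply: (CL2M_bounded (C := 1)) => //.
      by apply: cmeas_real; exact: meas_expRN.
    by move=> t t0; have /andP[e0 e1] := expRN_01 t0; rewrite norm1_real ger0_norm ltW.
  - by apply: CL2M => //; exact: Nop_CL2.
rewrite (Kop_laplace Lp z0) mulrDr /transfer mulrDr; congr (_ + _).
  rewrite laplaceE mulrA /= a1; congr (_ * _).
  by apply: cint_eq => t _; rewrite mulrA -lapk_shift a2.
rewrite laplaceE mulrA /= a3 -mulrA; congr (_ * (_ * _)).
apply: cint_eq => t _; congr (_ * _).
rewrite div1r invrK lapk_shift /z invrK /lapk -mulrA -rmorphM -expRD subrr expR0 rmorph1 mulr1.
by [].
Qed.

End Farey.

(** * Injectivity of the Laplace transform *)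

Section Injectivity.
Context {R : realType}.
Implicit Types (phi psi : R -> R[i]) (t s x y : R) (c z : R[i]).

Lemma bernoulli_ge x N : -1 <= x -> 1 + N%:R * x <= (1 + x) ^+ N.
Proof.
move=> x1; elim: N => [|N ih]; first by rewrite mul0r addr0 expr0.
rewrite exprS (@le_trans _ _ ((1 + x) * (1 + N%:R * x)))//; last first.
  by rewrite ler_wpM2l//; lra.
rewrite -natr1 -subr_ge0 (_ : _ - _ = N%:R * x ^+ 2); last by ring.
by rewrite mulr_ge0// sqr_ge0.
Qed.

(* The polynomials [(1 - x ^+ n) ^+ (2 ^ n)] tend to the indicator function of
   [[0, 1/2]]; at [x = expR (- c * t)] they recover the integral over a half-line
   from the exponential moments. *)
Lemma cutoff_lt x : 0 <= x -> x < 2^-1 ->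
  (fun n : nat => (1 - x ^+ n) ^+ (2 ^ n)) @ \oo --> (1 : R).
Proof.
move=> x0 x2; have x1 n : 0 <= x ^+ n <= 1.
  by rewrite exprn_ge0//= exprn_ile1//; lra.
apply: (@squeeze_cvgr _ _ _ _ (fun n => 1 - (2 * x) ^+ n) (cst 1)).
- near=> n; have /andP[y0 y1] := x1 n; apply/andP; split.
    have := @bernoulli_ge (- x ^+ n) (2 ^ n)%N; rewrite lerN2 => /(_ y1).
    by rewrite mulrN exprMn natrX.
  by rewrite exprn_ile1//; lra.
- rewrite -[X in _ --> X](subr0 1); apply: cvgB; first exact: cvg_cst.
  by apply: cvg_expr; rewrite ger0_norm ?mulr_ge0//; lra.
- exact: cvg_cst.
Unshelve. all: by end_near. Qed.

(** With y = x^n and N = 2^n, (1 - y)^N (1 + y)^N <= 1 and Bernoulli's inequality give (1 - y)^N <=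
    1 / (N y) = (2 x)^-n. *)
Lemma cutoff_gt x : 2^-1 < x -> x <= 1 ->
  (fun n : nat => (1 - x ^+ n) ^+ (2 ^ n)) @ \oo --> (0 : R).
Proof.
move=> x2 x1; have x0 : 0 < x by apply: lt_trans x2; rewrite invr_gt0 ltr0n.
apply: (@squeeze_cvgr _ _ _ _ (cst 0) (fun n => ((2 * x)^-1) ^+ n)).
- near=> n.
  have y0 : 0 < x ^+ n by rewrite exprn_gt0.
  have y1 : x ^+ n <= 1 by rewrite exprn_ile1// ltW.
  have z0 : 0 <= (1 - x ^+ n) ^+ (2 ^ n) by rewrite exprn_ge0// subr_ge0.
  rewrite z0/= exprVn -[leRHS]mul1r ler_pdivlMr ?exprn_gt0//; last by lra.
  apply: (@le_trans _ _ ((1 - x ^+ n) ^+ (2 ^ n) * (1 + x ^+ n) ^+ (2 ^ n))).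
    rewrite ler_wpM2l// exprMn -natrX.
    have := @bernoulli_ge (x ^+ n) (2 ^ n)%N; rewrite (le_trans _ (ltW y0)) ?lerN10// => /(_ isT).
    by apply: le_trans; rewrite lerDr.
  by rewrite -exprMn exprn_ile1//; [rewrite mulr_ge0//; lra|have := sqr_ge0 (x ^+ n); lra].
- exact: cvg_cst.
- apply: cvg_expr; rewrite ger0_norm ?invr_ge0; last by lra.
  by rewrite invf_lt1; lra.
Unshelve. all: by end_near. Qed.

Section RealMoments.
Variable u : R -> R.
Hypothesis Lu : L1 u.
Hypothesis moments : forall s, 0 <= s -> mint (fun t => expR (- s * t) * u t) = 0.

Lemma L1_expM (s : R) : 0 <= s -> L1 (fun t => expR (- s * t) * u t).
Proof.
move=> s0; apply: L1_le (L1_norm Lu) _.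
  by apply: measurable_funM; [exact: measurable_expRM|exact: L1_meas].
move=> t t0; rewrite normrM ler_piMl// ger0_norm ?expR_ge0//.
by rewrite -expR0 ler_expR mulNr oppr_le0 mulr_ge0// ltW.
Qed.

Lemma moment_cutoff (r : R) N : 0 <= r ->
  mint (fun t => (1 - expR (- r * t)) ^+ N * u t) = 0.
Proof.
move=> r0.
transitivity (mint (fun t => \sum_(i <- index_iota 0 N.+1)
   ('C(N, i)%:R * (-1) ^+ i) * (expR (- (i%:R * r) * t) * u t))).
  apply: mint_eq => t _; rewrite exprDn big_mkord mulr_suml; apply: eq_bigr => i _.
  rewrite expr1n mul1r [(- expR _) ^+ _]exprNn -mulr_natl.
  have -> : expR (- (i%:R * r) * t) = expR (- r * t) ^+ i.
    by rewrite -expRM_natl; congr expR; ring.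
  by ring.
have Li i : L1 (fun t => ('C(N, i)%:R * (-1) ^+ i) * (expR (- (i%:R * r) * t) * u t)).
  by apply/L1Z/L1_expM; rewrite mulr_ge0.
have [_ ->] := mint_sum (index_iota 0 N.+1) Li.
rewrite big1// => i _; rewrite mintZ; last by apply: L1_expM; rewrite mulr_ge0.
by rewrite moments ?mulr0// mulr_ge0.
Qed.

(** The cutoff polynomials are controlled only away from x = 1/2, which will correspond to t = a;
    that point is removed from the integrand beforehand. *)
Lemma mint_ne (a : R) (v : R -> R) : L1 v -> L1 (fun t => (t != a)%R%:R * v t) /\
  mint (fun t => (t != a)%R%:R * v t) = mint v.
Proof.
move=> Lv.
have mne : meas (fun t => (t != a)%R%:R : R).
  rewrite (_ : (fun t => _) = \1_(~` [set a])); last first.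
    apply/funext => t; rewrite indicE; congr ((_ : bool)%:R).
    by apply/idP/idP => [/eqP h|]; rewrite inE//= => /eqP.
  by apply: measurable_indic; exact: measurableC.
have L' : L1 (fun t => (t != a)%R%:R * v t).
  apply: L1_le (L1_norm Lv) _; first by apply: measurable_funM => //; exact: L1_meas.
  by move=> t _; case: (_ != _) => /=; rewrite ?mul1r ?mul0r ?normr0.
split=> //; rewrite /Rintegral; congr fine; apply: ae_eq_integral => //.
- exact: measurable_int L'.
- exact: measurable_int Lv.
exists [set a]; split => //.
  have /null_content_dominatesP := @m_dominates R; apply => //.
  exact: lebesgue_measure_set1.
move=> t /= /not_implyP[_]; case: (eqVneq t a) => // _; by rewrite mul1r.
Qed.

(** With c = ln 2 / a, the threshold x = 1/2 of the cutoff is x = e^(-c t) at t = a. Expanded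
    binomially, each cutoff polynomial is a combination of exponential moments, so its integral
    against [u] is 0, and dominated convergence passes this to the indicator of t > a. *)
Lemma moment_tail (a : R) : 0 < a -> mint (fun t => (a < t)%R%:R * u t) = 0.
Proof.
move=> a0; pose c := ln 2 / a.
have c0 : 0 < c by rewrite divr_gt0// ln_gt0// ltr1n.
have [L' _] := mint_ne a Lu.
have ea : expR (- c * a) = 2^-1 by rewrite /c mulNr divfK ?gt_eqF// expRN lnK// posrE.
pose w n t := (1 - expR (- (n%:R * c) * t)) ^+ (2 ^ n) * ((t != a)%R%:R * u t).
have xn n t : expR (- (n%:R * c) * t) = expR (- c * t) ^+ n.
  by rewrite -expRM_natl; congr expR; ring.
have cv : mint (w n) @[n --> \oo] --> mint (fun t => (a < t)%R%:R * ((t != a)%R%:R * u t)).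
  apply: (@mint_dct _ w _ (fun t => `|(t != a)%R%:R * u t|) _ _ _ _).2.
  - move=> n; apply: measurable_funM; last exact: L1_meas.
    apply: measurable_funX; apply: measurable_funB => //; exact: measurable_expRM.
  - exact: L1_norm.
  - move=> n t t0; rewrite /w normrM ler_piMl// normrX exprn_ile1//.
    rewrite xn; have e1 : expR (- c * t) ^+ n <= 1.
      by rewrite exprn_ile1 ?expR_ge0// -expR0 ler_expR mulNr oppr_le0 mulr_ge0// ltW.
    have e0 : 0 <= expR (- c * t) ^+ n by rewrite exprn_ge0// expR_ge0.
    by rewrite ger0_norm; lra.
  - move=> t t0; rewrite /w; have [->|ta] := eqVneq t a.
      rewrite mul0r mulr0; under eq_fun do rewrite mulr0; exact: cvg_cst.
    apply: cvgM; last exact: cvg_cst.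
    under eq_fun do rewrite xn.
    move: ta; case: ltgtP => // ta _.
    + apply: cutoff_lt; first exact: expR_ge0.
      by rewrite -ea ltr_expR !mulNr ltrN2 ltr_pM2l.
    + apply: cutoff_gt; first by rewrite -ea ltr_expR !mulNr ltrN2 ltr_pM2l.
      by rewrite -expR0 ler_expR mulNr oppr_le0 mulr_ge0// ltW.
have w0 n : mint (w n) = 0.
  have nc : 0 <= n%:R * c by rewrite mulr_ge0// ltW.
  rewrite -[RHS](moment_cutoff (2 ^ n) nc).
  have Lc : L1 (fun t => (1 - expR (- (n%:R * c) * t)) ^+ (2 ^ n) * u t).
    apply: L1_le (L1_norm Lu) _.
      apply: measurable_funM; last exact: L1_meas.
      apply: measurable_funX; apply: measurable_funB => //; exact: measurable_expRM.
    move=> t t0; rewrite normrM ler_piMl// normrX exprn_ile1//.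
    rewrite xn; have e1 : expR (- c * t) ^+ n <= 1.
      by rewrite exprn_ile1 ?expR_ge0// -expR0 ler_expR mulNr oppr_le0 mulr_ge0// ltW.
    have e0 : 0 <= expR (- c * t) ^+ n by rewrite exprn_ge0// expR_ge0.
    by rewrite ger0_norm; lra.
  have [_ e] := mint_ne a Lc; rewrite -[RHS]e.
  by apply: mint_eq => t _; rewrite /w mulrCA.
transitivity (mint (fun t => (a < t)%R%:R * ((t != a)%R%:R * u t))).
  apply: mint_eq => t _; case: ltgtP => _; rewrite ?mul0r ?mul1r//.
apply: (cvg_unique _ cv) => //; rewrite (_ : (fun n => _) = cst 0); first exact: cvg_cst.
by apply/funext => n; rewrite w0.
Qed.

(** The total integral and all tail integrals vanish, so the primitive of the Lebesgue density g of
    u dm is identically 0. By Lebesgue differentiation g = 0 almost everywhere, and [dens] is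
    positive, so [u] vanishes with it. *)
Lemma moment_ae0 : L1 (fun t => u t ^+ 2) -> mint (fun t => u t ^+ 2) = 0.
Proof.
move=> Lu2; have [gi _] := mint_lebesgue Lu.
pose g := (fun t => u t * dens t) \_ Rpos.
have gT : mu.-integrable setT (EFin \o g).
  by rewrite /g -restrict_EFin; apply/(integrable_mkcond _ _).1.
have F0 x : \int[mu]_(t in [set` `]-oo, x]]) g t = 0.
  have [x0|x0] := leP x 0.
    rewrite /Rintegral integral0_eq// => t /=; rewrite in_itv/= => tx.
    rewrite /g patchE ifF//; apply/negbTE/negP; rewrite inE/= in_itv/= andbT ltNge.
    by rewrite (le_trans tx x0).
  have mlt : meas (fun t => (x < t)%R%:R : R).
    rewrite (_ : (fun t => _) = \1_(`]x, +oo[%classic)); first exact: measurable_indic.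
    by apply/funext => t; rewrite indicE mem_setE in_itv/= andbT.
  have L' : L1 (fun t => (x < t)%R%:R * u t).
    apply: L1_le (L1_norm Lu) _; first by apply: measurable_funM => //; exact: L1_meas.
    by move=> t _; case: (_ < _); rewrite ?mul1r ?mul0r ?normr0.
  have L2 : L1 (fun t => (t <= x)%R%:R * u t).
    apply: (L1_eq _ (L1B Lu L')) => t _; rewrite leNgt.
    by case: (_ < _); rewrite ?mul1r ?mul0r ?subrr ?subr0.
  have : mint (fun t => (t <= x)%R%:R * u t) = 0.
    rewrite -[RHS](subrr 0) -[X in X - _](moments (lexx 0)) -[X in _ - X](moment_tail x0).
    rewrite -mintB//; last by apply: L1_expM.
    apply: mint_eq => t _; rewrite oppr0 mul0r expR0 mul1r leNgt.
    by case: (_ < _); rewrite ?mul1r ?mul0r ?subrr ?subr0.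
  have [_ ->] := mint_lebesgue L2; move=> <-.
  rewrite Rintegral_mkcond [RHS]Rintegral_mkcond; apply: eq_Rintegral => t _.
  rewrite /g !patchE !mem_setE !in_itv/= andbT.
  by case: (t <= x); case: (0 < t) => /=; rewrite ?mul1r ?mul0r.
have locg : locally_integrable [set: R] g.
  by apply: integrable_locally => //; exact: openT.
have gy y : mu.-integrable `]-oo, y] (EFin \o g) by exact: integrableS gT.
have ae := FTC1Ny gy locg.
have [_ ->] := mint_lebesgue Lu2.
rewrite /Rintegral (ae_eq_integral (cst 0%E))//.
- by rewrite integral0.
- by have [/(measurable_int mu)] := mint_lebesgue Lu2.
move: ae => /=; apply: filterS; first exact: (ae_filter_ringOfSetsType mu).
move=> t [_] /=.
rewrite (_ : (fun y => _) = cst 0); last by apply/funext => y; exact: F0.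
rewrite derive1_cst => g0; rewrite /= => t0.
move: g0; rewrite /g patchE mem_set// => /esym/eqP; rewrite mulf_eq0 orbC gt_eqF ?dens_gt0//=.
  by move=> /eqP ->; rewrite expr0n mul0r.
by move: t0; rewrite in_itv/= andbT.
Qed.

End RealMoments.

(** * The seminorm of L_2(m) and the norm of H_0 *)

Definition normsq phi := mint (fun t => reF phi t ^+ 2 + imF phi t ^+ 2).

Lemma normsqE phi : CL2 phi ->
  normsq phi = mint (fun t => reF phi t ^+ 2) + mint (fun t => imF phi t ^+ 2).
Proof. by move=> [[_ h1] [_ h2]]; rewrite -mintD. Qed.

Lemma normsq_ge0 phi : 0 <= normsq phi.
Proof. by apply: mint_ge0 => t _; rewrite addr_ge0// sqr_ge0. Qed.

(** Only the real points w = 1/(1 + s), s >= 0, are used: there the Laplace kernel is e^(-s t), so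
    the real and imaginary parts of [phi] have vanishing exponential moments. *)
Lemma laplace_inj0 phi : CL2 phi -> laplace phi = 0 -> normsq phi = 0.
Proof.
move=> Lp l0; have [p1 p2] := CL2_CL1 Lp.
have mom s : 0 <= s -> mint (fun t => expR (- s * t) * reF phi t) = 0 /\
    mint (fun t => expR (- s * t) * imF phi t) = 0.
  move=> s0; pose w : R[i] := ((1 + s)^-1)%:C%C.
  have s1 : 1 + s != 0 by rewrite gt_eqF// ltr_pwDl.
  have wV : w^-1 = (1 + s)%:C%C by rewrite -fmorphV invrK.
  have wD : 2^-1 < Re w^-1.
    by rewrite wV/=; apply: (@lt_le_trans _ _ 1); [rewrite invf_lt1 ?ltr1n|rewrite lerDl].
  have := congr1 (fun f => f (exist _ w wD)) l0.
  rewrite /= laplaceE /= wV => /eqP; rewrite mulf_eq0 invr_eq0 expf_eq0/=.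
  rewrite -invr_eq0 wV.
  have -> : ((1 + s)%:C%C == 0 :> R[i]) = false.
    by apply/negbTE/eqP => /(congr1 Re)/= /eqP; apply/negP.
  rewrite /= => /eqP h.
  have lE t : lapk (1 + s)%:C%C t = (expR (- s * t))%:C%C.
    rewrite /lapk (_ : - t%:C%C * (1 + s)%:C%C = (- t * (1 + s))%:C%C); last first.
      by rewrite rmorphM rmorphN.
    by rewrite cexp_real -rmorphM -expRD; congr ((expR _)%:C)%C; ring.
  move: h; rewrite cintE => h; split.
    move: (congr1 Re h) => /= e; rewrite -[RHS]e; apply: mint_eq => t _.
    by rewrite /reF lE cReM/=; ring.
  move: (congr1 Im h) => /= e; rewrite -[RHS]e; apply: mint_eq => t _.
  by rewrite /imF lE cImM/=; ring.
have [[_ q1] [_ q2]] := Lp.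
rewrite normsqE// moment_ae0//; last by move=> s /mom[].
by rewrite moment_ae0 ?addr0// => s /mom[].
Qed.

(** Cauchy-Schwarz plays the part of an almost-everywhere argument: pairings ignore functions of
    zero seminorm. *)
Lemma cint_ae0 phi psi : CL2 phi -> CL2 psi -> normsq psi = 0 ->
  cintegral (fun t => phi t * psi t) = 0.
Proof.
move=> Lp Lq q0; have [k1 k2] := Lp; have [h1 h2] := Lq.
have := normsqE Lq; rewrite q0 => /esym/eqP.
rewrite paddr_eq0; last 2 first.
- by apply: mint_ge0 => t _; exact: sqr_ge0.
- by apply: mint_ge0 => t _; exact: sqr_ge0.
move=> /andP[/eqP z1 /eqP z2].
have cs f g : SL2 f -> SL2 g -> mint (fun t => g t ^+ 2) = 0 -> mint (fun t => f t * g t) = 0.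
  move=> Lf Lg g0; have := cauchy_schwarz Lf Lg; rewrite g0 mulr0 => h.
  by apply/eqP; rewrite -sqrf_eq0 eq_le h sqr_ge0.
rewrite cintE; apply: complex_ext => /=.
  rewrite -[RHS](subrr 0) -[X in _ = X - _](cs _ _ k1 h1 z1) -[X in _ = _ - X](cs _ _ k2 h2 z2).
  rewrite -mintB; [|exact: SL2M|exact: SL2M].
  by apply: mint_eq => t _; rewrite /reF cReM.
rewrite -[RHS](addr0 0) -[X in _ = X + _](cs _ _ k1 h2 z2) -[X in _ = _ + X](cs _ _ k2 h1 z1).
rewrite -mintD; [|exact: SL2M|exact: SL2M].
by apply: mint_eq => t _; rewrite /imF cImM.
Qed.

Lemma laplace_ae0 phi : CL2 phi -> normsq phi = 0 -> laplace phi = 0.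
Proof.
move=> Lp q0; apply/funext => w; rewrite laplaceE cint_ae0 ?mulr0//.
exact: lapk_CL2 (svalP w).
Qed.

Definition L2norm phi := Num.sqrt (normsq phi).

Lemma L2norm_triangle phi psi : CL2 phi -> CL2 psi ->
  L2norm (fun t => phi t + psi t) <= L2norm phi + L2norm psi.
Proof.
move=> Lp Lq; have Lpq := CL2D Lp Lq.
have [h1 h2] := Lp; have [k1 k2] := Lq.
set x := mint (fun t => reF phi t * reF psi t).
set y := mint (fun t => imF phi t * imF psi t).
have e : normsq (fun t => phi t + psi t) = normsq phi + normsq psi + 2 * (x + y).
  have [_ a1] := h1; have [_ a2] := h2; have [_ b1] := k1; have [_ b2] := k2.
  have c1 := SL2M h1 k1; have c2 := SL2M h2 k2.
  transitivity (mint (fun t => ((reF phi t ^+ 2 + imF phi t ^+ 2) + (reF psi t ^+ 2 + imF psi t ^+ 2)) +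
      2 * (reF phi t * reF psi t + imF phi t * imF psi t))).
    by apply: mint_eq => t _; rewrite /reF /imF !raddfD/=; ring.
  rewrite mintD; [|by apply: L1D; exact: L1D|by apply: L1Z; exact: L1D].
  rewrite mintD; [|exact: L1D|exact: L1D].
  by rewrite [X in _ + X]mintZ; [rewrite [X in 2 * X]mintD|exact: L1D].
have xle := cauchy_schwarz h1 k1; have yle := cauchy_schwarz h2 k2.
rewrite -/x -/y in xle yle.
have U0 f : 0 <= mint (fun t => f t ^+ 2) by apply: mint_ge0 => t _; exact: sqr_ge0.
have Bq : (x + y) ^+ 2 <= normsq phi * normsq psi.
  rewrite !normsqE//; move: xle yle (U0 (reF phi)) (U0 (imF phi)) (U0 (reF psi)) (U0 (imF psi)).
  set U := mint (fun t => reF phi t ^+ 2); set U' := mint (fun t => reF psi t ^+ 2).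
  set V := mint (fun t => imF phi t ^+ 2); set V' := mint (fun t => imF psi t ^+ 2).
  move=> xle yle u0 v0 u1 v1.
  (* By the two Cauchy-Schwarz bounds, (x y)^2 <= (U V') (V U'), so this is the inequality between
     geometric and arithmetic means. *)
  have xy : 2 * (x * y) <= U * V' + V * U'.
    apply: (le_trans (ler_norm _)); rewrite -ler_sqr ?nnegrE ?addr_ge0 ?mulr_ge0//.
    rewrite real_normK ?num_real// (_ : (2 * (x * y)) ^+ 2 = 4 * (x ^+ 2 * y ^+ 2)); last by ring.
    have : x ^+ 2 * y ^+ 2 <= (U * U') * (V * V') by rewrite ler_pM// sqr_ge0.
    have := sqr_ge0 (U * V' - V * U'); set XX := x ^+ 2 * y ^+ 2.
    rewrite sqrrB sqrrD; nra.
  rewrite sqrrD; lra.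
have B : x + y <= L2norm phi * L2norm psi.
  apply: (le_trans (ler_norm _)); rewrite -ler_sqr ?nnegrE ?mulr_ge0 ?sqrtr_ge0//.
  by rewrite real_normK ?num_real// exprMn !sqr_sqrtr// normsq_ge0.
rewrite -ler_sqr ?nnegrE ?addr_ge0 ?sqrtr_ge0// sqr_sqrtr ?normsq_ge0// e sqrrD.
by rewrite !sqr_sqrtr ?normsq_ge0//; lra.
Qed.

Definition cabs c : R := Num.sqrt (Re c ^+ 2 + Im c ^+ 2).

Lemma normsqZ c phi : CL2 phi -> normsq (fun t => c * phi t) = cabs c ^+ 2 * normsq phi.
Proof.
move=> Lp; have [[_ h1] [_ h2]] := Lp.
rewrite -mintZ; last exact: L1D.
apply: mint_eq => t _; rewrite sqr_sqrtr ?addr_ge0 ?sqr_ge0// /reF /imF cReM cImM; ring.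
Qed.

Lemma L2normZ c phi : CL2 phi -> L2norm (fun t => c * phi t) = cabs c * L2norm phi.
Proof.
move=> Lp; rewrite /L2norm normsqZ// sqrtrM ?sqr_ge0// sqrtr_sqr ger0_norm// sqrtr_ge0//.
Qed.

Lemma laplace_inv_spec phi : CL2 phi -> CL2 (laplace_inv (laplace phi)) /\
  laplace (laplace_inv (laplace phi)) = laplace phi.
Proof.
move=> Lp; rewrite /laplace_inv.
have h : [set psi | L2 psi /\ laplace psi = laplace phi] phi by split=> //; exact/L2P.
have [/L2P ? ?] := xgetPex (fun=> 0) (ex_intro _ _ h).
by split.
Qed.

Lemma normsq0_L2norm phi psi : CL2 phi -> CL2 psi -> normsq (fun t => phi t + -1 * psi t) = 0 ->
  L2norm phi = L2norm psi.
Proof.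
move=> Lp Lq q0; apply/eqP; rewrite eq_le; apply/andP; split.
  have := L2norm_triangle Lq (CL2D Lp (CL2Z (-1) Lq)); rewrite /L2norm q0 sqrtr0 addr0.
  apply: le_trans; rewrite le_eqVlt; apply/orP; left; apply/eqP; congr (Num.sqrt _).
  by apply: mint_eq => t _; congr (Re _ ^+ 2 + Im _ ^+ 2); ring.
have Lq' := CL2D Lp (CL2Z (-1) Lq).
have := L2norm_triangle Lp (CL2Z (-1) Lq').
rewrite (L2normZ (-1) Lq') [L2norm (fun t => phi t + -1 * psi t)]/L2norm q0 sqrtr0 mulr0 addr0.
apply: le_trans; rewrite le_eqVlt; apply/orP; left; apply/eqP; congr (Num.sqrt _).
by apply: mint_eq => t _; congr (Re _ ^+ 2 + Im _ ^+ 2); ring.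
Qed.

Lemma laplace_eqP phi psi : CL2 phi -> CL2 psi ->
  (laplace phi = laplace psi <-> normsq (fun t => phi t + -1 * psi t) = 0).
Proof.
move=> Lp Lq; have Lq' := CL2Z (-1) Lq; have Lpq := CL2D Lp Lq'.
have e : laplace (fun t => phi t + -1 * psi t) = laplace phi - laplace psi.
  by rewrite laplaceD// laplaceZ// scaleN1r.
split=> h; first by apply: laplace_inj0 => //; rewrite e h subrr.
by apply/subr0_eq; rewrite -e laplace_ae0.
Qed.

(** The representative selected by [laplace_inv] may differ from [phi], but by injectivity the
    difference has zero seminorm, and the triangle inequality then equates the norms. *)
Lemma H0norm_laplace phi : CL2 phi -> H0norm (laplace phi) = L2norm phi.
Proof.
move=> Lp; have [Lq e] := laplace_inv_spec Lp.
rewrite -(normsq0_L2norm Lq Lp) ?(laplace_eqP Lq Lp).1//.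
rewrite /H0norm /H0inner /L2inner cintE /L2norm; congr (Num.sqrt _).
apply: mint_eq => t _; rewrite /reF /imF.
by case: (laplace_inv _ t) => a b /=; ring.
Qed.

End Injectivity.

(** * The Fredholm alternative outside [[0, 1]] *)

Section Fredholm.
Context {R : realType} {V : lmodType R[i]}.
Variables (H : set V) (nrm : V -> R) (T : V -> V) (lambda : R[i]).
Hypothesis HD : forall f g, H f -> H g -> H (f + g).
Hypothesis HZ : forall (c : R[i]) f, H f -> H (c *: f).
Hypothesis Hzero : H 0.
Hypothesis nrm_ge0 : forall f, 0 <= nrm f.
Hypothesis nrmD : forall f g, H f -> H g -> nrm (f + g) <= nrm f + nrm g.
Hypothesis nrmZ : forall (c : R[i]) f, H f -> nrm (c *: f) <= norm1 c * nrm f.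
Variables (B S : V -> V) (n : nat) (u : 'I_n -> V) (v : 'I_n -> V -> R[i]).
Hypothesis BH : forall f, H f -> H (B f).
Hypothesis BL : forall c f g, H f -> H g -> B (c *: f + g) = c *: B f + B g.
Hypothesis SH : forall f, H f -> H (S f).
Hypothesis SB : forall f, H f -> S (B f) = f.
Hypothesis BS : forall f, H f -> B (S f) = f.
Hypothesis Sbd : exists M, forall f, H f -> nrm (S f) <= M * nrm f.
Hypothesis uH : forall j, H (u j).
Hypothesis vL : forall j c f g, H f -> H g -> v j (c *: f + g) = c * v j f + v j g.
Hypothesis vbd : forall j, exists M, forall f, H f -> norm1 (v j f) <= M * nrm f.
Hypothesis TE : forall f, H f -> T f - lambda *: f = B f + \sum_j v j f *: u j.

Lemma H_sum (I : Type) (r : seq I) (x : I -> R[i]) (w : I -> V) : (forall i, H (w i)) ->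
  H (\sum_(i <- r) x i *: w i).
Proof.
move=> Hw; elim: r => [|i r ih]; first by rewrite big_nil.
by rewrite big_cons; apply: HD => //; exact: HZ.
Qed.

Lemma B0 : B 0 = 0.
Proof.
have := BL 1 Hzero Hzero; rewrite scale1r addr0 => /eqP.
by rewrite -subr_eq subrr eq_sym scale1r => /eqP.
Qed.

Lemma v0 j : v j 0 = 0.
Proof.
have := vL j 1 Hzero Hzero; rewrite scale1r addr0 mul1r => /eqP.
by rewrite -subr_eq subrr eq_sym => /eqP.
Qed.

Lemma B_sum (I : Type) (r : seq I) (x : I -> R[i]) (w : I -> V) : (forall i, H (w i)) ->
  B (\sum_(i <- r) x i *: w i) = \sum_(i <- r) x i *: B (w i).
Proof.
move=> Hw; elim: r => [|i r ih]; first by rewrite !big_nil B0.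
by rewrite !big_cons BL// ?ih//; exact: H_sum.
Qed.

Lemma v_sum j (I : Type) (r : seq I) (x : I -> R[i]) (w : I -> V) : (forall i, H (w i)) ->
  v j (\sum_(i <- r) x i *: w i) = \sum_(i <- r) x i * v j (w i).
Proof.
move=> Hw; elim: r => [|i r ih]; first by rewrite !big_nil v0.
by rewrite !big_cons vL// ?ih//; exact: H_sum.
Qed.

Let U j := S (u j).
Let UH j : H (U j). Proof. exact: SH. Qed.

Lemma B_inj f g : H f -> H g -> B f = B g -> f = g.
Proof. by move=> Hf Hg e; rewrite -(SB Hf) e SB. Qed.

(** Apply the inverse of [B] to B f + sum_j v_j(f) u_j = g. The unknown [f] is thereby reduced to
    the finitely many numbers v_j(f); for g = 0 it lies in the span of the [U j]. *)
Lemma fredholm_solution f g : H f -> H g -> T f - lambda *: f = g ->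
  f = S g - \sum_j v j f *: U j.
Proof.
move=> Hf Hg e; have Hs : H (\sum_j v j f *: U j) by exact: H_sum.
apply: B_inj => //; first by rewrite -scaleN1r; apply: HD; [exact: SH|exact: HZ].
rewrite addrC -scaleN1r BL//; last exact: SH.
rewrite B_sum// BS// -e TE// scaleN1r; under [X in - X]eq_bigr do rewrite BS//.
by rewrite addrCA [X in _ = _ + X]addrC subrr addr0.
Qed.

Lemma fredholm_multiplicity : finite_multiplicity H T lambda.
Proof.
exists n, U => f [Hf e]; exists (fun k => - v k f).
have := @fredholm_solution f 0 Hf Hzero; rewrite e subrr => /(_ erefl).
have -> : S 0 = 0 by rewrite -[X in S X]B0 SB.
by rewrite sub0r -sumrN => {1}->; apply: eq_bigr => j _; rewrite scaleNr.
Qed.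

Lemma nrm_sum (r : seq 'I_n) (x : 'I_n -> V -> R[i]) :
  (forall j, exists M, forall g, H g -> norm1 (x j g) <= M * nrm g) ->
  exists M, forall g, H g -> nrm (\sum_(j <- r) x j g *: U j) <= M * nrm g.
Proof.
move=> xb; elim: r => [|j r [M ih]].
  exists 0 => g Hg; rewrite big_nil mul0r -(scale0r (0 : V)).
  by apply: (le_trans (nrmZ _ Hzero)); rewrite /norm1/= normr0 addr0 mul0r.
have [K hK] := xb j; exists (K * nrm (U j) + M) => g Hg.
rewrite big_cons mulrDl (le_trans (nrmD _ _))//; [exact: HZ|exact: H_sum|].
apply: lerD; last exact: ih.
rewrite (le_trans (nrmZ _ _))// mulrAC ler_wpM2r//; exact: hK.
Qed.

Lemma norm1_sum_bd (r : seq 'I_n) (a : 'I_n -> R[i]) (x : 'I_n -> V -> R[i]) :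
  (forall j, exists M, forall g, H g -> norm1 (x j g) <= M * nrm g) ->
  exists M, forall g, H g -> norm1 (\sum_(j <- r) a j * x j g) <= M * nrm g.
Proof.
move=> xb; elim: r => [|j r [M ih]].
  by exists 0 => g Hg; rewrite big_nil mul0r /norm1/= normr0 addr0.
have [K hK] := xb j; exists (norm1 (a j) * K + M) => g Hg.
rewrite big_cons mulrDl (le_trans (norm1D _ _))// lerD//; last exact: ih.
rewrite (le_trans (norm1M _ _))// -mulrA ler_wpM2l ?norm1_ge0//; exact: hK.
Qed.

(** Applying v_i to [fredholm_solution] gives W x = (v_i (S g))_i for x_j = v_j(f), with W = 1 +
    (v_i (U j)). If W is singular, a kernel vector x yields the eigenvector sum_j x_j U_j; if W is
    invertible, solving for x gives a bounded inverse of T - lambda. *)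
Lemma fredholm_alternative : ~ resolvent_set H nrm T lambda -> is_eigenvalue H T lambda.
Proof.
pose W : 'M[R[i]]_n := \matrix_(i, j) ((i == j)%:R + v i (U j)).
have WE (x : 'I_n -> R[i]) i : (W *m \col_j x j) i 0 = x i + \sum_j x j * v i (U j).
  rewrite mxE; under eq_bigr do rewrite !mxE mulrDl.
  rewrite big_split/= (bigD1 i)//= eqxx mul1r big1 ?addr0; last first.
    by move=> j ji; rewrite eq_sym (negbTE ji) mul0r.
  by congr (_ + _); apply: eq_bigr => j _; rewrite mulrC.
have [Wu|Wn] := boolP (W \in unitmx); last first.
  move=> _; have /det0P[y y0 yW] : \det W^T == 0.
    by rewrite det_tr; move: Wn; rewrite unitmxE unitfE negbK.
  pose x j := y 0 j.
  have Wx i : x i + \sum_j x j * v i (U j) = 0.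
    rewrite -WE; have -> : \col_j x j = y^T by apply/matrixP => a b; rewrite !mxE ord1.
    by rewrite -[W]trmxK -trmx_mul yW trmx0 mxE.
  pose f := \sum_j x j *: U j.
  have Hf : H f by exact: H_sum.
  have vf i : v i f = - x i.
    by rewrite v_sum//; apply/eqP; rewrite -addr_eq0 addrC; apply/eqP; exact: Wx.
  exists f.
    split=> //; apply/subr0_eq; rewrite TE// B_sum// -big_split/=.
    by apply: big1 => j _; rewrite vf BS// scaleNr subrr.
  (* The [U j] may be linearly dependent; the vector is nonzero because the functionals recover x
     from it, v_i(f) = - x_i. *)
  apply: contraNneq y0 => f0; apply/eqP/matrixP => a b; rewrite ord1 mxE.
  by have := vf b; rewrite f0 v0 => /esym/eqP; rewrite oppr_eq0 => /eqP.
move=> nres; exfalso; apply: nres.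
pose x g j := (invmx W *m \col_i v i (S g)) j 0.
have xE g j : x g j = \sum_i invmx W j i * v i (S g).
  by rewrite /x mxE; apply: eq_bigr => i _; rewrite mxE.
have xW g i : x g i + \sum_j x g j * v i (U j) = v i (S g).
  rewrite -WE; have -> : \col_j x g j = invmx W *m \col_i v i (S g).
    by apply/matrixP => a b; rewrite [LHS]mxE ord1.
  by rewrite mulmxA mulmxV// mul1mx mxE.
have vSb j : exists M, forall g, H g -> norm1 (v j (S g)) <= M * nrm g.
  have [M hM] := vbd j; have [K hK] := Sbd; exists (`|M| * K) => g Hg.
  rewrite (le_trans (hM _ (SH Hg)))// (le_trans (ler_wpM2r _ (ler_norm M)))//.
  by rewrite -mulrA ler_wpM2l// hK.
have xb j : exists M, forall g, H g -> norm1 (x g j) <= M * nrm g.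
  have [M hM] := @norm1_sum_bd (index_enum _) (fun i => invmx W j i) _ vSb.
  by exists M => g Hg; rewrite xE hM.
exists (fun g => S g - \sum_j x g j *: U j).
have Hs g : H (\sum_j x g j *: U j) by exact: H_sum.
have HS g : H g -> H (S g - \sum_j x g j *: U j).
  by move=> Hg; rewrite -scaleN1r; apply: HD; [exact: SH|exact: HZ].
have vS g i : H g -> v i (S g - \sum_j x g j *: U j) = x g i.
  move=> Hg; rewrite addrC -scaleN1r vL//; last exact: SH.
  by rewrite v_sum// -(xW g i) mulN1r addrCA addNr addr0.
split=> //.
- move=> f Hf; set g := T f - lambda *: f.
  have Hg : H g by rewrite /g TE//; apply: HD; [exact: BH|exact: H_sum].
  have fE := fredholm_solution Hf Hg erefl.
  rewrite [RHS]fE; congr (_ - _); apply: eq_bigr => j _; congr (_ *: _).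
  suff e : \col_j x g j = \col_j v j f by have /matrixP/(_ j 0) := e; rewrite !mxE.
  have -> : \col_j x g j = invmx W *m \col_i v i (S g).
    by apply/matrixP => a b; rewrite [LHS]mxE ord1.
  have -> : \col_i v i (S g) = W *m \col_j v j f.
    apply/matrixP => a b; rewrite ord1 WE mxE.
    have e2 : v a f = v a (S g) - \sum_j v j f * v a (U j).
      rewrite {1}fE addrC -scaleN1r vL; [|exact: H_sum|exact: SH].
      by rewrite v_sum// mulN1r addrC.
    by rewrite e2 subrK.
  by rewrite mulmxA mulVmx// mul1mx.
- move=> g Hg; rewrite TE; last exact: HS.
  rewrite addrC -[X in B X]addrC -scaleN1r BL//; last exact: SH.
  rewrite B_sum// BS// scaleN1r addrA.
  under eq_bigr do rewrite vS//.
  under [X in _ *: X]eq_bigr do rewrite BS//.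
  by rewrite scaleN1r subrr add0r.
- have [M hM] := @nrm_sum (index_enum _) (fun j g => x g j) xb.
  have [K hK] := Sbd; exists (K + norm1 (-1 : R[i]) * M) => g Hg.
  rewrite mulrDl (le_trans (nrmD _ _))//; [exact: SH|by rewrite -scaleN1r; exact: HZ|].
  rewrite lerD ?hK// -scaleN1r (le_trans (nrmZ _ _))// -mulrA ler_wpM2l ?norm1_ge0//.
  exact: hM.
Qed.

End Fredholm.

(** * Neumann series for kernels dominated by a product *)

Section Neumann.
Context {R : realType}.
Implicit Types (phi psi : R -> R[i]) (t s x y : R) (c z : R[i]).

Variables (k : R -> R -> R) (mult : R -> R[i]) (C : R) (a : R -> R).
Hypothesis bk_k : bkernel k.
Hypothesis mmult : cmeas mult.
Hypothesis C0 : 0 <= C.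
Hypothesis multC : forall t, 0 < t -> norm1 (mult t) <= C.
Hypothesis La : SL2 a.
Hypothesis a0 : forall t, 0 < t -> 0 <= a t.
Hypothesis ka : forall t s, 0 < t -> 0 < s -> `|k t s| <= a t * a s.
Let q := mint (fun t => a t ^+ 2).
Let r := C * q.
Hypothesis r1 : r < 1.

Let kap phi t := mult t * Kop k phi t.
(** Contraction is measured by this weighted integral instead of the L_2 norm: [kap phi t] is
    bounded at every point t > 0 by C al(phi) a(t), so [al] shrinks by the factor [r] at each
    iteration and the series converges pointwise under the square-integrable bound [dom]. *)
Let al phi := mint (fun t => a t * norm1 (phi t)).

Let q0 : 0 <= q. Proof. by apply: mint_ge0 => t _; exact: sqr_ge0. Qed.
Let r0 : 0 <= r. Proof. exact: mulr_ge0. Qed.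

Let al_ge0 phi : 0 <= al phi.
Proof. by apply: mint_ge0 => t t0; rewrite mulr_ge0 ?norm1_ge0// a0. Qed.

Let L1_al phi : CL2 phi -> L1 (fun t => a t * norm1 (phi t)).
Proof. by move=> Lp; apply: SL2M => //; exact: CL2_norm1. Qed.

Let kap_le phi t : CL2 phi -> 0 < t -> norm1 (kap phi t) <= C * al phi * a t.
Proof.
move=> Lp t0; apply: (le_trans (norm1M _ _)); rewrite -mulrA.
apply: ler_pM; [exact: norm1_ge0|exact: norm1_ge0|exact: multC|].
have -> : al phi * a t = mint (fun s => a t * (a s * norm1 (phi s))).
  by rewrite mintZ; [rewrite mulrC|exact: L1_al].
apply: Kop_le; [exact: bk_k|exact: CL2_CL1|exact: t0|by apply: L1Z; exact: L1_al|].
by move=> s s0; rewrite mulrA ler_wpM2r ?norm1_ge0// ka.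
Qed.

Let kap_CL2 phi : CL2 phi -> CL2 (kap phi).
Proof.
move=> Lp; apply: CL2_le (SL2Z (C * al phi) La) _; last by move=> t; exact: kap_le.
by apply: cmeasM => //; apply: Kop_cmeas => //; exact: CL2_CL1.
Qed.

Let al_kap phi : CL2 phi -> al (kap phi) <= r * al phi.
Proof.
move=> Lp; have [_ La2] := La.
have -> : r * al phi = mint (fun t => (C * al phi) * a t ^+ 2).
  by rewrite mintZ// /r -/q; ring.
apply: mint_le; [by apply: L1_al; exact: kap_CL2|exact: L1Z|].
by move=> t t0; rewrite expr2 mulrA [leRHS]mulrC ler_wpM2l ?a0// kap_le.
Qed.

Let it j phi := iter j kap phi.

Let it_CL2 j phi : CL2 phi -> CL2 (it j phi).
Proof. by move=> Lp; elim: j => //= j; exact: kap_CL2. Qed.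

Let al_it j phi : CL2 phi -> al (it j phi) <= r ^+ j * al phi.
Proof.
move=> Lp; elim: j => [|j ih]; first by rewrite expr0 mul1r.
rewrite exprS -mulrA (le_trans (al_kap (it_CL2 j Lp)))// ler_wpM2l//.
Qed.

Let it_le j phi t : CL2 phi -> 0 < t -> norm1 (it j.+1 phi t) <= C * a t * al phi * r ^+ j.
Proof.
move=> Lp t0; rewrite (le_trans (kap_le (it_CL2 j Lp) t0))//.
rewrite mulrAC -[leRHS]mulrA ler_wpM2l ?mulr_ge0 ?a0//.
by rewrite mulrC al_it.
Qed.

Let dom phi t := norm1 (phi t) + C * a t * al phi / (1 - r).

Let partial n phi t := \sum_(0 <= j < n) it j phi t.

Let geom_le n : \sum_(0 <= j < n) r ^+ j <= (1 - r)^-1.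
Proof.
have r1' : 0 < 1 - r by rewrite subr_gt0.
rewrite -[leRHS]mul1r ler_pdivlMr// big_mkord mulrC -[1 - r]opprB mulNr -subrX1 opprB.
by rewrite lerBlDr lerDl exprn_ge0.
Qed.

Let it_sum_le n phi t : CL2 phi -> 0 < t ->
  \sum_(0 <= j < n) norm1 (it j phi t) <= dom phi t.
Proof.
move=> Lp t0; have h0 : 0 <= C * a t * al phi.
  apply: mulr_ge0; last exact: al_ge0.
  by apply: mulr_ge0 => //; exact: a0.
case: n => [|n].
  rewrite big_nil; apply: addr_ge0; first exact: norm1_ge0.
  by apply: divr_ge0 => //; rewrite subr_ge0 ltW.
rewrite big_nat_recl//= lerD2l.
apply: (@le_trans _ _ (\sum_(0 <= j < n) C * a t * al phi * r ^+ j)).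
  by apply: ler_sum => j _; exact: it_le.
by rewrite -mulr_sumr ler_wpM2l.
Qed.

Let norm1_sum n (w : nat -> R[i]) : norm1 (\sum_(0 <= j < n) w j) <= \sum_(0 <= j < n) norm1 (w j).
Proof.
elim: n => [|n ih]; first by rewrite !big_nil /norm1/= normr0 addr0.
by rewrite !big_nat_recr//= (le_trans (norm1D _ _))// lerD2r.
Qed.

Let partial_le n phi t : CL2 phi -> 0 < t -> norm1 (partial n phi t) <= dom phi t.
Proof. by move=> Lp t0; rewrite (le_trans (norm1_sum _ _))// it_sum_le. Qed.

Let dom_SL2 phi : CL2 phi -> SL2 (dom phi).
Proof.
move=> Lp; apply: SL2D; first exact: CL2_norm1.
rewrite (_ : (fun t => _) = fun t => (C * al phi / (1 - r)) * a t); first exact: SL2Z.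
by apply/funext => t; ring.
Qed.

Definition neumann phi t : R[i] :=
  (limn (fun n => Re (partial n phi t)) +i* limn (fun n => Im (partial n phi t)))%C.

Let it_cvg (f : R[i] -> R) phi t : (forall z, `|f z| <= norm1 z) -> CL2 phi -> 0 < t ->
  cvgn (series (fun j => f (it j phi t))).
Proof.
move=> fn Lp t0; apply: normed_cvg.
apply: (@series_le_cvg _ _ (fun j => norm1 (it j phi t))) => //.
- by move=> j /=.
- by move=> j; exact: norm1_ge0.
- by move=> j; exact: fn.
apply: nondecreasing_is_cvgn.
  by apply/nondecreasing_seqP => n; rewrite !seriesEnat/= big_nat_recr//= lerDl norm1_ge0.
by exists (dom phi t) => _ [n _ <-]; rewrite seriesEnat/=; exact: it_sum_le.
Qed.

Let neumann_cvg phi t : CL2 phi -> 0 < t ->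
  (fun n => Re (partial n phi t)) @ \oo --> Re (neumann phi t) /\
  (fun n => Im (partial n phi t)) @ \oo --> Im (neumann phi t).
Proof.
move=> Lp t0; split=> /=.
  have h := @it_cvg Re phi t (@norm1_Re R) Lp t0.
  suff e : (fun n => Re (partial n phi t)) = series (fun j => Re (it j phi t)) by rewrite e.
  by apply/funext => n; rewrite seriesEnat/= /partial raddf_sum.
have h := @it_cvg Im phi t (@norm1_Im R) Lp t0.
suff e : (fun n => Im (partial n phi t)) = series (fun j => Im (it j phi t)) by rewrite e.
by apply/funext => n; rewrite seriesEnat/= /partial raddf_sum.
Qed.

Let partial_CL2 n phi : CL2 phi -> CL2 (partial n phi).
Proof.
move=> Lp; elim: n => [|n ih].
  rewrite (_ : partial 0 phi = fun t => 0 * phi t); first exact: CL2Z.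
  by apply/funext => t; rewrite /partial big_nil mul0r.
rewrite (_ : partial n.+1 phi = fun t => partial n phi t + it n phi t).
  by apply: CL2D => //; exact: it_CL2.
by apply/funext => t; rewrite /partial big_nat_recr.
Qed.

Lemma neumann_le phi t : CL2 phi -> 0 < t -> norm1 (neumann phi t) <= dom phi t.
Proof.
move=> Lp t0; have [hR hI] := neumann_cvg Lp t0.
have h : (fun n => norm1 (partial n phi t)) @ \oo --> norm1 (neumann phi t).
  by apply: cvgD; exact: cvg_norm.
by apply: (cvgr_to_le h); apply: nearW => n; exact: partial_le.
Qed.

Lemma neumann_CL2 phi : CL2 phi -> CL2 (neumann phi).
Proof.
move=> Lp; apply: CL2_le (dom_SL2 Lp) _; last by move=> t; exact: neumann_le.
split.
  apply: (@measurable_fun_cvg _ _ _ _ (fun n => reF (partial n phi))).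
    by move=> n; have [] := CL2_cmeas (partial_CL2 n Lp).
  by move=> t; rewrite /= in_itv/= andbT => t0; have [] := neumann_cvg Lp t0.
apply: (@measurable_fun_cvg _ _ _ _ (fun n => imF (partial n phi))).
  by move=> n; have [] := CL2_cmeas (partial_CL2 n Lp).
by move=> t; rewrite /= in_itv/= andbT => t0; have [] := neumann_cvg Lp t0.
Qed.

Let kap_partial n phi t : CL2 phi -> 0 < t -> kap (partial n phi) t = partial n.+1 phi t - phi t.
Proof.
move=> Lp t0; elim: n => [|n ih].
  rewrite /partial big_nat1 subrr /kap (_ : Kop k _ t = 0) ?mulr0//.
  have -> : Kop k (fun s => \sum_(0 <= j < 0) it j phi s) t = Kop k (fun s => 0 * phi s) t.
    by apply: Kop_eq => s _; rewrite big_nil mul0r.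
  by rewrite KopZ ?mul0r//; exact: CL2_CL1.
transitivity (kap (fun s => partial n phi s + it n phi s) t).
  by rewrite /kap; congr (_ * _); apply: Kop_eq => s _; rewrite /partial big_nat_recr.
rewrite /kap KopD//; [|exact/CL2_CL1/partial_CL2|exact/CL2_CL1/it_CL2].
rewrite mulrDr -[mult t * Kop k (partial n phi) t]/(kap (partial n phi) t) ih.
rewrite -[mult t * Kop k (it n phi) t]/(it n.+1 phi t).
by rewrite /partial [in RHS]big_nat_recr//= addrAC.
Qed.

(** Partial sums satisfy kap(partial n) = partial (n + 1) - phi; dominated convergence under the
    kernel, with the bound a(t) a(s) dom(s), passes to the limit. The equation holds at every t > 0,
    not just almost everywhere. *)
Lemma neumann_solves phi t : CL2 phi -> 0 < t ->
  neumann phi t - mult t * Kop k (neumann phi) t = phi t.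
Proof.
move=> Lp t0; rewrite -[mult t * _]/(kap (neumann phi) t).
have mkt : measurable_fun setT (k t).
  have [mk _] := bk_k; rewrite (_ : k t = (fun x : R * R => k x.1 x.2) \o pair t)//.
  by apply: measurableT_comp => //; exact: pair1_measurable.
have kcv (f : R[i] -> R) : (forall z, `|f z| <= norm1 z) ->
    (forall n, meas (fun s => f (partial n phi s))) ->
    (forall s, 0 < s -> (fun n => f (partial n phi s)) @ \oo --> f (neumann phi s)) ->
    (fun n => mint (fun s => k t s * f (partial n phi s))) @ \oo -->
      mint (fun s => k t s * f (neumann phi s)).
  move=> fn mf fcv.
  apply: (@mint_dct _ _ _ (fun s => a t * (a s * dom phi s)) _ _ _ _).2.
  - move=> n; apply: measurable_funM => //; apply: measurable_funTS.
    exact: mkt.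
  - by apply: L1Z; apply: SL2M => //; exact: dom_SL2.
  - move=> n s s0; rewrite normrM mulrA ler_pM ?ka//.
    by rewrite (le_trans (fn _))// partial_le.
  - by move=> s s0; apply: cvgMr; exact: fcv.
have hR : (fun n => mint (fun s => k t s * Re (partial n phi s))) @ \oo -->
    mint (fun s => k t s * Re (neumann phi s)).
  apply: kcv; [exact: norm1_Re|by move=> n; exact: (CL2_cmeas (partial_CL2 n Lp)).1|].
  by move=> s s0; exact: (neumann_cvg Lp s0).1.
have hI : (fun n => mint (fun s => k t s * Im (partial n phi s))) @ \oo -->
    mint (fun s => k t s * Im (neumann phi s)).
  apply: kcv; [exact: norm1_Im|by move=> n; exact: (CL2_cmeas (partial_CL2 n Lp)).2|].
  by move=> s s0; exact: (neumann_cvg Lp s0).2.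
have [pR pI] := neumann_cvg Lp t0.
suff e : kap (neumann phi) t = neumann phi t - phi t by rewrite e subKr.
have shift (f : R[i] -> R) l : (fun n => f (partial n phi t)) @ \oo --> l ->
    (fun n => f (partial n.+1 phi t)) @ \oo --> l.
  by move=> h; rewrite (cvg_shiftS (fun n => f (partial n phi t))).
apply: complex_ext.
  have h1 : (fun n => Re (kap (partial n phi) t)) @ \oo --> Re (kap (neumann phi) t).
    have -> : (fun n => Re (kap (partial n phi) t)) = fun n =>
       Re (mult t) * mint (fun s => k t s * Re (partial n phi s)) -
       Im (mult t) * mint (fun s => k t s * Im (partial n phi s)).
      by apply/funext => n; rewrite /kap cReM.
    by rewrite /kap cReM; apply: cvgB; exact: cvgMr.
  have h2 : (fun n => Re (kap (partial n phi) t)) @ \oo --> Re (neumann phi t - phi t).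
    have -> : (fun n => Re (kap (partial n phi) t)) = fun n => Re (partial n.+1 phi t) - Re (phi t).
      by apply/funext => n; rewrite kap_partial// raddfB.
    by rewrite raddfB; apply: cvgB; [exact: shift pR|exact: cvg_cst].
  exact: (cvg_unique _ h1 h2).
have h1 : (fun n => Im (kap (partial n phi) t)) @ \oo --> Im (kap (neumann phi) t).
  have -> : (fun n => Im (kap (partial n phi) t)) = fun n =>
     Re (mult t) * mint (fun s => k t s * Im (partial n phi s)) +
     Im (mult t) * mint (fun s => k t s * Re (partial n phi s)).
    by apply/funext => n; rewrite /kap cImM.
  by rewrite /kap cImM; apply: cvgD; exact: cvgMr.
have h2 : (fun n => Im (kap (partial n phi) t)) @ \oo --> Im (neumann phi t - phi t).
  have -> : (fun n => Im (kap (partial n phi) t)) = fun n => Im (partial n.+1 phi t) - Im (phi t).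
    by apply/funext => n; rewrite kap_partial// raddfB.
  by rewrite raddfB; apply: cvgB; [exact: shift pI|exact: cvg_cst].
exact: (cvg_unique _ h1 h2).
Qed.

(** A fixed point has al(phi) <= r al(phi), hence al(phi) = 0, and then the pointwise bound [kap_le]
    forces the value 0 at every t > 0. *)
Lemma kernel_fixpoint0 phi t : CL2 phi ->
  (forall s, 0 < s -> phi s = mult s * Kop k phi s) -> 0 < t -> phi t = 0.
Proof.
move=> Lp fx t0.
have ae : al phi <= r * al phi.
  have e : al phi = al (kap phi).
    by apply: mint_eq => s s0; rewrite {1}(fx s s0).
  by rewrite {1}e; exact: al_kap.
have al0 : al phi = 0.
  apply/eqP; rewrite eq_le al_ge0 andbT.
  have : (1 - r) * al phi <= 0 by rewrite mulrBl mul1r subr_le0.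
  by rewrite pmulr_rle0 ?subr_gt0.
have : norm1 (phi t) <= 0.
  by rewrite (fx t t0) (le_trans (kap_le Lp t0))// al0 mulr0 mul0r.
rewrite /norm1 => h; apply: complex_ext => /=; apply/eqP; rewrite -normr_eq0 eq_le normr_ge0 andbT.
  by apply: le_trans h; rewrite lerDl.
by apply: le_trans h; rewrite lerDr.
Qed.

Lemma neumann_unique phi psi t : CL2 phi -> CL2 psi ->
  (forall s, 0 < s -> psi s = phi s - mult s * Kop k phi s) -> 0 < t -> neumann psi t = phi t.
Proof.
move=> Lp Lq e t0; apply/subr0_eq.
have Ln := neumann_CL2 Lq; have Lm := CL2Z (-1) Lp.
have -> : neumann psi t - phi t = neumann psi t + -1 * phi t by rewrite mulN1r.
apply: (@kernel_fixpoint0 (fun t => neumann psi t + -1 * phi t)) => //; first exact: CL2D.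
move=> s s0; rewrite KopD//; [|exact: CL2_CL1|exact: CL2_CL1].
rewrite KopZ//; last exact: CL2_CL1.
have h1 := neumann_solves Lq s0; rewrite (e s s0) in h1.
have -> : neumann psi s = phi s - mult s * Kop k phi s + mult s * Kop k (neumann psi) s.
  by rewrite -h1 subrK.
by ring.
Qed.

Lemma neumann_bounded : exists M, forall phi, CL2 phi -> normsq (neumann phi) <= M * normsq phi.
Proof.
pose e := C / (1 - r).
have e0 : 0 <= e by rewrite divr_ge0// subr_ge0 ltW.
(* From [neumann_le], (x + y)^2 <= 2 x^2 + 2 y^2 and al(phi)^2 <= q P, where P is the integral of
   [norm1 (phi t) ^+ 2]; the last factor 2 compares P with [normsq phi]. *)
exists ((2 + 2 * (e ^+ 2 * q * q)) * 2) => phi Lp.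
have Ln := neumann_CL2 Lp.
have [_ Lp2] := CL2_norm1 Lp; have [_ La2] := La.
pose P := mint (fun t => norm1 (phi t) ^+ 2).
have P0 : 0 <= P by apply: mint_ge0 => t _; exact: sqr_ge0.
have alP : al phi ^+ 2 <= q * P by apply: cauchy_schwarz => //; exact: CL2_norm1.
have PQ : P <= 2 * normsq phi.
  have [[_ h1] [_ h2]] := Lp.
  rewrite /P /normsq -mintZ; last exact: L1D.
  apply: mint_le => //; first by apply: L1Z; exact: L1D.
  move=> t _; rewrite /norm1 -/(reF phi t) -/(imF phi t).
  have := sqr_ge0 (`|reF phi t| - `|imF phi t|).
  rewrite sqrrB sqrrD !real_normK ?num_real//; lra.
apply: (@le_trans _ _ (mint (fun t => 2 * norm1 (phi t) ^+ 2 + 2 * (e * al phi) ^+ 2 * a t ^+ 2))).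
  have [[_ h1] [_ h2]] := Ln.
  apply: mint_le; [exact: L1D|by apply: L1D; exact: L1Z|].
  move=> t t0; have := neumann_le Lp t0.
  have -> : dom phi t = norm1 (phi t) + e * al phi * a t by rewrite /dom /e; ring.
  set x := norm1 (phi t); set y := e * al phi * a t => h.
  have x0 : 0 <= x by exact: norm1_ge0.
  have y0 : 0 <= y.
    by apply: mulr_ge0; [apply: mulr_ge0 => //; exact: al_ge0|exact: a0].
  apply: (@le_trans _ _ (norm1 (neumann phi t) ^+ 2)).
    rewrite /norm1 sqrrD !real_normK ?num_real// /reF /imF.
    by rewrite -addrA [X in _ <= _ + X]addrC addrA lerDl mulrn_wge0// mulr_ge0.
  apply: (@le_trans _ _ ((x + y) ^+ 2)).
    by rewrite lerXn2r ?nnegrE ?addr_ge0 ?norm1_ge0.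
  have -> : 2 * (e * al phi) ^+ 2 * a t ^+ 2 = 2 * y ^+ 2 by rewrite /y; ring.
  by rewrite -subr_ge0 (_ : _ - _ = (x - y) ^+ 2); [exact: sqr_ge0|ring].
rewrite mintD; [|exact: L1Z|exact: L1Z].
rewrite !mintZ// -/P -/q exprMn.
have h : e ^+ 2 * q * (al phi ^+ 2) <= e ^+ 2 * q * (q * P).
  by rewrite ler_wpM2l// mulr_ge0// sqr_ge0.
apply: (@le_trans _ _ ((2 + 2 * (e ^+ 2 * q * q)) * P)); first by lra.
rewrite -[leRHS]mulrA ler_wpM2l//.
have : 0 <= e ^+ 2 * q * q by do 2 apply: mulr_ge0 => //; exact: sqr_ge0.
by move: (e ^+ 2 * q * q) => y y0; lra.
Qed.

End Neumann.

(** * Approximation of the Bessel kernel by degenerate kernels *)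

Section Essential.
Context {R : realType}.
Implicit Types (phi psi : R -> R[i]) (t s x y : R) (c z : R[i]).

Definition pol (n : nat) (A t s : R) : R :=
  (t <= A)%R%:R * (s <= A)%R%:R * pseries bessc (t * s) n.

(* [rho n A] is what is left of the kernel of [Nop] once the first [n] terms of
   the Bessel series, which give a degenerate kernel, are removed on [t, s <= A]. *)
Definition rho n A t s : R := (1 - expR (- t)) * (bk t s - pol n A t s).

Lemma measurable_le (A : R) : measurable_fun setT (fun t : R => (t <= A)%R%:R : R).
Proof.
rewrite (_ : (fun t => _) = \1_(`]-oo, A]%classic)); first exact: measurable_indic.
by apply/funext => t; rewrite indicE mem_setE in_itv/=.
Qed.

Lemma measurable_pseries n : measurable_fun setT (fun x : R => pseries bessc x n).
Proof.
elim: n => [|n ih].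
  rewrite (_ : (fun x => _) = cst 0); first exact: measurable_cst.
  by apply/funext => x; rewrite /pseries seriesEnat/= big_geq.
rewrite (_ : (fun x => _) = fun x : R => pseries bessc x n + bessc n * x ^+ n).
  by apply: measurable_funD => //; apply: measurable_funM => //; exact: measurable_funX.
by apply/funext => x; rewrite /pseries !seriesEnat/= big_nat_recr.
Qed.

Lemma measurable_rho n A : measurable_fun setT (fun x : R * R => rho n A x.1 x.2).
Proof.
have [mb _] := @bkernel_bk R.
have mp : measurable_fun setT (fun x : R * R => x.1 * x.2).
  by apply: measurable_funM; [exact: measurable_fst|exact: measurable_snd].
apply: measurable_funM.
  apply: (measurableT_comp (f := fun t : R => 1 - expR (- t))); last exact: measurable_fst.
  apply: measurable_funB => //; rewrite (_ : (fun t => _) = fun t => expR (-1 * t)).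
    exact: measurable_expRM.
  by apply/funext => t; rewrite mulN1r.
apply: measurable_funB => //; apply: measurable_funM; first apply: measurable_funM.
- apply: (measurableT_comp (f := fun t : R => (t <= A)%R%:R : R)); first exact: measurable_le.
  exact: measurable_fst.
- apply: (measurableT_comp (f := fun t : R => (t <= A)%R%:R : R)); first exact: measurable_le.
  exact: measurable_snd.
- by apply: (measurableT_comp (f := fun x => pseries bessc x n)) => //; exact: measurable_pseries.
Qed.

Lemma tail_small (e : R) : 0 < e -> exists2 A : R, 0 < A & mint (fun t => (A < t)%R%:R) <= e.
Proof.
move=> e0.
have ml (A : R) : meas (fun t => (A < t)%R%:R).
  rewrite (_ : (fun t => _) = \1_(`]A, +oo[%classic)); first exact: measurable_indic.
  by apply/funext => t; rewrite indicE mem_setE in_itv/= andbT.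
have h : (fun n => mint (fun t => (n.+1%:R < t)%R%:R)) @ \oo --> mint (fun=> 0).
  apply: (@mint_dct R (fun n t => (n.+1%:R < t)%R%:R) _ (fun=> 1) _ _ _ _).2.
  - by move=> n; exact: ml.
  - exact: L1_cst.
  - by move=> n t _; case: (_ < _) => /=; rewrite ?normr1 ?normr0.
  - move=> t _; apply: cvg_near_cst; near=> n.
    rewrite ltNge (@le_trans _ _ n%:R) ?ler_nat//.
    by near: n; exact: nbhs_infty_ger.
rewrite Rintegral_cst// mul0r in h.
move/cvgrPdist_le : h => /(_ e e0)[N _ h]; exists N.+1%:R => //.
by have := h N (leqnn N); rewrite /= sub0r normrN => /(le_trans (ler_norm _)).
Unshelve. all: by end_near. Qed.

(* On [t, s <= A] the remainder of the series is at most [d ^ 2]; elsewhere the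
   kernel is at most 1, which [d * d^-1] bounds; and the set [A < t] has small
   measure. *)
Definition weight (d A t : R) : R := if t <= A then d else d^-1.

Lemma SL2_weight d A : 0 < d -> d <= 1 -> SL2 (weight d A).
Proof.
move=> d0 d1; apply: SL2_le (SL2_cst d^-1) _.
  rewrite (_ : weight d A = fun t => (t <= A)%R%:R * d + (1 - (t <= A)%R%:R) * d^-1).
    have ml := @measurable_le A.
    by apply: measurable_funTS; apply: measurable_funD; apply: measurable_funM => //; exact: measurable_funB.
  by apply/funext => t; rewrite /weight; case: ifP => _ /=; ring.
have di : 0 <= d^-1 by rewrite invr_ge0 ltW.
move=> t _; rewrite /weight; case: ifP => _; rewrite ger0_norm//; last exact: ltW.
by apply: (le_trans d1); rewrite invf_ge1.
Qed.

Lemma rho_le (d A t s : R) n : 0 < d -> d <= 1 ->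
  expR (A * A) - series (exp_coeff (A * A)) n <= d * d -> 0 < t -> 0 < s ->
  `|rho n A t s| <= weight d A t * weight d A s.
Proof.
move=> d0 d1 tail t0 s0; rewrite /rho normrM.
have /andP[e0 e1] := expRN_01 t0.
have di : 1 <= d^-1 by rewrite invf_ge1.
have di0 : 0 <= d^-1 by rewrite invr_ge0 ltW.
apply: (@le_trans _ _ `|bk t s - pol n A t s|).
  by rewrite ler_piMl// ger0_norm; lra.
rewrite /weight /pol; case: (leP t A) => tA; case: (leP s A) => sA.
- rewrite !mul1r; apply: le_trans tail; apply: psum_tail; first exact: bessc_le1.
  rewrite ger0_norm; last by apply: mulr_ge0; exact: ltW.
  by apply: ler_pM => //; exact: ltW.
all: rewrite /= ?mulr0 ?mul0r subr0; apply: (le_trans (bess_le1 _));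
  first by apply: mulr_ge0; exact: ltW.
- by rewrite divff ?gt_eqF.
- by rewrite mulVf ?gt_eqF.
- by rewrite -[leLHS]mulr1 ler_pM.
Qed.

Lemma mint_weight (d A : R) : 0 < d -> d <= 1 ->
  mint (fun t => weight d A t ^+ 2) <=
    d ^+ 2 * mint (fun=> 1) + d^-1 ^+ 2 * mint (fun t => (A < t)%R%:R).
Proof.
move=> d0 d1; have [_ Lw] := SL2_weight A d0 d1.
have Ll : L1 (fun t => (A < t)%R%:R).
  apply: L1_le (L1_cst 1) _; last by move=> t _; case: (_ < _) => /=; rewrite ?normr1 ?normr0.
  rewrite (_ : (fun t => _) = \1_(`]A, +oo[%classic)); first exact: measurable_indic.
  by apply/funext => t; rewrite indicE mem_setE in_itv/= andbT.
rewrite -!mintZ//; last exact: L1_cst.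
rewrite -mintD; [|by apply: L1Z; exact: L1_cst|exact: L1Z].
apply: mint_le => //; first by apply: L1D; apply: L1Z => //; exact: L1_cst.
move=> t _; rewrite /weight mulr1; case: (leP t A) => _ /=; first by rewrite mulr0 addr0.
by rewrite mulr1 lerDr sqr_ge0.
Qed.

(** The parameters are chosen in the order d, A, n. A small d makes the contribution of t <= A to C
    times the integral of a^2 at most 1/3; then A is so large that the tail, although weighted by
    d^-2, also contributes at most 1/3; finally n makes the series remainder on the square at most
    d^2. *)
Lemma small_kernel (C : R) : 0 < C -> exists (n : nat) (A : R) (a : R -> R),
  [/\ SL2 a, (forall t, 0 < t -> 0 <= a t), C * mint (fun t => a t ^+ 2) < 1,
      bkernel (rho n A) & forall t s, 0 < t -> 0 < s -> `|rho n A t s| <= a t * a s].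
Proof.
move=> C0; pose M : R := mint (fun=> 1).
have M0 : 0 <= M by exact: mint_ge0.
pose d : R := Num.min 1 (3 * C * (M + 1))^-1.
have p0 : 0 < 3 * C * (M + 1) by rewrite !mulr_gt0// ltr_wpDl.
have d0 : 0 < d by rewrite lt_min ltr01 invr_gt0.
have d1 : d <= 1 by rewrite ge_min lexx.
have dM : d <= (3 * C * (M + 1))^-1 by rewrite ge_min lexx orbT.
have e0 : 0 < d ^+ 2 / (3 * C) by rewrite divr_gt0 ?exprn_gt0// mulr_gt0.
have [A _ tA] := tail_small e0.
have dd : 0 < d * d by rewrite mulr_gt0.
have [n hn] := cvg_expseries_tail (A * A) dd.
have k1 := rho_le d0 d1 hn.
exists n, A, (weight d A); split => //.
- exact: SL2_weight.
- by move=> t _; rewrite /weight; case: ifP => _; rewrite ?invr_ge0 ltW.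
- have hw := mint_weight A d0 d1.
  have h1 : C * (d ^+ 2 * M) <= 3^-1.
    have : d * (3 * C * (M + 1)) <= 1.
      by rewrite -ler_pdivlMr// mul1r.
    have : C * (d ^+ 2 * M) <= C * (d * (M + 1)).
      rewrite ler_pM2l// expr2 -mulrA; apply: ler_wpM2l; first exact: ltW.
      by apply: (@le_trans _ _ M); rewrite ?lerDl// ler_piMl.
    move: (C * (d ^+ 2 * M)) => Y; rewrite (_ : d * (3 * C * (M + 1)) = 3 * (C * (d * (M + 1)))); last by ring.
    move: (C * (d * (M + 1))) => X; lra.
  have h2 : C * (d^-1 ^+ 2 * mint (fun t => (A < t)%R%:R)) <= 3^-1.
    apply: (@le_trans _ _ (C * (d^-1 ^+ 2 * (d ^+ 2 / (3 * C))))).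
      by rewrite ler_pM2l// ler_wpM2l// sqr_ge0.
    rewrite le_eqVlt; apply/orP; left; apply/eqP; field; rewrite !gt_eqF//.
  have : C * mint (fun t => weight d A t ^+ 2) <= C * (d ^+ 2 * M + d^-1 ^+ 2 * mint (fun t => (A < t)%R%:R)).
    by rewrite ler_pM2l.
  rewrite mulrDr; move: h1 h2.
  move: (C * (d ^+ 2 * M)) (C * (d^-1 ^+ 2 * mint (fun t => (A < t)%R%:R)))
    (C * mint (fun t => weight d A t ^+ 2)) => X Y Z; lra.
- split; first exact: measurable_rho.
  exists (d^-1 * d^-1) => t s t0 s0; rewrite (le_trans (k1 _ _ t0 s0))//.
  have wd x : 0 <= weight d A x <= d^-1.
    have di : 0 <= d^-1 by rewrite invr_ge0 ltW.
    rewrite /weight; case: ifP => _; rewrite ?di ?lexx// ltW//=.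
    by apply: (le_trans d1); rewrite invf_ge1.
  by have /andP[? ?] := wd t; have /andP[? ?] := wd s; rewrite ler_pM.
Qed.

Lemma spectral_gap c : ~ [set x%:C%C | x in [set x : R | 0 <= x <= 1]] c ->
  exists2 d : R, 0 < d & forall x, 0 <= x <= 1 -> d <= norm1 (c - x%:C%C).
Proof.
move=> h; have [i0|i0] := eqVneq (Im c) 0; last first.
  exists `|Im c|; first by rewrite normr_gt0.
  by move=> x _; apply: le_trans (norm1_Im _); rewrite raddfB/= subr0.
have [c0|c0] := ltP (Re c) 0.
  exists (- Re c); first by rewrite oppr_gt0.
  move=> x /andP[x0 _]; apply: le_trans (norm1_Re _); rewrite raddfB/=.
  by rewrite ltr0_norm; lra.
have [c1|c1] := ltP 1 (Re c).
  exists (Re c - 1); first by rewrite subr_gt0.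
  move=> x /andP[_ x1]; apply: le_trans (norm1_Re _); rewrite raddfB/=.
  by rewrite gtr0_norm; lra.
exfalso; apply: h; exists (Re c); first by rewrite /= c0 c1.
by apply: complex_ext.
Qed.

Lemma norm1V z : z != 0 -> norm1 z^-1 <= 2 / norm1 z.
Proof.
move=> z0; have nz : 0 < norm1 z.
  rewrite lt_neqAle norm1_ge0 andbT eq_sym; apply: contraNneq z0 => /eqP.
  rewrite paddr_eq0// !normr_eq0 => /andP[/eqP a0 /eqP b0].
  by apply/eqP/complex_ext.
rewrite ler_pdivlMr//; case: z z0 nz => a b z0; rewrite /norm1/= => nz.
have n0 : 0 < a ^+ 2 + b ^+ 2.
  rewrite lt_neqAle addr_ge0 ?sqr_ge0// andbT eq_sym paddr_eq0 ?sqr_ge0// !sqrf_eq0.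
  by apply: contraNN z0 => /andP[/eqP -> /eqP ->].
rewrite normrN !normrM !normfV (gtr0_norm n0) -mulrDl mulrAC ler_pdivrMr//.
have := sqr_ge0 (`|a| - `|b|).
rewrite sqrrB -(real_normK (num_real a)) -(real_normK (num_real b)).
move: `|a| `|b| => x y; rewrite !expr2; lra.
Qed.

End Essential.

(** * Inverse of the multiplier and splitting of the kernel *)

Section Multiplier.
Context {R : realType}.
Implicit Types (phi psi : R -> R[i]) (t s x y : R) (c z : R[i]).

Definition gap c t := c - (expR (- t))%:C%C.

Lemma gap_re c t : reF (gap c) t = Re c - expR (- t).
Proof. by rewrite /reF /gap raddfB. Qed.

Lemma gap_im c t : imF (gap c) t = Im c.
Proof. by rewrite /imF /gap raddfB/= subr0. Qed.

Lemma cmeas_gapV c : (forall t, 0 < t -> gap c t != 0) -> cmeas (fun t => (gap c t)^-1).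
Proof.
move=> g0; have me : meas (fun t => expR (- t)) by exact: meas_expRN.
pose N t := (Re c - expR (- t)) ^+ 2 + Im c ^+ 2.
have N0 t : 0 < t -> 0 < N t.
  move=> t0; rewrite lt_neqAle addr_ge0 ?sqr_ge0// andbT eq_sym.
  rewrite paddr_eq0 ?sqr_ge0// !sqrf_eq0.
  apply: contraNN (g0 t t0) => /andP[/eqP a0 /eqP b0].
  by apply/eqP/complex_ext; [rewrite -[LHS]/(reF (gap c) t) gap_re|rewrite -[LHS]/(imF (gap c) t) gap_im].
have mN : meas (fun t => (N t)^-1).
  apply: open_continuous_measurable_fun; first exact: interval_open.
  move=> t; rewrite inE/= in_itv/= andbT => t0.
  have ce : {for t, continuous (fun t : R => Re c - expR (- t))}.
    apply: cvgB; first exact: cvg_cst.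
    have h := @continuous_expRM R (-1) t.
    by move: h; rewrite (_ : (fun t => expR (-1 * t)) = fun t : R => expR (- t))//;
      apply/funext => s; rewrite mulN1r.
  apply: cvgV; first by rewrite gt_eqF// N0.
  by apply: cvgD; [under eq_fun do rewrite expr2; apply: cvgM|exact: cvg_cst].
split.
  rewrite (_ : reF _ = fun t => (Re c - expR (- t)) * (N t)^-1).
    by apply: measurable_funM => //; apply: measurable_funB.
  by apply/funext => t; rewrite /reF /N -gap_re -(gap_im c t) /reF /imF; case: (gap c t).
rewrite (_ : imF _ = fun t => - Im c * (N t)^-1); first exact: measurable_funM.
by apply/funext => t; rewrite /N -gap_re -(gap_im c t) /imF /reF; case: (gap c t) => a b /=; rewrite mulNr.
Qed.

(** For t > 0 the value e^-t lies in the unit interval, so the distance of [c] from that interval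
    bounds the symbol of c - M away from 0. *)
Lemma gapV_bounded c : ~ [set x%:C%C | x in [set x : R | 0 <= x <= 1]] c ->
  [/\ forall t, 0 < t -> gap c t != 0, cmeas (fun t => (gap c t)^-1) &
      exists2 C, 0 < C & forall t, 0 < t -> norm1 (gap c t)^-1 <= C].
Proof.
move=> /spectral_gap[d d0 hd].
have gd t : 0 < t -> d <= norm1 (gap c t).
  by move=> t0; apply: hd; have /andP[e0 e1] := expRN_01 t0; rewrite !ltW.
have g0 t : 0 < t -> gap c t != 0.
  move=> t0; apply: contraTneq (gd t t0) => ->.
  by rewrite /norm1/= normr0 addr0 -ltNge.
split => //; first exact: cmeas_gapV.
exists (2 / d); first by rewrite divr_gt0.
move=> t t0; apply: (le_trans (norm1V (g0 t t0))).
by rewrite ler_pM2l// lef_pV2 ?posrE// ?gd// (lt_le_trans d0 (gd t t0)).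
Qed.

Lemma normsq_le_mul phi psi (C : R) : cmeas psi -> CL2 phi -> 0 <= C ->
  (forall t, 0 < t -> norm1 (psi t) <= C) -> normsq (fun t => psi t * phi t) <= C ^+ 2 * normsq phi.
Proof.
move=> mp Lp C0 pC; have [[_ h1] [_ h2]] := CL2M_bounded mp Lp pC.
have [[_ k1] [_ k2]] := Lp.
rewrite /normsq -mintZ; last exact: L1D.
apply: mint_le; [exact: L1D|by apply: L1Z; exact: L1D|].
move=> t t0; have := pC t t0.
rewrite /reF /imF cReM cImM; case: (psi t) => a b /=; case: (phi t) => x y /=.
rewrite /norm1/= => abC.
have -> : (a * x - b * y) ^+ 2 + (a * y + b * x) ^+ 2 = (a ^+ 2 + b ^+ 2) * (x ^+ 2 + y ^+ 2) by ring.
rewrite ler_wpM2r ?addr_ge0 ?sqr_ge0//.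
apply: (@le_trans _ _ ((`|a| + `|b|) ^+ 2)).
  rewrite sqrrD !real_normK ?num_real// -addrA lerD2l lerDr mulrn_wge0// mulr_ge0//.
by rewrite lerXn2r ?nnegrE// addr_ge0.
Qed.

Definition mono (A : R) (j : nat) s : R := (s <= A)%R%:R * s ^+ j.

Lemma meas_mono A j : meas (mono A j).
Proof.
apply: measurable_funM; first by apply: measurable_funTS; exact: measurable_le.
by apply: measurable_funX.
Qed.

Lemma SL2_mono A j : SL2 (mono A j).
Proof.
apply: SL2_le (SL2_cst (`|A| ^+ j)) _; first exact: meas_mono.
move=> t t0; rewrite /mono; case: (leP t A) => tA /=; last by rewrite mul0r normr0 exprn_ge0.
by rewrite mul1r normrX lerXn2r ?nnegrE// gtr0_norm// (le_trans tA)// ler_norm.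
Qed.

(* [rho n A] and the [degen A j t * mono A j s], [j < n], add up to the kernel
   of [Nop]. *)
Definition degen (A : R) (j : nat) t : R := (1 - expR (- t)) * bessc j * mono A j t.

Lemma SL2_degen A j : SL2 (degen A j).
Proof.
apply: (SL2M_bounded (C := `|bessc j : R|)); first exact: SL2_mono.
  by apply: measurable_funM => //; apply: measurable_funB => //; exact: meas_expRN.
move=> t t0; have /andP[e0 e1] := expRN_01 t0.
by rewrite normrM ler_piMl// ger0_norm; lra.
Qed.

Lemma CL2_real (u : R -> R) : SL2 u -> CL2 (fun t => (u t)%:C%C).
Proof. by move=> Lu; split => //; exact: SL2_cst. Qed.

Lemma cint_real (u : R -> R) phi :
  cintegral (fun t => (u t)%:C%C * phi t) =
  (mint (fun t => u t * reF phi t) +i* mint (fun t => u t * imF phi t))%C.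
Proof.
rewrite cintE; congr (_ +i* _)%C; apply: mint_eq => t _.
  by rewrite /reF cReM/= mul0r subr0.
by rewrite /imF cImM/= mul0r addr0.
Qed.

Lemma mint_pol n A t (f : R -> R) : SL2 f ->
  L1 (fun s => pol n A t s * f s) /\
  mint (fun s => pol n A t s * f s) =
    \sum_(j < n) bessc j * mono A j t * mint (fun s => mono A j s * f s).
Proof.
move=> Lf.
have Lj (j : 'I_n) : L1 (fun s => bessc j * mono A j t * (mono A j s * f s)).
  by apply: L1Z; apply: SL2M => //; exact: SL2_mono.
have e : (fun s => pol n A t s * f s) =
    fun s => \sum_(j < n) bessc j * mono A j t * (mono A j s * f s).
  apply/funext => s; rewrite /pol /pseries seriesEord/= mulr_sumr mulr_suml.
  by apply: eq_bigr => j _; rewrite /mono exprMn; ring.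
rewrite e; have [h1 h2] := mint_sum (index_enum 'I_n) Lj; split => //.
rewrite h2; apply: eq_bigr => j _; rewrite mintZ//.
by apply: SL2M => //; exact: SL2_mono.
Qed.

Lemma Nop_split n A phi t : CL2 phi -> 0 < t ->
  Nop phi t = Kop (rho n A) phi t +
    \sum_(j < n) cintegral (fun s => (mono A j s)%:C%C * phi s) * (degen A j t)%:C%C.
Proof.
move=> Lp t0; have [b1 b2] := Kop_L1 bkernel_bk (CL2_CL1 Lp) t0.
have real (f : R -> R) : SL2 f -> L1 (fun s => bk t s * f s) ->
    (1 - expR (- t)) * mint (fun s => bk t s * f s) =
    mint (fun s => rho n A t s * f s) +
    \sum_(j < n) mint (fun s => mono A j s * f s) * degen A j t.
  move=> Lf Lb; have [Lpol e] := mint_pol n A t Lf.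
  rewrite (_ : mint (fun s => rho n A t s * f s) =
    (1 - expR (- t)) * (mint (fun s => bk t s * f s) - mint (fun s => pol n A t s * f s))).
    rewrite mulrBr -addrA e mulr_sumr -sumrN -big_split/= big1 ?addr0// => j _.
    by rewrite /degen; ring.
  rewrite -mintB// -mintZ; last exact: L1B.
  by apply: mint_eq => s _; rewrite /rho -mulrA; congr (_ * _); exact: mulrBl.
under eq_bigr do rewrite cint_real.
apply: complex_ext.
  rewrite raddfD raddf_sum /Nop cReM/= mul0r subr0 (real (reF phi) Lp.1 b1).
  by congr (_ + _); apply: eq_bigr => j _; rewrite mulr0 subr0.
rewrite raddfD raddf_sum /Nop cImM/= mul0r addr0 (real (imF phi) Lp.2 b2).
by congr (_ + _); apply: eq_bigr => j _; rewrite mulr0 add0r.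
Qed.

End Multiplier.

(** * The space H_0 as the image of L_2(m) *)

Section SpaceH0.
Context {R : realType}.
Implicit Types (phi psi : R -> R[i]) (t s x y : R) (c z : R[i]) (f g : disk R -> R[i]).

Lemma H0_laplace phi : CL2 phi -> H0 (laplace phi).
Proof. by move=> Lp; exists phi => //; apply/L2P. Qed.

Lemma H0P f : H0 f -> CL2 (laplace_inv f) /\ laplace (laplace_inv f) = f.
Proof. by case=> phi /L2P Lp <-; exact: laplace_inv_spec. Qed.

Lemma H0D f g : H0 f -> H0 g -> H0 (f + g).
Proof.
move=> /H0P[Lf <-] /H0P[Lg <-]; rewrite -laplaceD//.
by apply: H0_laplace; exact: CL2D.
Qed.

Lemma H0Z c f : H0 f -> H0 (c *: f).
Proof.
move=> /H0P[Lf <-]; rewrite -laplaceZ//.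
by apply: H0_laplace; exact: CL2Z.
Qed.

Lemma H0_0 : H0 (0 : disk R -> R[i]).
Proof.
have L0 : CL2 (fun=> 0 : R[i]) by split; exact: SL2_cst.
have := H0Z 0 (H0_laplace L0); by rewrite scale0r.
Qed.

Lemma H0_transfer f : H0 f -> H0 (transfer f).
Proof.
move=> /H0P[Lf <-]; rewrite transfer_laplace//.
by apply: H0_laplace; exact: Aop_CL2.
Qed.

Lemma H0norm_ge0 f : 0 <= H0norm f. Proof. exact: sqrtr_ge0. Qed.

Lemma H0normD f g : H0 f -> H0 g -> H0norm (f + g) <= H0norm f + H0norm g.
Proof.
move=> /H0P[Lf <-] /H0P[Lg <-]; rewrite -laplaceD//.
by rewrite !H0norm_laplace//; [exact: L2norm_triangle|exact: CL2D].
Qed.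

Lemma cabs_le c : cabs c <= norm1 c.
Proof.
rewrite -ler_sqr ?nnegrE ?sqrtr_ge0 ?norm1_ge0// sqr_sqrtr ?addr_ge0 ?sqr_ge0//.
by rewrite /norm1 sqrrD !real_normK ?num_real// -addrA lerD2l lerDr mulrn_wge0// mulr_ge0.
Qed.

Lemma H0normZ c f : H0 f -> H0norm (c *: f) <= norm1 c * H0norm f.
Proof.
move=> /H0P[Lf <-]; rewrite -laplaceZ// !H0norm_laplace//; last exact: CL2Z.
by rewrite L2normZ// ler_wpM2r ?sqrtr_ge0// cabs_le.
Qed.

Lemma laplace_sum (I : Type) (r : seq I) (c : I -> R[i]) (w : I -> R -> R[i]) :
  (forall i, CL2 (w i)) ->
  CL2 (fun t => \sum_(i <- r) c i * w i t) /\
  laplace (fun t => \sum_(i <- r) c i * w i t) = \sum_(i <- r) c i *: laplace (w i).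
Proof.
move=> Lw; elim: r => [|i r [L e]].
  have L0 : CL2 (fun=> 0 : R[i]) by split; exact: SL2_cst.
  split; first by under eq_fun do rewrite big_nil.
  rewrite big_nil -[RHS](scale0r (laplace (fun=> 0))) -laplaceZ//.
  by apply: laplace_eq => t _; rewrite big_nil mul0r.
have Li : CL2 (fun t => c i * w i t) by exact: CL2Z.
have -> : (fun t => \sum_(i <- i :: r) c i * w i t) =
    fun t => c i * w i t + \sum_(i <- r) c i * w i t.
  by apply/funext => t; rewrite big_cons.
split; first exact: CL2D.
by rewrite big_cons laplaceD// laplaceZ// e.
Qed.

(** Integration against a square-integrable function is thus a well-defined functional on H_0;
    linearity of the finite-rank coefficients rests on this. *)
Lemma cint_laplace_inv (w : R -> R[i]) phi : CL2 w -> CL2 phi ->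
  cintegral (fun s => w s * laplace_inv (laplace phi) s) = cintegral (fun s => w s * phi s).
Proof.
move=> Lw Lp; have [Lq e] := laplace_inv_spec Lp; set psi := laplace_inv _ in Lq e *.
have := (laplace_eqP Lq Lp).1 e => q0.
have := cint_ae0 Lw (CL2D Lq (CL2Z (-1) Lp)) q0.
have -> : cintegral (fun t => w t * (psi t + -1 * phi t)) =
    cintegral (fun t => w t * psi t + -1 * (w t * phi t)).
  by apply: cint_eq => t _; ring.
rewrite cintD; [|exact: CL2M|]; last first.
  rewrite (_ : (fun t => _) = fun t => (-1 * w t) * phi t).
    by apply: CL2M => //; exact: CL2Z.
  by apply/funext => t; rewrite mulrA.
rewrite cintZ; last exact: CL2M.
by rewrite mulN1r => /subr0_eq.
Qed.

Lemma cint_real_le (u : R -> R) : SL2 u ->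
  exists M : R, forall phi, CL2 phi -> norm1 (cintegral (fun s => (u s)%:C%C * phi s)) <= M * L2norm phi.
Proof.
move=> Lu; pose W := Num.sqrt (mint (fun t => u t ^+ 2)).
have U0 (h : R -> R) : 0 <= mint (fun t => h t ^+ 2) by apply: mint_ge0 => t _; exact: sqr_ge0.
exists (2 * W) => phi Lp; have [h1 h2] := Lp.
have cs (h : R -> R) : SL2 h -> mint (fun t => h t ^+ 2) <= normsq phi ->
    `|mint (fun t => u t * h t)| <= W * L2norm phi.
  move=> Lh hQ; rewrite -ler_sqr ?nnegrE ?mulr_ge0 ?sqrtr_ge0//.
  rewrite real_normK ?num_real// exprMn !sqr_sqrtr ?normsq_ge0//.
  by rewrite (le_trans (cauchy_schwarz Lu Lh))// ler_wpM2l.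
rewrite cint_real /norm1/= -mulrA mulr_natl mulr2n lerD//; apply: cs => //; rewrite normsqE//.
  by rewrite lerDl.
by rewrite lerDr.
Qed.

End SpaceH0.

(** * The alternative for the transfer operator *)

Section Alternative.
Context {R : realType}.
Implicit Types (phi psi : R -> R[i]) (t s : R) (f g : disk R -> R[i]).

Variables (lambda : R[i]).
Hypothesis lambda01 : ~ [set x%:C%C | x in [set x : R | 0 <= x <= 1]] lambda.

Let mult t := (gap lambda t)^-1.

Variables (C A : R) (n : nat) (a : R -> R).
Hypothesis C0 : 0 < C.
Hypothesis multC : forall t, 0 < t -> norm1 (mult t) <= C.
Hypothesis La : SL2 a.
Hypothesis a0 : forall t, 0 < t -> 0 <= a t.
Hypothesis Ca1 : C * mint (fun t => a t ^+ 2) < 1.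
Hypothesis brho : bkernel (rho n A).
Hypothesis ka : forall t s, 0 < t -> 0 < s -> `|rho n A t s| <= a t * a s.

Let gap_neq0 t : 0 < t -> gap lambda t != 0.
Proof. by have [h _ _] := gapV_bounded lambda01; exact: h. Qed.

Let mmult : cmeas mult.
Proof. by have [_ h _] := gapV_bounded lambda01. Qed.

(** [Bop] is A - lambda stripped of its finite-rank part. It factors as - gap (1 - mult K), K having
    kernel [rho n A], so its inverse [Sop] is the Neumann series applied to - mult phi. *)
Let Bop phi t := - gap lambda t * phi t + Kop (rho n A) phi t.
Let Sop phi := neumann (rho n A) mult (fun t => - mult t * phi t).

Let Bop_CL2 phi : CL2 phi -> CL2 (Bop phi).
Proof.
move=> Lp; apply: CL2D; last by apply: Kop_CL2 => //; exact: CL2_CL1.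
rewrite (_ : (fun t => _) = fun t => (expR (- t))%:C%C * phi t + - lambda * phi t).
  apply: CL2D; last exact: CL2Z.
  apply: (CL2M_bounded (C := 1)) => //; first by apply: cmeas_real; exact: meas_expRN.
  by move=> t t0; have /andP[e0 e1] := expRN_01 t0; rewrite norm1_real gtr0_norm// ltW.
by apply/funext => t; rewrite /gap; ring.
Qed.

Let BopD phi psi (c : R[i]) t : CL2 phi -> CL2 psi -> 0 < t ->
  Bop (fun s => c * phi s + psi s) t = c * Bop phi t + Bop psi t.
Proof.
move=> Lp Lq t0; rewrite /Bop KopD//; [|by apply: CL2_CL1; exact: CL2Z|exact: CL2_CL1].
by rewrite KopZ//; [ring|exact: CL2_CL1].
Qed.

Let multN_CL2 phi : CL2 phi -> CL2 (fun t => - mult t * phi t).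
Proof.
move=> Lp; rewrite (_ : (fun t => _) = fun t => -1 * (mult t * phi t)).
  by apply: CL2Z; exact: CL2M_bounded multC.
by apply/funext => t; ring.
Qed.

Let Sop_CL2 phi : CL2 phi -> CL2 (Sop phi).
Proof.
move=> Lp; apply: (neumann_CL2 brho mmult (ltW C0) multC La a0 ka Ca1).
exact: multN_CL2.
Qed.

Let SopB phi psi t : CL2 phi -> CL2 psi -> (forall s, 0 < s -> psi s = Bop phi s) ->
  0 < t -> Sop psi t = phi t.
Proof.
move=> Lp Lq e t0; apply: (neumann_unique brho mmult (ltW C0) multC La a0 ka Ca1) => //.
  exact: multN_CL2.
move=> s s0; rewrite e// /Bop mulrDr mulrA mulrNN mulVf ?mul1r ?mulNr//.
exact: gap_neq0.
Qed.

Let BopS phi t : CL2 phi -> 0 < t -> Bop (Sop phi) t = phi t.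
Proof.
move=> Lp t0.
have := neumann_solves brho mmult (ltW C0) multC La a0 ka Ca1 (multN_CL2 Lp) t0.
rewrite -/(Sop phi) => e.
have g0 := gap_neq0 t0.
transitivity (- gap lambda t * (Sop phi t - mult t * Kop (rho n A) (Sop phi) t)).
  by rewrite /Bop mulrBr [X in _ - X]mulrA [- _ * mult t]mulNr mulfV// mulN1r opprK.
by rewrite e mulrA mulrNN mulfV// mul1r.
Qed.

Let Sop_bounded : exists2 M, 0 <= M & forall phi, CL2 phi -> normsq (Sop phi) <= M * normsq phi.
Proof.
have [M hM] := neumann_bounded brho mmult (ltW C0) multC La a0 ka Ca1.
exists (`|M| * C ^+ 2); first by rewrite mulr_ge0// sqr_ge0.
move=> phi Lp; apply: (le_trans (hM _ (multN_CL2 Lp))).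
apply: (le_trans (ler_wpM2r (normsq_ge0 _) (ler_norm M))); rewrite -mulrA ler_wpM2l//.
apply: normsq_le_mul => //; last 2 first.
- exact: ltW.
- by move=> t t0; rewrite (_ : norm1 (- mult t) = norm1 (mult t)) ?multC// /norm1 !raddfN/= !normrN.
by rewrite (_ : (fun t => _) = fun t => -1 * mult t); [apply: cmeasM => //; exact: cmeas_cst|
  apply/funext => t; rewrite mulN1r].
Qed.

Let w (j : nat) t : R[i] := (mono A j t)%:C%C.
Let u (j : nat) t : R[i] := (degen A j t)%:C%C.
Let v (j : 'I_n) f := cintegral (fun s => w j s * laplace_inv f s).
(** Defined by subtraction, which makes the decomposition of transfer - lambda immediate; that it is
    the image of [Bop] under [laplace] is then [BE]. *)
Let B f := transfer f - lambda *: f - \sum_(j < n) v j f *: laplace (u j).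
Let S f := laplace (Sop (laplace_inv f)).

Let w_CL2 j : CL2 (w j). Proof. by apply: CL2_real; exact: SL2_mono. Qed.
Let u_CL2 j : CL2 (u j). Proof. by apply: CL2_real; exact: SL2_degen. Qed.

Let vE j phi : CL2 phi -> v j (laplace phi) = cintegral (fun s => w j s * phi s).
Proof. by move=> Lp; exact: cint_laplace_inv. Qed.

Let BE phi : CL2 phi -> B (laplace phi) = laplace (Bop phi).
Proof.
move=> Lp; rewrite /B transfer_laplace//; apply/eqP.
under eq_bigr do rewrite vE//.
have [Ls <-] := laplace_sum (index_enum 'I_n)
  (fun j => cintegral (fun s => w j s * phi s)) (fun j : 'I_n => u_CL2 j).
rewrite !subr_eq -laplaceZ// -laplaceD//; last exact: Bop_CL2.
rewrite -laplaceD//; [|by apply: CL2D => //; exact: Bop_CL2|exact: CL2Z].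
apply/eqP/laplace_eq => t t0; rewrite /Aop (@Nop_split _ n A)// /Bop /gap.
by move: (\sum_(_ < n) _) => X; ring.
Qed.

Let fredholm_pieces :
  [/\ forall f, H0 f -> H0 (B f),
      forall c f g, H0 f -> H0 g -> B (c *: f + g) = c *: B f + B g,
      forall f, H0 f -> H0 (S f) &
      [/\ forall f, H0 f -> S (B f) = f,
      forall f, H0 f -> B (S f) = f &
      exists M, forall f, H0 f -> H0norm (S f) <= M * H0norm f]].
Proof.
split; last split.
- by move=> f /H0P[Lf <-]; rewrite BE//; apply: H0_laplace; exact: Bop_CL2.
- move=> c f g /H0P[Lf <-] /H0P[Lg <-].
  rewrite -laplaceZ// -laplaceD//; last exact: CL2Z.
  rewrite !BE//; last by apply: CL2D => //; exact: CL2Z.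
  rewrite -laplaceZ; last exact: Bop_CL2.
  rewrite -laplaceD; [|by apply: CL2Z; exact: Bop_CL2|exact: Bop_CL2].
  by apply: laplace_eq => t t0; exact: BopD.
- by move=> f /H0P[Lf _]; apply: H0_laplace; exact: Sop_CL2.
(* [S] applies [Sop] to the representative [chi] chosen for [laplace (Bop phi)], not to [Bop phi]
   itself. Their difference has zero seminorm, and the bound on [Sop] carries this over to [Sop chi]
   and [phi]. *)
- move=> f /H0P[Lf fE]; rewrite -[in LHS]fE -[RHS]fE BE//; set phi := laplace_inv f in Lf *.
  have LB := Bop_CL2 Lf; have [Lc e] := laplace_inv_spec LB.
  rewrite /S; set chi := laplace_inv _ in Lc e *.
  have LS := Sop_CL2 Lc.
  apply/(laplace_eqP LS Lf); apply/eqP; rewrite eq_le normsq_ge0 andbT.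
  have [M M0 hM] := Sop_bounded.
  have q0 := (laplace_eqP Lc LB).1 e.
  have Ld := CL2D Lc (CL2Z (-1) LB).
  have := hM _ Ld; rewrite q0 mulr0; apply: le_trans.
  rewrite le_eqVlt; apply/orP; left; apply/eqP.
  apply: mint_eq => t t0; rewrite /reF /imF.
  have -> // : Sop (fun t => chi t + -1 * Bop phi t) t = Sop chi t + -1 * phi t.
  apply: (@SopB (fun t => Sop chi t + -1 * phi t)) => //; first by apply: CL2D => //; exact: CL2Z.
  move=> s s0; rewrite -(BopS Lc s0).
  transitivity (-1 * Bop phi s + Bop (Sop chi) s); first by rewrite addrC.
  rewrite -BopD//; congr (Bop _ s); by apply/funext => r; rewrite addrC.
- move=> f /H0P[Lf fE]; rewrite /S BE; last exact: Sop_CL2.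
  by rewrite -[RHS]fE; apply: laplace_eq => t t0; exact: BopS.
- have [M M0 hM] := Sop_bounded; exists (Num.sqrt M) => f /H0P[Lf fE].
  rewrite -[in leRHS]fE /S !H0norm_laplace//; last exact: Sop_CL2.
  by rewrite /L2norm -sqrtrM// ler_wsqrtr// hM.
Qed.

Lemma transfer_alternative :
  finite_multiplicity H0 transfer lambda /\
  (~ resolvent_set H0 H0norm transfer lambda -> is_eigenvalue H0 transfer lambda).
Proof.
have [BH BL SH [SB BS Sbd]] := fredholm_pieces.
have uH (j : 'I_n) : H0 (laplace (u j)) by exact: H0_laplace.
have TE f : H0 f -> transfer f - lambda *: f = B f + \sum_(j < n) v j f *: laplace (u j).
  by move=> _; rewrite /B subrK.
split; first exact: (fredholm_multiplicity (@H0D R) (@H0Z R) (@H0_0 R) BL SH SB BS uH TE).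
apply: (fredholm_alternative (@H0D R) (@H0Z R) (@H0_0 R) (@H0norm_ge0 R) (@H0normD R)
  (@H0normZ R) BH BL SH SB BS Sbd uH _ _ TE).
- move=> j c f g /H0P[Lf <-] /H0P[Lg <-].
  rewrite -laplaceZ// -laplaceD//; last exact: CL2Z.
  rewrite !vE//; last by apply: CL2D => //; exact: CL2Z.
  rewrite -cintZ; last exact: CL2M.
  rewrite -cintD; [|by rewrite (_ : (fun t => _) = fun t => w j t * (c * laplace_inv f t));
    [apply: CL2M => //; exact: CL2Z|apply/funext => t; rewrite mulrCA]|exact: CL2M].
  by apply: cint_eq => t _; ring.
- move=> j; have [M hM] := cint_real_le (SL2_mono A j).
  by exists M => f /H0P[Lf fE]; rewrite -[in leRHS]fE H0norm_laplace//; exact: hM.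
Qed.

End Alternative.

Lemma transfer_fredholm (R : realType) (lambda : R[i]) :
  ~ [set x%:C%C | x in [set x : R | 0 <= x <= 1]] lambda ->
  finite_multiplicity H0 transfer lambda /\
  (~ resolvent_set H0 H0norm transfer lambda -> is_eigenvalue H0 transfer lambda).
Proof.
move=> l01; have [_ _ [C C0 hC]] := gapV_bounded l01.
have [n [A [a [La a0 Ca1 brho ka]]]] := small_kernel C0.
exact: (transfer_alternative l01 C0 hC La a0 Ca1 brho ka).
Qed.

(** * The interval [[0, 1]] *)

Section Continuous.
Context {R : realType}.
Implicit Types (phi psi : R -> R[i]) (t s x y : R) (c z : R[i]).

Lemma dens_ge t : 0 < t -> expR (- t) <= dens t.
Proof.
move=> t0; rewrite /dens ler_pdivlMr; last by rewrite subr_gt0 -expR0 ltr_expR.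
rewrite mulrBr -expRD addNr expR0 mulr1.
by have := expR_ge1Dx (- t); lra.
Qed.

Lemma m_interval (a d : R) : 0 <= a -> 0 < d -> L1 (\1_(`]a, (a + d)%R[)) /\
  0 < mint (\1_(`]a, (a + d)%R[)) <= d.
Proof.
move=> a0 d0; set I := `]a, (a + d)%R[%classic.
have mI : measurable I by exact: measurable_itv.
have Lu : L1 (\1_I).
  apply: L1_le (L1_cst 1) _; first exact: measurable_indic.
  by move=> t _; rewrite indicE; case: (_ \in _) => /=; rewrite ?normr1 ?normr0.
split => //; have [Li ->] := mint_lebesgue Lu.
have IR : I `&` Rpos = I.
  apply/setIidl => t; rewrite /I /= !in_itv/= andbT => /andP[h _]; exact: le_lt_trans h.
have muI : mu I = d%:E.
  rewrite /I lebesgue_measure_itv/= lte_fin ltrDl d0 -EFinB; congr (_%:E); ring.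
have L0 : mu.-integrable Rpos (EFin \o \1_I).
  by apply: (integrableS measurableT) => //; exact: integrable_indic_itv.
have i0 : \int[mu]_(t in Rpos) \1_I t = d.
  by rewrite /Rintegral integral_indic// IR; exact: (congr1 fine muI).
pose c := expR (- (a + d)).
have c0 : 0 < c by exact: expR_gt0.
apply/andP; split.
  apply: (@lt_le_trans _ _ (\int[mu]_(t in Rpos) (c * \1_I t))).
    by rewrite RintegralZl// i0 mulr_gt0.
  apply: le_Rintegral => //.
    by rewrite (_ : EFin \o _ = (fun t => c%:E * (EFin \o \1_I) t))%E//; exact: integrableZl.
  move=> t; rewrite /= in_itv/= andbT => t0; rewrite mulrC.
  rewrite indicE; case: (boolP (t \in I)) => [|_]; last by rewrite !mul0r.
  rewrite inE /I/= in_itv/= => /andP[_ h]; rewrite !mul1r.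
  by apply: (le_trans _ (dens_ge t0)); rewrite ler_expR lerN2 ltW.
rewrite -[leRHS]i0; apply: le_Rintegral => //.
move=> t; rewrite /= in_itv/= andbT => t0.
by rewrite ler_piMr ?dens_le1// indicE ler0n.
Qed.

(** The interval should start at - ln x, but x may be 0; taking y = max(x, e) in place of x costs at
    most e, and e^-t drops by at most e over an interval of length e. *)
Lemma approx_exp (x e : R) : 0 <= x <= 1 -> 0 < e -> e <= 1 ->
  exists2 a : R, 0 <= a & forall t, a < t < a + e -> `|expR (- t) - x| <= 2 * e.
Proof.
move=> /andP[x0 x1] e0 e1; pose y := Num.max x e.
have y0 : 0 < y by rewrite lt_max e0 orbT.
have y1 : y <= 1 by rewrite ge_max x1.
have xy : x <= y by rewrite le_max lexx.
have yx : y <= x + e by rewrite ge_max lerDl lerDr x0 ltW.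
exists (- ln y); first by rewrite oppr_ge0 ln_le0.
move=> t /andP[at_ ta].
have E : expR (- t) = y * expR (- (t + ln y)).
  rewrite opprD expRD expRN [X in _ * (_ * X)]expRN lnK ?posrE//.
  by rewrite mulrC -mulrA mulVf ?gt_eqF// mulr1.
have h1 : expR (- t) <= y by rewrite E ler_piMr ?(ltW y0)// -[leRHS]expR0 ler_expR; lra.
have h2 : y - e <= expR (- t).
  have := expR_ge1Dx (- (t + ln y)); rewrite E => h.
  have : y * (1 + - (t + ln y)) <= y * expR (- (t + ln y)) by rewrite ler_pM2l.
  have : y * (t + ln y) <= 1 * e.
    by apply: ler_pM; [exact: ltW| | |]; lra.
  move: (y * expR _) => Z; nra.
by rewrite ler_norml; apply/andP; split; lra.
Qed.

Lemma resolvent_bound (lambda : R[i]) : resolvent_set H0 H0norm transfer lambda ->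
  exists M : R, forall phi, CL2 phi ->
    normsq phi <= M ^+ 2 * normsq (fun t => Aop phi t + - lambda * phi t).
Proof.
move=> [S [_ SB _ [M hM]]]; exists M => phi Lp.
have Lq : CL2 (fun t => Aop phi t + - lambda * phi t).
  by apply: CL2D; [exact: Aop_CL2|exact: CL2Z].
have e : transfer (laplace phi) - lambda *: laplace phi =
    laplace (fun t => Aop phi t + - lambda * phi t).
  rewrite transfer_laplace// [RHS]laplaceD; [|exact: Aop_CL2|exact: CL2Z].
  by rewrite laplaceZ// scaleNr.
have := hM _ (H0_laplace Lq); rewrite -e SB; last exact: H0_laplace.
rewrite e !H0norm_laplace// => h.
rewrite -[leLHS]sqr_sqrtr ?normsq_ge0// -[X in _ * X]sqr_sqrtr ?normsq_ge0// -exprMn.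
by rewrite lerXn2r ?nnegrE ?sqrtr_ge0//; exact: le_trans (sqrtr_ge0 _) h.
Qed.

(** For the indicator of an interval of mass m1 <= e, the squared norm is m1, linear in the mass,
    whereas N contributes at most m1 pointwise and so m1^2 M1 to the squared norm, quadratic in the
    mass. The multiplication part contributes at most a multiple of e^2 m1, so a bounded inverse is
    impossible for small e. *)
Lemma unit_interval_spectrum (x : R) : 0 <= x <= 1 ->
  spectrum H0 H0norm transfer x%:C%C.
Proof.
move=> x01 /resolvent_bound[M hM].
pose M1 : R := mint (fun=> 1).
have M10 : 0 <= M1 by exact: mint_ge0.
(* With e = 1/K, the terms 8 M^2 e^2 m1 and 2 M^2 M1 m1^2 are at most 8/24 and 2/24 of m1, which
   together stay below m1. *)
pose K := 24 * (M ^+ 2 + 1) * (M1 + 1).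
have M20 : 0 <= M ^+ 2 by exact: sqr_ge0.
have K1 : 1 <= K by rewrite /K; nra.
pose e := K^-1.
have e0 : 0 < e by rewrite invr_gt0; lra.
have e1 : e <= 1 by rewrite invf_le1//; lra.
have [a a0 ha] := approx_exp x01 e0 e1.
set I := `]a, (a + e)%R[%classic.
have [LI /andP[m0 me]] := m_interval a0 e0.
rewrite -/I in LI m0 me; set m1 := mint _ in m0 me.
pose phi t : R[i] := (\1_I t)%:C%C.
have sI t : \1_I t ^+ 2 = \1_I t :> R.
  by rewrite indicE; case: (_ \in _) => /=; rewrite ?expr1n ?expr0n.
have SI : SL2 (\1_I : R -> R).
  by split; [exact: L1_meas|apply: L1_eq LI => t _; rewrite sI].
have Lp : CL2 phi by exact: CL2_real.
have Kre t : 0 < t -> `|mint (fun s => bk t s * reF phi s)| <= m1.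
  move=> t0; have [b1 _] := Kop_L1 bkernel_bk (CL2_CL1 Lp) t0.
  apply: mint_normle => // s s0; rewrite normrM /reF/=.
  have i0 : 0 <= \1_I s :> R by rewrite indicE ler0n.
  by rewrite (ger0_norm i0) ler_piMl// bess_le1// mulr_ge0// ltW.
have Kim t : mint (fun s => bk t s * imF phi s) = 0.
  by rewrite (@mint_eq R _ (fun=> 0)) ?Rintegral_cst ?mul0r// => s _; rewrite /imF/= mulr0.
have Lq : CL2 (fun t => Aop phi t + - x%:C%C * phi t).
  by apply: CL2D; [exact: Aop_CL2|exact: CL2Z].
have Q1 : normsq phi = m1.
  by apply: mint_eq => t _; rewrite /reF /imF/= expr0n addr0 sI.
have Q2 : normsq (fun t => Aop phi t + - x%:C%C * phi t) <= 8 * e ^+ 2 * m1 + 2 * m1 ^+ 2 * M1.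
  have [[_ h1] [_ h2]] := Lq.
  rewrite -!mintZ//; last exact: L1_cst.
  rewrite -mintD; [|exact: L1Z|by apply: L1Z; exact: L1_cst].
  apply: mint_le; [exact: L1D|by apply: L1D; [exact: L1Z|by apply: L1Z; exact: L1_cst]|].
  move=> t t0; have /andP[E0 E1] := expRN_01 t0.
  have -> : imF (fun t => Aop phi t + - x%:C%C * phi t) t = 0.
    by rewrite /imF /Aop /Nop /Kop Kim /=; ring.
  have -> : reF (fun t => Aop phi t + - x%:C%C * phi t) t =
      (expR (- t) - x) * \1_I t + (1 - expR (- t)) * mint (fun s => bk t s * reF phi s).
    by rewrite /reF /Aop /Nop /Kop Kim /=; ring.
  have := Kre t t0; set k := (X in `|X| <= _) => hk; rewrite mulr1 expr0n/= addr0.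
  have hk2 : ((1 - expR (- t)) * k) ^+ 2 <= m1 ^+ 2.
    rewrite -[leLHS]real_normK ?num_real// lerXn2r ?nnegrE ?(ltW m0)//.
    by rewrite normrM; apply: le_trans hk; rewrite ler_piMl// ger0_norm; lra.
  have he2 : ((expR (- t) - x) * \1_I t) ^+ 2 <= 4 * e ^+ 2 * \1_I t.
    rewrite exprMn sI indicE; case: (boolP (t \in I)) => [|_]; last by rewrite !mulr0.
    rewrite inE /I/= in_itv/= => /ha h; rewrite !mulr1 -[leLHS]real_normK ?num_real//.
    by rewrite (_ : 4 * _ = (2 * e) ^+ 2); [rewrite lerXn2r ?nnegrE// mulr_ge0// ltW|ring].
  have := sqr_ge0 ((expR (- t) - x) * \1_I t - (1 - expR (- t)) * k).
  move: hk2 he2; rewrite sqrrB sqrrD.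
  move: ((expR (- t) - x) * \1_I t) ((1 - expR (- t)) * k) (\1_I t) => X Y Z.
  move: (e ^+ 2 * Z) (m1 ^+ 2) (X * Y) (X ^+ 2) (Y ^+ 2) => a1 a2 a3 a4 a5; lra.
have := hM phi Lp; rewrite Q1 => h.
have : m1 <= M ^+ 2 * (8 * e ^+ 2 * m1 + 2 * m1 ^+ 2 * M1).
  by apply: (le_trans h); rewrite ler_wpM2l.
apply/negP; rewrite -ltNge.
have eK : (M ^+ 2 + 1) * (M1 + 1) * e = 24^-1.
  by rewrite /e /K; field; rewrite !gt_eqF//; lra.
have P1 : M ^+ 2 * e <= 24^-1.
  rewrite -eK ler_pM2r//; nra.
have P2 : M ^+ 2 * M1 * m1 <= 24^-1.
  rewrite -eK; apply: ler_pM => //; [exact: mulr_ge0|exact: ltW|nra].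
have P3 : M ^+ 2 * e * (e * m1) <= 24^-1 * m1.
  apply: ler_pM => //; first by rewrite mulr_ge0// ltW.
    by rewrite mulr_ge0// ltW.
  by rewrite ler_piMl// ltW.
have P4 : M ^+ 2 * M1 * m1 * m1 <= 24^-1 * m1 by rewrite ler_pM2r.
rewrite (_ : M ^+ 2 * _ = 8 * (M ^+ 2 * e * (e * m1)) + 2 * (M ^+ 2 * M1 * m1 * m1)); last by ring.
by lra.
Qed.

End Continuous.

(** * Countability of the eigenvalues *)

Section Eigenvalues.
Context {R : realType}.
Implicit Types (phi psi : R -> R[i]) (t s x y : R) (c z : R[i]).

Definition sroot t : R := Num.sqrt (1 - expR (- t)).

Definition sker t s := sroot t * bk t s * sroot s.

Lemma sroot_ge0 t : 0 <= sroot t. Proof. exact: sqrtr_ge0. Qed.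

Lemma sroot_le1 t : 0 < t -> sroot t <= 1.
Proof.
move=> t0; have /andP[e0 e1] := expRN_01 t0.
by rewrite -[leRHS]sqrtr1 ler_wsqrtr// lerBlDr lerDl ltW.
Qed.

Lemma sqr_sroot t : 0 < t -> sroot t ^+ 2 = 1 - expR (- t).
Proof. by move=> t0; have /andP[e0 e1] := expRN_01 t0; rewrite sqr_sqrtr// subr_ge0 ltW. Qed.

Lemma measurable_sroot : measurable_fun setT sroot.
Proof.
apply: continuous_measurable_fun => t.
apply: (@continuous_comp _ _ _ (fun t => 1 - expR (- t))); last exact: sqrt_continuous.
apply: cvgB; first exact: cvg_cst.
have h := @continuous_expRM R (-1) t.
by move: h; rewrite (_ : (fun t => expR (-1 * t)) = fun t : R => expR (- t))//;
  apply/funext => s; rewrite mulN1r.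
Qed.

Lemma sker_le1 t s : 0 < t -> 0 < s -> `|sker t s| <= 1.
Proof.
move=> t0 s0; rewrite !normrM !(ger0_norm (sroot_ge0 _)).
rewrite -[leRHS]mulr1; apply: ler_pM; rewrite ?sroot_ge0 ?sroot_le1//.
  by rewrite mulr_ge0 ?sroot_ge0.
rewrite -[leRHS]mulr1; apply: ler_pM; rewrite ?sroot_ge0 ?sroot_le1//.
by rewrite bess_le1// mulr_ge0// ltW.
Qed.

Lemma measurable_sker : measurable_fun setT (fun x : R * R => sker x.1 x.2).
Proof.
have [mb _] := @bkernel_bk R; have ms := measurable_sroot.
apply: measurable_funM; first apply: measurable_funM => //.
  by apply: (measurableT_comp (f := sroot)) => //; exact: measurable_fst.
by apply: (measurableT_comp (f := sroot)) => //; exact: measurable_snd.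
Qed.

Lemma sker_sym t s : sker t s = sker s t.
Proof. by rewrite /sker /bk [t * s]mulrC; ring. Qed.

Lemma sker_swap (u v : R -> R) : L1 u -> L1 v ->
  mint (fun t => u t * mint (fun s => sker t s * v s)) =
  mint (fun t => v t * mint (fun s => sker t s * u s)).
Proof.
move=> Lu Lv; rewrite (mint_swap measurable_sker sker_le1 Lu Lv).
by apply: mint_eq => t _; congr (_ * _); apply: mint_eq => s _; rewrite sker_sym.
Qed.

Lemma SL2_sker (u : R -> R) : SL2 u -> SL2 (fun t => mint (fun s => sker t s * u s)).
Proof.
move=> Lu; have [Lk mk] := L1_kernel measurable_sker sker_le1 (SL2_L1 Lu).
apply: SL2_le (SL2_cst (mint (fun s => `|u s|))) _ => // t t0.
apply: mint_normle; [exact: Lk|by apply: L1_norm; exact: SL2_L1|].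
by move=> s s0; rewrite normrM ler_piMl// sker_le1.
Qed.

Lemma SL2_sker_row t : 0 < t -> SL2 (sker t).
Proof.
move=> t0; apply: SL2_le (SL2_cst 1) _; last by move=> s s0; exact: sker_le1.
apply: measurable_funTS.
rewrite (_ : sker t = (fun x : R * R => sker x.1 x.2) \o pair t)//.
by apply: measurableT_comp; [exact: measurable_sker|exact: pair1_measurable].
Qed.

(** With D = 1 - e^-t, an eigenfunction satisfies phi = D psi almost everywhere, where psi = (lambda
    - e^-t)^-1 K phi. Setting g = D^(1/2) psi avoids dividing phi by D^(1/2), which vanishes at t =
    0, so g is visibly square-integrable; and because psi is given by a formula, the equation for g
    holds at every t > 0. *)
Lemma eigen_kernel (lambda : R[i]) :
  ~ [set x%:C%C | x in [set x : R | 0 <= x <= 1]] lambda ->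
  is_eigenvalue H0 transfer lambda ->
  exists g, [/\ CL2 g, normsq g != 0 &
    forall t, 0 < t -> gap lambda t * g t = Kop sker g t].
Proof.
move=> l01 [f [/H0P[Lf fE] fl] f0].
have [g0 mg [C C0 hC]] := gapV_bounded l01.
set phi := laplace_inv f in Lf fE.
have LA := Aop_CL2 Lf; have Ll := CL2Z lambda Lf.
have q0 : normsq (fun t => Aop phi t + -1 * (lambda * phi t)) = 0.
  by apply/(laplace_eqP LA Ll); rewrite -transfer_laplace// laplaceZ// fE fl.
have Ld := CL2D LA (CL2Z (-1) Ll).
pose psi t := (gap lambda t)^-1 * Kop bk phi t.
have LK : CL2 (Kop bk phi) by apply: Kop_CL2; [exact: bkernel_bk|exact: CL2_CL1].
have Lpsi : CL2 psi by exact: CL2M_bounded hC.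
pose D t : R[i] := (1 - expR (- t))%:C%C.
have mr := measurable_sroot.
have cr : cmeas (fun t => (sroot t)%:C%C) by apply: cmeas_real; exact: measurable_funTS.
have DE t : 0 < t -> D t = (sroot t)%:C%C * (sroot t)%:C%C.
  by move=> t0; rewrite -rmorphM -expr2 sqr_sroot.
pose g t := (sroot t)%:C%C * psi t.
have sb t : 0 < t -> norm1 (sroot t)%:C%C <= 1.
  by move=> t0; rewrite norm1_real ger0_norm ?sroot_ge0 ?sroot_le1.
have Lg : CL2 g by exact: CL2M_bounded sb.
have Lsg : CL2 (fun t => (sroot t)%:C%C * g t) by exact: CL2M_bounded sb.
have qd : normsq (fun t => phi t + -1 * ((sroot t)%:C%C * g t)) = 0.
  apply/eqP; rewrite eq_le normsq_ge0 andbT.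
  apply: (@le_trans _ _ (C ^+ 2 * normsq (fun t => -1 * (Aop phi t + -1 * (lambda * phi t))))).
    apply: le_trans (normsq_le_mul mg (CL2Z (-1) Ld) (ltW C0) hC).
    rewrite le_eqVlt; apply/orP; left; apply/eqP; apply: mint_eq => t t0.
    rewrite /reF /imF; have -> // : phi t + -1 * ((sroot t)%:C%C * g t) =
        (gap lambda t)^-1 * (-1 * (Aop phi t + -1 * (lambda * phi t))).
    rewrite /g mulrA -DE// /psi /Aop /Nop -/(D t).
    have := g0 t t0; rewrite /gap => gt0; field; exact: gt0.
  by rewrite normsqZ// q0 !mulr0.
exists g; split => //.
- apply: contraNneq f0 => gq0; rewrite -fE; apply/eqP/laplace_ae0 => //.
  have q1 : normsq (fun t => (sroot t)%:C%C * g t) = 0.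
    apply/eqP; rewrite eq_le normsq_ge0 andbT.
    by apply: (le_trans (normsq_le_mul cr Lg ler01 sb)); rewrite gq0 mulr0.
  have := normsq0_L2norm Lf Lsg qd; rewrite /L2norm q1 sqrtr0 => /eqP.
  by rewrite sqrtr_eq0 => h; apply/eqP; rewrite eq_le h normsq_ge0.
- move=> t t0; have gt0 := g0 t t0.
  have Kd : Kop bk phi t = Kop bk (fun s => (sroot s)%:C%C * g s) t.
    have Lb : SL2 (bk t).
      apply: SL2_le (SL2_cst 1) _; last first.
        by move=> s s0; rewrite bess_le1// mulr_ge0// ltW.
      have [mb _] := @bkernel_bk R; apply: measurable_funTS.
      rewrite (_ : bk t = (fun x : R * R => bk x.1 x.2) \o pair t)//.
      by apply: measurableT_comp => //; exact: pair1_measurable.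
    have := cint_ae0 (CL2_real Lb) (CL2D Lf (CL2Z (-1) Lsg)) qd.
    rewrite cint_real -[LHS]/(Kop bk _ t) KopD; [|exact: bkernel_bk|exact: CL2_CL1|
      by apply: CL2_CL1; exact: CL2Z|exact: t0].
    rewrite KopZ; [|exact: bkernel_bk|exact: CL2_CL1|exact: t0].
    by rewrite mulN1r => /subr0_eq.
  rewrite {1}/g /psi mulrCA [gap _ _ * _]mulrA mulfV// mul1r Kd.
  apply: complex_ext; rewrite ?cReM ?cImM/= mul0r ?subr0 ?addr0.
    rewrite -mintZ; last by have [h _] := Kop_L1 bkernel_bk (CL2_CL1 Lsg) t0.
    by apply: mint_eq => s _; rewrite /reF cReM/= /sker; ring.
  rewrite -mintZ; last by have [_ h] := Kop_L1 bkernel_bk (CL2_CL1 Lsg) t0.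
  by apply: mint_eq => s _; rewrite /imF cImM/= /sker; ring.
Qed.

(** For g = p + i q, symmetry of the kernel gives Im(lambda) normsq(g) = <p, K q> - <q, K p> = 0.
    The real and imaginary parts then satisfy the same real equation, and whichever of them is not
    null is normalised. *)
Lemma eigen_real (lambda : R[i]) :
  ~ [set x%:C%C | x in [set x : R | 0 <= x <= 1]] lambda ->
  is_eigenvalue H0 transfer lambda ->
  Im lambda = 0 /\ exists u : R -> R, [/\ SL2 u, mint (fun t => u t ^+ 2) = 1 &
    forall t, 0 < t -> (Re lambda - expR (- t)) * u t = mint (fun s => sker t s * u s)].
Proof.
move=> l01 le; have [g [Lg q0 ge]] := eigen_kernel l01 le.
have [Lp Lq] := Lg; set p := reF g in Lp; set q := imF g in Lq.
have Ep t : 0 < t -> (Re lambda - expR (- t)) * p t - Im lambda * q t =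
    mint (fun s => sker t s * p s).
  move=> t0; have := congr1 Re (ge t t0); rewrite cReM /= => <-.
  by rewrite -/(reF (gap lambda) t) -/(imF (gap lambda) t) gap_re gap_im.
have Eq t : 0 < t -> (Re lambda - expR (- t)) * q t + Im lambda * p t =
    mint (fun s => sker t s * q s).
  move=> t0; have := congr1 Im (ge t t0); rewrite cImM /= => <-.
  by rewrite -/(reF (gap lambda) t) -/(imF (gap lambda) t) gap_re gap_im.
have I0 : Im lambda = 0.
  have : Im lambda * normsq g = 0.
    rewrite /normsq -mintZ; last by apply: L1D; [exact: Lp.2|exact: Lq.2].
    transitivity (mint (fun t => p t * mint (fun s => sker t s * q s) -
                               q t * mint (fun s => sker t s * p s))).
      by apply: mint_eq => t t0; rewrite -Ep// -Eq// -/(p t) -/(q t); ring.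
    rewrite mintB; [|by apply: SL2M => //; exact: SL2_sker|by apply: SL2M => //; exact: SL2_sker].
    by rewrite sker_swap ?subrr//; exact: SL2_L1.
  by move/eqP; rewrite mulf_eq0 (negbTE q0) orbF => /eqP.
split => //.
have normalize (u : R -> R) : SL2 u -> mint (fun t => u t ^+ 2) != 0 ->
    (forall t, 0 < t -> (Re lambda - expR (- t)) * u t = mint (fun s => sker t s * u s)) ->
    exists u : R -> R, [/\ SL2 u, mint (fun t => u t ^+ 2) = 1 &
      forall t, 0 < t -> (Re lambda - expR (- t)) * u t = mint (fun s => sker t s * u s)].
  move=> Lu; set N := (X in X != 0) => u0 Eu.
  have N0 : 0 <= N by apply: mint_ge0 => t _; exact: sqr_ge0.
  pose c := (Num.sqrt N)^-1; exists (fun t => c * u t); split; first exact: SL2Z.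
    have -> : mint (fun t => (c * u t) ^+ 2) = mint (fun t => c ^+ 2 * u t ^+ 2).
      by apply: mint_eq => t _; rewrite exprMn.
    by rewrite mintZ ?Lu.2// -/N /c exprVn sqr_sqrtr// mulVf.
  move=> t t0; rewrite mulrCA Eu//.
  have [Lk _] := L1_kernel measurable_sker sker_le1 (SL2_L1 Lu).
  by rewrite -mintZ; [apply: mint_eq => s _; rewrite mulrCA|exact: Lk].
have [p0|p0] := eqVneq (mint (fun t => p t ^+ 2)) 0; last first.
  by apply: (normalize p) => // t t0; rewrite -Ep// I0 mul0r subr0.
apply: (normalize q) => //; last by move=> t t0; rewrite -Eq// I0 mul0r addr0.
by move: q0; rewrite normsqE// -/p -/q p0 add0r.
Qed.

Lemma eigen_orthogonal (a b : R) (u v : R -> R) : SL2 u -> SL2 v ->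
  (forall t, 0 < t -> (a - expR (- t)) * u t = mint (fun s => sker t s * u s)) ->
  (forall t, 0 < t -> (b - expR (- t)) * v t = mint (fun s => sker t s * v s)) ->
  a != b -> mint (fun t => u t * v t) = 0.
Proof.
move=> Lu Lv Eu Ev ab.
have : (a - b) * mint (fun t => u t * v t) = 0.
  rewrite -mintZ; last exact: SL2M.
  transitivity (mint (fun t => v t * mint (fun s => sker t s * u s) -
                               u t * mint (fun s => sker t s * v s))).
    by apply: mint_eq => t t0; rewrite -Eu// -Ev//; ring.
  rewrite mintB; [|by apply: SL2M => //; exact: SL2_sker|by apply: SL2M => //; exact: SL2_sker].
  by rewrite sker_swap ?subrr//; exact: SL2_L1.
by move/eqP; rewrite mulf_eq0 subr_eq0 (negbTE ab) => /eqP.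
Qed.

(** Induction on n for all h at once: subtracting from h its component along u_n lowers the squared
    norm by the square of that coefficient and leaves the earlier coefficients unchanged. *)
Lemma bessel (n : nat) (u : nat -> R -> R) (h : R -> R) :
  (forall k, SL2 (u k)) -> (forall k, mint (fun t => u k t ^+ 2) = 1) ->
  (forall j k, (j < k)%N -> mint (fun t => u j t * u k t) = 0) -> SL2 h ->
  \sum_(0 <= k < n) mint (fun t => h t * u k t) ^+ 2 <= mint (fun t => h t ^+ 2).
Proof.
move=> Lu u1 uo; elim: n h => [|n ih] h Lh.
  by rewrite big_geq//; apply: mint_ge0 => t _; exact: sqr_ge0.
set c := mint (fun t => h t * u n t).
have Lh' : SL2 (fun t => h t + - c * u n t) by apply: SL2D => //; exact: SL2Z.
rewrite big_nat_recr//= -/c -lerBrDr.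
have -> : mint (fun t => h t ^+ 2) - c ^+ 2 = mint (fun t => (h t + - c * u n t) ^+ 2).
  have [_ l1] := Lh; have [_ l2] := Lu n; have l3 := SL2M Lh (Lu n).
  have -> : mint (fun t => (h t + - c * u n t) ^+ 2) =
      mint (fun t => h t ^+ 2 + (- (2 * c) * (h t * u n t) + c ^+ 2 * u n t ^+ 2)).
    by apply: mint_eq => t _; ring.
  rewrite mintD; [|by []|by apply: L1D; exact: L1Z].
  rewrite mintD; [|exact: L1Z|exact: L1Z].
  by rewrite !mintZ// -/c u1; ring.
apply: le_trans (ih _ Lh'); rewrite le_eqVlt; apply/orP; left; apply/eqP.
apply: eq_big_nat => k /andP[_ kn]; congr (_ ^+ 2).
have -> : mint (fun t => (h t + - c * u n t) * u k t) =
    mint (fun t => h t * u k t + - c * (u k t * u n t)).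
  by apply: mint_eq => t _; ring.
rewrite mintD; [|exact: SL2M|by apply: L1Z; exact: SL2M].
by rewrite mintZ ?uo ?mulr0 ?addr0//; exact: SL2M.
Qed.

(** The eigenvalue equation says that the row [sker t] has coefficient (a_k - e^-t) u_k(t) along
    u_k, which absorbs the non-compact multiplication part. Bessel's inequality at fixed t, with
    |a_k - e^-t| >= e, bounds the sum of e^2 u_k(t)^2 by the squared norm of the row, at most the
    total mass; integrating in t gives the claim. *)
Lemma eigen_finite (e : R) (n : nat) (a : nat -> R) (u : nat -> R -> R) : 0 < e ->
  injective a -> (forall k x, 0 <= x <= 1 -> e <= `|a k - x|) ->
  (forall k, SL2 (u k)) -> (forall k, mint (fun t => u k t ^+ 2) = 1) ->
  (forall k t, 0 < t -> (a k - expR (- t)) * u k t = mint (fun s => sker t s * u k s)) ->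
  n%:R * e ^+ 2 <= mint (fun=> 1) ^+ 2.
Proof.
move=> e0 inja ae Lu u1 Eu.
have uo j k : (j < k)%N -> mint (fun t => u j t * u k t) = 0.
  move=> jk; apply: (eigen_orthogonal (Lu j) (Lu k) (Eu j) (Eu k)).
  by apply: contraTneq jk => /inja ->; rewrite ltnn.
have Lsum := mint_sum (index_iota 0 n) (fun k => L1Z (e ^+ 2) (Lu k).2).
have -> : n%:R * e ^+ 2 = mint (fun t => \sum_(0 <= k < n) e ^+ 2 * u k t ^+ 2).
  rewrite Lsum.2 (eq_bigr (fun=> e ^+ 2)); last first.
    by move=> k _; rewrite mintZ ?u1 ?mulr1//; exact: (Lu k).2.
  by rewrite big_const_nat subn0 iter_addr_0 mulr_natl.
set M := mint (fun=> 1).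
have M1 : mint (fun=> M) = M ^+ 2.
  by rewrite expr2 -mintZ; [apply: mint_eq => t _; rewrite mulr1|exact: L1_cst].
rewrite -M1; apply: mint_le; [exact: Lsum.1|exact: L1_cst|].
move=> t t0; have /andP[e1 e2] := expRN_01 t0.
apply: (@le_trans _ _ (mint (fun s => sker t s ^+ 2))); last first.
  have [_ Ls] := SL2_sker_row t0.
  apply: mint_le => //; first exact: L1_cst.
  move=> s s0; rewrite -[leLHS]real_normK ?num_real// expr_le1//.
  exact: sker_le1.
apply: le_trans (bessel n Lu u1 uo (SL2_sker_row t0)).
apply: ler_sum => k _; rewrite -Eu// exprMn ler_wpM2r ?sqr_ge0//.
by rewrite -[leRHS]real_normK ?num_real// lerXn2r ?nnegrE ?(ltW e0)// ae// !ltW.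
Qed.

Definition real_eigen (e a : R) := (forall x, 0 <= x <= 1 -> e <= `|a - x|) /\
  exists u : R -> R, [/\ SL2 u, mint (fun t => u t ^+ 2) = 1 &
    forall t, 0 < t -> (a - expR (- t)) * u t = mint (fun s => sker t s * u s)].

(** An infinite set would contain an injective sequence, and [eigen_finite] caps the length of its
    initial segments by the squared total mass over e^2. *)
Lemma real_eigen_finite (e : R) : 0 < e -> finite_set [set a : R | real_eigen e a].
Proof.
move=> e0; apply: contrapT => /infiniteP/pcard_leP[f].
have fG k : real_eigen e (f k) by apply: (@funS _ _ _ _ f).
have finj : injective f by move=> j k; apply: inj; rewrite inE.
pose u k := projT1 (cid (fG k).2).
have hu k := projT2 (cid (fG k).2).
pose M : R := mint (fun=> 1); pose N := Num.bound (M ^+ 2 / e ^+ 2).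
have h : N%:R * e ^+ 2 <= M ^+ 2.
  apply: (eigen_finite (u := u) N e0 finj) => [k|k|k|k].
  - exact: (fG k).1.
  - by have [] := hu k.
  - by have [] := hu k.
  - by have [] := hu k.
have e20 : 0 < e ^+ 2 by rewrite exprn_gt0.
have := @archi_boundP _ (M ^+ 2 / e ^+ 2) (divr_ge0 (sqr_ge0 _) (ltW e20)).
by rewrite ltNge ler_pdivlMr// h.
Qed.

Lemma eigenvalues_countable :
  countable [set c : R[i] | is_eigenvalue H0 transfer c /\
    ~ [set x%:C%C | x in [set x : R | 0 <= x <= 1]] c].
Proof.
apply: (@sub_countable _ _ _ (\bigcup_(n in setT)
  [set x%:C%C | x in [set a | real_eigen n.+1%:R^-1 a]])).
  apply: subset_card_le => c [ce c01].
  have [d d0 hd] := spectral_gap c01.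
  have [I0 [u hu]] := eigen_real c01 ce.
  pose n := Num.bound d^-1.
  exists n => //; exists (Re c); last by apply: complex_ext.
  split; last by exists u.
  move=> x x01; have := hd x x01; rewrite /norm1 !raddfB/= I0 subrr normr0 addr0.
  apply: le_trans; rewrite invf_ple ?posrE//; apply/ltW.
  apply: (@lt_trans _ _ n%:R); last by rewrite ltr_nat.
  by apply: archi_boundP; rewrite invr_ge0 ltW.
apply: bigcup_countable => // n _; apply/finite_set_countable/finite_image.
by apply: real_eigen_finite; rewrite invr_gt0.
Qed.

End Eigenvalues.

Local Open Scope complex_scope.

Theorem theorem3 (R : realType) :
  (forall f : disk R -> R[i], H0 f -> H0 (transfer f)) /\
  exists E : set R[i],
    [/\ countable E,
        forall lambda, E lambda ->
          is_eigenvalue H0 transfer lambda /\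
          finite_multiplicity H0 transfer lambda &
        spectrum H0 H0norm transfer =
          [set x%:C | x in [set x : R | 0 <= x <= 1]] `|` E].
Proof.
split; first exact: H0_transfer.
(* [E] is the part of the spectrum outside the interval, so eigenvalues embedded in [0,1] are not
   listed. The set equality then asks only that the interval lie in the spectrum; the Fredholm
   alternative and the countability lemma supply the rest. *)
exists [set c | spectrum H0 H0norm transfer c /\
  ~ [set x%:C | x in [set x : R | 0 <= x <= 1]] c].
have eig c : spectrum H0 H0norm transfer c ->
    ~ [set x%:C | x in [set x : R | 0 <= x <= 1]] c ->
    is_eigenvalue H0 transfer c /\ finite_multiplicity H0 transfer c.
  by move=> sc /transfer_fredholm[fm alt]; split => //; exact: alt.
split.
- apply: (sub_countable _ (@eigenvalues_countable R)).
  by apply: subset_card_le => c [sc c01]; split => //; exact: (eig c sc c01).1.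
- by move=> c [sc c01]; exact: eig.
- apply/seteqP; split=> [c sc|c [[x x01 <-]|[]//]]; last exact: unit_interval_spectrum.
  by have [|] := pselect ([set x%:C | x in [set x : R | 0 <= x <= 1]] c); [left|right].
Qed.
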